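(* The map $(c,t)\mapsto p_c(t)$ is continuous on $\mathbb{T}\times[0,\infty)$.
   Context: $\mathbb{T}=\mathbb{R}/\mathbb{Z}$ is the torus with the doubling map $T\colon x\mapsto 2x \pmod 1$. For $c\in\mathbb{T}$, $\psi_c\colon\mathbb{T}\to[-\infty,+\infty)$ is $\psi_c(x)=2\log(|\sin(\pi(x-c))|)$, with $\log 0=-\infty$. $\mathcal{M}_c$ is the set of $T$-invariant Borel probability measures on $\mathbb{T}$ whose support does not contain $c$. $h(\mu)$ is the measure-theoretic (Kolmogorov–Sinai) entropy of $\mu$ with respect to $T$ (natural logarithm). The pressure is $p_c(t)=\sup_{\mu\in\mathcal{M}_c}\left(h(\mu)+\int t\psi_c\,\mathrm{d}\mu\right)$. *)

(* Defs.v *)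
From HB Require Import structures.
From mathcomp Require Import all_boot all_order all_algebra.
From mathcomp Require Import all_classical all_reals all_analysis.
Set Implicit Arguments.
Unset Strict Implicit.
Unset Printing Implicit Defensive.
Import Order.TTheory GRing.Theory Num.Theory.
Import numFieldNormedType.Exports.
Local Open Scope classical_set_scope.
Local Open Scope ring_scope.

Definition integers (R : realType) : {pred R} := [pred x : R | x \is a Num.int].
Arguments integers : clear implicits.

Fact integers_zmod_closed (R : realType) : zmod_closed (integers R).
Proof.
split=> [|x y]; rewrite ?inE; first exact: rpred0.
exact: rpredB.
Qed.

HB.instance Definition _ (R : realType) :=
  GRing.isZmodClosed.Build R (integers R) (@integers_zmod_closed R).

(* R/Z: the quotient group, with the quotient topology. *)
Definition torus (R : realType) : Type :=
  quotient_topology (Quotient.quot (integers R)).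

HB.instance Definition _ (R : realType) := PointedTopological.on (torus R).
HB.instance Definition _ (R : realType) :=
  GRing.isZmodule.Build (torus R)
    (@Quotient.addqA R (integers R)) (@Quotient.addqC R (integers R))
    (@Quotient.add0q R (integers R)) (@Quotient.addNq R (integers R)).

(* The torus with its Borel sigma-algebra. *)
Definition btorus (R : realType) := g_sigma_algebraType (@open (torus R)).

Definition doubling (R : realType) (x : torus R) : torus R := x *+ 2.

(* [repr (x - c)] is an arbitrary real representative of [x - c]; the value
   does not depend on it since [|sin (pi y)|] is 1-periodic (see [psi_pi]).
   [lne 0 = -oo]. *)
Definition psi (R : realType) (c x : torus R) : \bar R :=
  (2%:E * lne `|sin (pi * repr (x - c))|%:E)%E.

Section Entropy.
Context d (X : measurableType d) (R : realType).
Variables (f : X -> X) (mu : probability X R).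

Definition invariant_measure : Prop :=
  forall A : set X, measurable A -> mu (f @^-1` A) = mu A.

Definition measurable_partition (k : nat) (A : 'I_k -> set X) : Prop :=
  (forall i, measurable (A i)) /\ partition setT A setT.

(* The Shannon entropy of the join of A, f^-1 A, ..., f^-(n-1) A, whose cells
   are indexed by words of length n; [0 * ln 0 = 0]. *)
Definition join_cell (k : nat) (A : 'I_k -> set X) (n : nat)
    (w : {ffun 'I_n -> 'I_k}) : set X :=
  [set x | forall i : 'I_n, A (w i) (iter i f x)].

Definition join_entropy (k : nat) (A : 'I_k -> set X) (n : nat) : R :=
  - \sum_(w : {ffun 'I_n -> 'I_k})
      fine (mu (join_cell A w)) * ln (fine (mu (join_cell A w))).

Definition partition_entropy (k : nat) (A : 'I_k -> set X) : R :=
  limn (fun n => join_entropy A n / n%:R).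

Definition ks_entropy : \bar R :=
  ereal_sup [set h | exists (k : nat) (A : 'I_k -> set X),
    measurable_partition A /\ h = (partition_entropy A)%:E].

End Entropy.

Definition supp (R : realType) (mu : probability (btorus R) R) :
    set (torus R) :=
  [set x | forall U : set (torus R), open U -> U x -> (0 < mu U)%E].

Definition invariant_avoiding (R : realType) (c : torus R) :
    set (probability (btorus R) R) :=
  [set mu | invariant_measure (@doubling R : btorus R -> btorus R) mu /\
            ~ supp mu c].

Definition pressure (R : realType) (c : torus R) (t : R) : \bar R :=
  ereal_sup
    [set (ks_entropy (@doubling R : btorus R -> btorus R) mu +
          \int[mu]_(x in [set: btorus R]) (t%:E * psi c x))%E
    | mu in invariant_avoiding c].

Section Facts.
Variable R : realType.
Implicit Types (x y : R) (m : int).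
Local Open Scope quotient_scope.

Lemma torus_eqP x y :
  reflect (\pi_(torus R) x = \pi_(torus R) y) (x - y \is a Num.int).
Proof.
have -> : (x - y \is a Num.int) = (x - y \in integers R) by [].
by rewrite (Quotient.idealrBE (integers R)); apply: (iffP eqP).
Qed.

Lemma pi_torusD x y :
  \pi_(torus R) (x + y) = \pi_(torus R) x + \pi_(torus R) y.
Proof. exact: (Quotient.pi_add (integers R)). Qed.

Lemma pi_torusN x : \pi_(torus R) (- x) = - \pi_(torus R) x.
Proof. exact: (Quotient.pi_opp (integers R)). Qed.

Lemma doubling_pi x : doubling (\pi_(torus R) x) = \pi_(torus R) (2 * x).
Proof. by rewrite mulr_natl !mulr2n pi_torusD. Qed.

Lemma normr_sin_pi_int x m : `|sin (pi * (x + m%:~R))| = `|sin (pi * x)|.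
Proof.
suff nat_case n y : `|sin (pi * (y + n%:R))| = `|sin (pi * y)|.
  case: m => n; first exact: nat_case.
  by rewrite NegzE mulrNz -[in RHS](subrK n.+1%:R x) nat_case.
elim: n => [|n IH]; first by rewrite addr0.
by rewrite -natr1 addrA mulrDr mulr1 sinDpi normrN.
Qed.

Lemma psi_pi x c : psi (\pi_(torus R) c) (\pi_(torus R) x) =
  (2%:E * lne `|sin (pi * (x - c))|%:E)%E.
Proof.
rewrite /psi -pi_torusN -pi_torusD; set y := repr _.
have /intrP[m e] : y - (x - c) \is a Num.int.
  by apply/torus_eqP; rewrite /y reprK.
by rewrite -(subrK (x - c) y) e addrC normr_sin_pi_int.
Qed.

End Facts.

(* Main.v *)
Require Import Defs.
From HB Require Import structures.
From mathcomp Require Import all_boot all_order all_algebra.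
From mathcomp Require Import all_classical all_reals all_analysis.
From mathcomp Require Import measurable_realfun ring lra zify.
Set Implicit Arguments.
Unset Strict Implicit.
Unset Printing Implicit Defensive.
Import Order.TTheory GRing.Theory Num.Theory.
Import numFieldNormedType.Exports.
Local Open Scope classical_set_scope.
Local Open Scope ring_scope.

(** Write [sg (x - c)] for the chordal distance [|sin (pi (x - c))|], so that
    [psi c x = 2 ln (sg (x - c))].  For a dyadic cell of generation [n] and
    index [k], [birkhoff n k c] bounds from above the sum of the
    [ln (sg (2^j x - c))], [j < n], over the points [x] of the cell, and
      [partition_sum n c t = \sum_k exp (2 t * birkhoff n k c)].
    These sums are continuous in [(c, t)], whatever happens at the singularity
    [c], because [birkhoff] only involves distances that are bounded below.
    Continuity of the pressure follows from two facts.

    Upper semicontinuity: the pressure is the infimum over [n] of the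
    continuous functions [ln (partition_sum n c t) / n].
    - No invariant measure does better ([pressure_le]): by the Gibbs
      inequality, the entropy of a measure is at most the mean information of
      a product law on blocks of [n] digits, and the law with weights
      [exp (2 t * birkhoff n k c)] gives the bound.  Partitions other than
      the dyadic ones are handled by approximation ([ks_entropy_le]).
    - This bound is asymptotically sharp ([pressure_approx]).  If the partition sums grow
      at least like [exp (n b)], some class of words of length [n] with nearly
      the same Birkhoff sum carries that growth up to a small loss in the
      rate ([good_words]).  These words are concatenated freely, separated
      by one fixed spacer word of length [O(log n)].  The spacer is a backward
      orbit that stays away from [c], and its initial point stays at distance
      about [n^-2] from the first [n] images of [c]; the latter prevents an
      orbit that follows a word from coming much closer to [c] than the cell
      does, except at few times ([block_lower_bound]).  Coding independent
      random words and averaging over one block yields an invariant measure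
      supported away from [c], whose entropy and integral are bounded below
      ([block_pressure]).
      Spacers exist because every point has two preimages, which are far
      apart.  The exception is [c = 1/2], whose image is the fixed point [0]:
      there only landing points far from [0] have spacers, and the words that
      land near [0] are controlled by the recursion
      [partition_sum_half_succ].  At [t = 0] the pressure is [ln 2]
      ([pressure0_ge]), by taking almost all blocks.

    Lower semicontinuity ([pressure_lsc]): a measure that gives mass zero to a
    neighbourhood of [c] also avoids every [c'] close to [c], and its integral
    of [psi c'] depends continuously on [c']; hence it is a competitor for all
    nearby parameters, with almost the same value. *)

(** * The circle, its dyadic digits and the chordal distance *)

Section Torus.
Variable R : realType.
Implicit Types (x y z c u : torus R) (r s : R) (n m a b k : nat).

Definition proj (r : R) : torus R := \pi_(torus R)%qT r.

Definition frac x : R := repr x - (Num.floor (repr x))%:~R.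

Lemma projD r s : proj (r + s) = proj r + proj s.
Proof. exact: pi_torusD. Qed.

Lemma projN r : proj (- r) = - proj r.
Proof. exact: pi_torusN. Qed.

Lemma projB r s : proj (r - s) = proj r - proj s.
Proof. by rewrite projD projN. Qed.

Lemma proj_eq r s : r - s \is a Num.int -> proj r = proj s.
Proof. by move=> rs; apply/torus_eqP. Qed.

Lemma proj0 : proj 0 = 0.
Proof. by apply: (addrI (proj 0)); rewrite -projD !addr0. Qed.

Lemma proj_int (m : int) : proj m%:~R = 0.
Proof. by rewrite -proj0; apply: proj_eq; rewrite subr0 intr_int. Qed.

Lemma proj_nat n : proj n%:R = 0.
Proof. by rewrite -(proj_int n). Qed.

Lemma projMn r n : proj (r *+ n) = proj r *+ n.
Proof. by elim: n => [|n IH]; rewrite ?proj0// !mulrS projD IH. Qed.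

Lemma proj_frac x : proj (frac x) = x.
Proof.
rewrite /frac projB proj_int subr0; exact: reprK.
Qed.

Lemma frac_ge0 x : 0 <= frac x.
Proof. by rewrite subr_ge0 floor_le. Qed.

Lemma frac_lt1 x : frac x < 1.
Proof.
by rewrite ltrBlDr; have := floorD1_gt (repr x); rewrite intrD [X in _ < X]addrC.
Qed.

Lemma frac_proj r : 0 <= r < 1 -> frac (proj r) = r.
Proof.
move=> /andP[r0 r1].
have /intrP[m e] : frac (proj r) - r \is a Num.int.
  by apply/torus_eqP; rewrite -/(proj _) proj_frac.
have := frac_ge0 (proj r); have := frac_lt1 (proj r).
have eq : frac (proj r) = m%:~R + r by rewrite -e subrK.
rewrite eq => h1 h2.
have : (m%:~R : R) < 1%:~R by rewrite mulr1z; lra.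
have : ((-1)%:~R : R) < m%:~R by rewrite mulrN1z; lra.
rewrite !ltr_int => m1 m2.
have -> : m = 0 by lia.
by rewrite mulr0z add0r.
Qed.

Lemma iter_doubling n x : iter n (@doubling R) x = x *+ 2 ^ n.
Proof.
elim: n => [|n IH]; first by rewrite expn0 mulr1n.
by rewrite iterS IH /doubling -mulrnA expnSr.
Qed.

(** The first [n] binary digits of [x], read as one integer below [2^n]. *)
Definition dig n x : nat := Num.truncn (2 ^+ n * frac x).

Lemma dig_itv n x : (dig n x)%:R <= 2 ^+ n * frac x < (dig n x).+1%:R.
Proof. by rewrite truncn_itv// mulr_ge0 ?exprn_ge0 ?frac_ge0. Qed.

Lemma digP n x k : k%:R <= 2 ^+ n * frac x < k.+1%:R -> dig n x = k.
Proof. exact: truncn_def. Qed.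

Lemma dig_lt n x : (dig n x < 2 ^ n)%N.
Proof.
rewrite -(ltr_nat R) natrX; have /andP[h _] := dig_itv n x.
apply: (le_lt_trans h); rewrite gtr_pMr ?exprn_gt0//; exact: frac_lt1.
Qed.

Lemma frac_mul n x : frac (x *+ 2 ^ n) = 2 ^+ n * frac x - (dig n x)%:R.
Proof.
have /andP[h1 h2] := dig_itv n x.
rewrite -[x in LHS]proj_frac -projMn.
rewrite -[LHS]/(frac (proj _)) -[in RHS]natrX mulr_natl.
have -> : proj (frac x *+ 2 ^ n) = proj (frac x *+ 2 ^ n - (dig n x)%:R).
  by rewrite projB proj_nat subr0.
rewrite frac_proj//; move: h1 h2; rewrite -natrX mulr_natl -natr1 => h1 h2.
by apply/andP; split; lra.
Qed.

(** Doubling [a] times drops the first [a] digits. *)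
Lemma digD a b x : dig (a + b) x = (dig a x * 2 ^ b + dig b (x *+ 2 ^ a))%N.
Proof.
apply: digP; have := dig_itv b (x *+ 2 ^ a); rewrite frac_mul.
have -> : 2 ^+ (a + b) * frac x =
  2 ^+ b * (2 ^+ a * frac x - (dig a x)%:R) + (dig a x * 2 ^ b)%:R :> R.
  by rewrite natrM natrX exprD; ring.
move: (_ * (_ - _)) => w /andP[h1 h2].
by rewrite -addnS !natrD; apply/andP; split; lra.
Qed.

Lemma dig_eq n x y : dig n x = dig n y -> `|frac x - frac y| < 2 ^- n.
Proof.
move=> e; have := dig_itv n x; have := dig_itv n y; rewrite e -!(natr1 (dig n y)).
move: (dig n y)%:R => d /andP[h1 h2] /andP[h3 h4].
have p0 : 0 < 2 ^+ n :> R by rewrite exprn_gt0.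
suff : 2 ^+ n * `|frac x - frac y| < 1.
  by rewrite mulrC -ltr_pdivlMr// mul1r.
rewrite -[X in X * _](@ger0_norm _ (2 ^+ n)) ?ltW// -normrM ltr_norml mulrBr.
by apply/andP; split; lra.
Qed.

Lemma dig_proj n k r : (k < 2 ^ n)%N -> 0 <= r < 1 ->
  dig n (proj ((k%:R + r) / 2 ^+ n)) = k.
Proof.
move=> kn /andP[r0 r1]; have p0 : 0 < 2 ^+ n :> R by rewrite exprn_gt0.
have kn' : k%:R + 1 <= 2 ^+ n :> R by rewrite natr1 -natrX ler_nat.
have h0 : 0 <= (k%:R + r) / 2 ^+ n by rewrite divr_ge0 ?addr_ge0// ltW.
have h1 : (k%:R + r) / 2 ^+ n < 1 by rewrite ltr_pdivrMr// mul1r; lra.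
apply: digP; rewrite frac_proj ?h0// mulrC divfK ?gt_eqF// -natr1.
by apply/andP; split; lra.
Qed.

Lemma proj_mulX r n : proj r *+ 2 ^ n = proj (2 ^+ n * r).
Proof. by rewrite -projMn -natrX mulr_natl. Qed.

(** Half the length of the chord between [exp (2 pi i x)] and [1]: a
    translation-invariant metric for which [psi c x = 2 ln (sg (x - c))]. *)
Definition sg x : R := `|sin (pi * repr x)|.

Lemma sg_proj r : sg (proj r) = `|sin (pi * r)|.
Proof.
have /intrP[m e] : repr (proj r) - r \is a Num.int.
  by apply/torus_eqP; rewrite reprK.
by rewrite /sg -(subrK r (repr _)) e addrC normr_sin_pi_int.
Qed.

Lemma sg_ge0 x : 0 <= sg x. Proof. exact: normr_ge0. Qed.

Lemma sg_le1 x : sg x <= 1. Proof. exact: sin_max. Qed.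

Lemma sg0 : sg 0 = 0.
Proof. by rewrite -proj0 sg_proj mulr0 sin0 normr0. Qed.

Lemma sgN x : sg (- x) = sg x.
Proof. by rewrite -(proj_frac x) -projN !sg_proj mulrN sinN normrN. Qed.

Lemma sgBC x y : sg (x - y) = sg (y - x).
Proof. by rewrite -sgN opprB. Qed.

Lemma sgD x y : sg (x + y) <= sg x + sg y.
Proof.
rewrite -(proj_frac x) -(proj_frac y) -projD !sg_proj mulrDr sinD.
apply: (le_trans (ler_normD _ _)); rewrite !normrM lerD//.
  by rewrite ler_piMr// cos_max.
by rewrite ler_piMl// cos_max.
Qed.

Lemma sg_triangle y x z : sg (x - z) <= sg (x - y) + sg (y - z).
Proof. by have := sgD (x - y) (y - z); rewrite addrA subrK. Qed.

Lemma sg_mulX n x : sg (x *+ 2 ^ n) <= 2 ^+ n * sg x.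
Proof.
elim: n => [|n IH]; first by rewrite expn0 mulr1n expr0 mul1r.
rewrite expnSr mulrnA mulr2n; apply: (le_trans (sgD _ _)).
by rewrite exprS; lra.
Qed.

Lemma sg_gt0 x : x != 0 -> 0 < sg x.
Proof.
move=> x0; have f0 : 0 < frac x.
  rewrite lt_neqAle frac_ge0 andbT; apply: contra x0 => /eqP h.
  by rewrite -(proj_frac x) -h proj0.
rewrite -(proj_frac x) sg_proj normr_gt0 gt_eqF// sin_gt0_pi// mulr_gt0 ?pi_gt0//=.
by rewrite gtr_pMr ?pi_gt0// frac_lt1.
Qed.

Definition half : torus R := proj 2^-1.

Lemma half2 : half + half = 0.
Proof. by rewrite -projD -[2^-1]mul1r -splitr -(proj_nat 1). Qed.

Lemma sg_half : sg half = 1.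
Proof. by rewrite sg_proj sin_pihalf normr1. Qed.

(** Antipodal points cannot both be close to [0]; this is what leaves, among
    the two preimages of a point, one that is far from the singularity. *)
Lemma sg_sqr x : sg x ^+ 2 + sg (x + half) ^+ 2 = 1.
Proof.
rewrite -(proj_frac x) /half -projD !sg_proj (mulrDr pi (frac x)) sinDpihalf.
by rewrite !real_normK ?num_real// addrC cos2Dsin2.
Qed.

Lemma sin_le_norm r : `|sin r| <= `|r|.
Proof.
wlog r0 : r / 0 <= r.
  move=> h; have [/h//|/ltW rlt0] := leP 0 r.
  by have := h (- r); rewrite sinN !normrN; apply; rewrite oppr_ge0.
have [x1|z _] := @MVT_segment _ sin cos 0 r r0 _ _.
  exact/continuous_subspaceT/continuous_sin.
by rewrite sin0 !subr0 => ->; rewrite normrM ler_piMl// cos_max.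
Qed.

Lemma sg_le r : sg (proj r) <= pi * `|r|.
Proof.
by rewrite sg_proj (le_trans (sin_le_norm _))// normrM ger0_norm// pi_ge0.
Qed.

Lemma dbl0 x : x *+ 2 = 0 -> x = 0 \/ x = half.
Proof.
move=> x2; have := frac_ge0 x; have := frac_lt1 x => x1 x0.
have : frac (x *+ 2 ^ 1) = 0 by rewrite expn1 x2 -proj0 frac_proj// lexx ltr01.
rewrite frac_mul expr1; have := dig_lt 1 x; rewrite expn1.
case: dig => [|[|//]] _ h; [left|right]; rewrite -(proj_frac x).
  by rewrite (_ : frac x = 0) ?proj0//; lra.
by rewrite /half; congr proj; lra.
Qed.

Lemma halvable z : exists u, u *+ 2 = z.
Proof.
exists (proj (frac z / 2)); rewrite -projMn mulr2n -splitr.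
exact: proj_frac.
Qed.

Lemma halfD2 u : (u + half) *+ 2 = u *+ 2.
Proof. by rewrite mulrnDl [half *+ 2]mulr2n half2 addr0. Qed.

Lemma addhalf_neq u : u + half != u.
Proof.
apply/eqP => h; have : half = 0 by apply: (addrI u); rewrite h addr0.
by move=> h'; have := sg_half; rewrite h' sg0 => /eqP; rewrite eq_sym oner_eq0.
Qed.

(** Distinct points with the same image under [T^L] differ by a multiple of
    [2^-L], hence are separated; this allows counting preimages by
    separation. *)
Lemma sg_sep L x : x *+ 2 ^ L = 0 -> x != 0 -> 2 / 2 ^+ L <= sg x.
Proof.
have p0 n : 0 < 2 ^+ n :> R by rewrite exprn_gt0.
elim: L x => [|L IH] x; first by rewrite expn0 mulr1n => ->; rewrite eqxx.
have -> : 2 / 2 ^+ L.+1 = 1 / 2 ^+ L :> R.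
  by rewrite exprS; field; rewrite gt_eqF.
rewrite expnS mulrnA => xL x0.
have [x2|x2] := eqVneq (x *+ 2) 0.
  case: (dbl0 x2) => xe; first by rewrite xe eqxx in x0.
  rewrite xe sg_half mul1r.
  by rewrite invf_le1 ?exprn_gt0// exprn_ege1// ler1n.
have := sg_mulX 1 x; rewrite expn1 expr1; have := IH _ xL x2.
by lra.
Qed.

End Torus.

(** * Topology and measurability on the circle *)

Section TorusTopology.
Variable R : realType.
Implicit Types (x y z c u : torus R) (r s : R) (n m a b k : nat).

Lemma open_torusE (U : set (torus R)) : open U <-> open (@proj R @^-1` U).
Proof. by []. Qed.

Lemma continuous_sg_proj c : continuous (fun r : R => sg (proj r - c)).
Proof.
have -> : (fun r : R => sg (proj r - c)) = (fun r : R => `|sin (pi * (r - frac c))|).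
  by apply/funext => r; rewrite -[in LHS](proj_frac c) -projB sg_proj.
move=> r; apply: (@continuous_comp _ _ _ (fun r => sin (pi * (r - frac c))) Num.norm).
  apply: (@continuous_comp _ _ _ (fun r => (pi * (r - frac c))) sin).
    apply: cvgM; first exact: cvg_cst.
    by apply: cvgB; [exact: cvg_id|exact: cvg_cst].
  exact: continuous_sin.
exact: norm_continuous.
Qed.

Lemma continuous_sgB c : continuous (fun x => sg (x - c)).
Proof. by apply/quotient_continuous; exact: continuous_sg_proj. Qed.

Lemma open_sgB c (e : R) : open [set x | sg (x - c) < e].
Proof.
have /continuousP h := @continuous_sgB c. by have := h [set r | r < e]; apply; exact: open_lt.
Qed.

Lemma sin_ge (e u : R) : 0 < e <= 2^-1 -> e <= u <= 1 - e -> sin (pi * e) <= sin (pi * u).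
Proof.
move=> /andP[e0 e1] /andP[u0 u1]; have p0 := @pi_gt0 R.
wlog uh : u u0 u1 / u <= 2^-1.
  move=> h; have [/h|/ltW hu] := leP u 2^-1; first exact.
  have -> : pi * u = - (pi * (1 - u)) + pi by ring.
  by rewrite sinDpi sinN opprK; apply: h; lra.
rewrite le_eqVlt; have [->|ne] := eqVneq e u; first by rewrite eqxx.
apply/orP; right; rewrite ltr_sin; first by rewrite ltr_pM2l// lt_neqAle ne.
- by rewrite in_itv/=; apply/andP; split; nra.
- by rewrite in_itv/=; apply/andP; split; nra.
Qed.

(** The sets [sg (x - c) < d] form a basis of neighbourhoods of [c] in the
    quotient topology: near [0] and near [1], [sin (pi u)] is small only if [u]
    is close to an integer. *)
Lemma nbhd_sg (U : set (torus R)) c : open U -> U c ->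
  exists2 d : R, 0 < d & forall x, sg (x - c) < d -> U x.
Proof.
move=> oU Uc; have oV : open (@proj R @^-1` U) by [].
have : nbhs (frac c) (@proj R @^-1` U).
  by apply: open_nbhs_nbhs; split => //; rewrite /preimage /= proj_frac.
move=> /nbhs_ballP[e /= e0 he].
pose e' := Num.min (e / 2) 4^-1.
have e'0 : 0 < e' by rewrite lt_min; apply/andP; split; lra.
have e'e : e' < e by apply: (le_lt_trans (_ : _ <= e / 2)); [rewrite ge_min lexx|lra].
have e'q : e' <= 4^-1 by rewrite ge_min lexx orbT.
have hU v : `|v| <= e' -> U (proj (frac c + v)).
  move=> ve; apply: (he (frac c + v)); rewrite -ball_normE /= opprD addNKr normrN.
  exact: le_lt_trans e'e.
exists (sin (pi * e')).
  apply: sin_gt0_pi; have p0 := @pi_gt0 R; apply/andP; split; nra.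
move=> x; rewrite ltNge => /negP h.
have u0 := frac_ge0 (x - c); have u1 := frac_lt1 (x - c).
have xE v : v - frac (x - c) \is a Num.int -> x = proj (frac c + v).
  by move=> /proj_eq vE; rewrite projD vE !proj_frac addrC subrK.
have [ue|eu] := leP (frac (x - c)) e'.
  rewrite (xE (frac (x - c))); last by rewrite subrr.
  by apply: hU; rewrite ger0_norm.
have [ue'|eu'] := leP (1 - e') (frac (x - c)).
  rewrite (xE (frac (x - c) - 1)).
    by apply: hU; rewrite ler0_norm; lra.
  by rewrite addrAC subrr sub0r rpredN rpred1.
exfalso; apply: h; rewrite -(proj_frac (x - c)) sg_proj.
rewrite (le_trans _ (ler_norm _))//; apply: sin_ge; apply/andP; split; lra.
Qed.

Lemma continuous_doubling : continuous (@doubling R).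
Proof.
apply/quotient_continuous.
have -> : @doubling R \o \pi_(torus R)%qT = (@proj R) \o (fun r => 2 * r).
  by apply/funext => r /=; rewrite doubling_pi.
move=> r; apply: continuous_comp; first exact: mulrl_continuous.
exact: pi_continuous.
Qed.

Lemma open_proj (O : set R) : open O -> open (@proj R @` O).
Proof.
move=> oO; apply/open_torusE.
have -> : proj (R:=R) @^-1` (proj (R:=R) @` O) =
  \bigcup_(m : int) ((fun r => r + m%:~R) @^-1` O).
  apply/seteqP; split => r /=.
    move=> [s Os /torus_eqP /intrP[m e]]; exists m => //=.
    by rewrite -e addrC subrK.
  by move=> [m _ /= Om]; exists (r + m%:~R) => //; rewrite projD proj_int addr0.
apply: bigcup_open => m _; apply: open_comp => // r _.
by apply: cvgD; [exact: cvg_id|exact: cvg_cst].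
Qed.

Lemma measurable_open_torus (U : set (btorus R)) : open (U : set (torus R)) -> measurable U.
Proof. by move=> oU; exact: sub_sigma_algebra. Qed.

Lemma measurable_proj : measurable_fun [set: R] (@proj R : R -> btorus R).
Proof.
apply: (@measurability _ _ _ (btorus R) _ _ (@open (torus R)) erefl).
move=> _ [U oU <-]; rewrite setTI.
by apply: open_measurable; exact: oU.
Qed.

Lemma measurable_doubling : measurable_fun [set: btorus R] (@doubling R : btorus R -> btorus R).
Proof.
apply: (@measurability _ _ _ (btorus R) _ _ (@open (torus R)) erefl).
move=> _ [U oU <-]; rewrite setTI.
apply: measurable_open_torus.
by have /continuousP := continuous_doubling; exact.
Qed.

(** The map [frac] jumps at [0], so that this set is not open.  It is the
    union of the image of an open interval and of the single point [0], here
    written as the complement of an open set. *)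
Lemma frac_lt_preimage r : 0 < r <= 1 ->
  [set x | frac x < r] = (~` (@proj R @` `]0, 1[)) `|` (@proj R @` `]0, r[).
Proof.
move=> /andP[r0 r1]; apply/seteqP; split => x /=.
  move=> xr; have := frac_ge0 x; rewrite le_eqVlt => /orP[/eqP x0|x0]; last first.
    by right; exists (frac x); rewrite ?proj_frac//= in_itv/= x0.
  left=> -[s]; rewrite /= in_itv/= => /andP[s0 s1] e.
  by move: x0; rewrite -e frac_proj ?s1 ?ltW// => s00; rewrite -s00 ltxx in s0.
move=> [h|[s]]; last first.
  by rewrite /= in_itv/= => /andP[s0 sr] <-; rewrite frac_proj// ltW//=; lra.
have := frac_ge0 x; rewrite le_eqVlt => /orP[/eqP <-//|x0].
by exfalso; apply: h; exists (frac x); rewrite ?proj_frac//= in_itv/= x0 frac_lt1.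
Qed.

Lemma measurable_frac : measurable_fun [set: btorus R] (@frac R : btorus R -> R).
Proof.
move=> mD; apply: (measurability _ (RGenInftyO.measurableE R)) => //.
move=> _ [_ [r ->] <-]; rewrite setTI.
have -> : (@frac R : btorus R -> R) @^-1` `]-oo, r[ = [set x | frac x < r].
  by apply/seteqP; split => x /=; rewrite in_itv.
have [r0|r0] := leP r 0.
  suff -> : [set x | frac x < r] = set0 by exact: measurable0.
  apply/seteqP; split => // x /= xr.
  by have := lt_le_trans xr (le_trans r0 (frac_ge0 x)); rewrite ltxx.
have [r1|r1] := leP r 1; last first.
  suff -> : [set x | frac x < r] = setT by exact: measurableT.
  by apply/seteqP; split => // x _ /=; exact: lt_trans (frac_lt1 x) r1.
rewrite frac_lt_preimage ?r0//; apply: measurableU.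
  by apply: measurableC; apply: measurable_open_torus; apply: open_proj; exact: interval_open.
by apply: measurable_open_torus; apply: open_proj; exact: interval_open.
Qed.

Definition cell n k : set (btorus R) := [set x | dig n x = k].

Lemma measurable_cell n k : measurable (cell n k).
Proof.
have -> : cell n k = (@frac R : btorus R -> R) @^-1` [set r | k%:R <= 2 ^+ n * r < k.+1%:R].
  apply/seteqP; split => x /=; first by move=> <-; exact: dig_itv.
  exact: digP.
rewrite -[X in measurable X]setTI; apply: measurable_frac => //.
have -> : [set r : R | k%:R <= 2 ^+ n * r < k.+1%:R] = `[k%:R / 2 ^+ n, k.+1%:R / 2 ^+ n[%classic.
  have p0 : 0 < 2 ^+ n :> R by rewrite exprn_gt0.
  apply/seteqP; split => r /=; rewrite in_itv/= ler_pdivrMr// ltr_pdivlMr// mulrC//.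
  by rewrite mulrC.
Qed.

Lemma measurable_sgB c : measurable_fun [set: btorus R] (fun x : btorus R => sg ((x : torus R) - c)).
Proof.
have -> : (fun x : btorus R => sg ((x : torus R) - c)) =
  (fun r : R => sg (proj r - c)) \o (@frac R : btorus R -> R).
  by apply/funext => x /=; rewrite proj_frac.
apply: measurableT_comp; last exact: measurable_frac.
by apply: continuous_measurable_fun; exact: continuous_sg_proj.
Qed.

Lemma psiE c x : psi c x = (2%:E * lne (sg (x - c))%:E)%E.
Proof. by []. Qed.

Lemma psi_ln c x : 0 < sg (x - c) -> psi c x = (2 * ln (sg (x - c)))%:E.
Proof. by move=> x0; rewrite psiE lne_EFin//. Qed.

Lemma psi_le0 c x : (psi c x <= 0)%E.
Proof.
rewrite psiE; have := sg_ge0 (x - c); rewrite le_eqVlt => /orP[/eqP <-|h].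
  by rewrite le0_lneNy// gt0_muleNy ?lte_fin// leNye.
by rewrite lne_EFin// -EFinM lee_fin mulr_ge0_le0// ln_le0// sg_le1.
Qed.

Lemma measurable_psi c : measurable_fun [set: btorus R] (psi c : btorus R -> \bar R).
Proof.
have -> : psi c = fun x : btorus R => if 0 < sg ((x : torus R) - c)
    then (2 * ln (sg ((x : torus R) - c)))%:E else -oo%E.
  apply/funext => x; case: ifPn => [/psi_ln//|]; rewrite lt_neqAle sg_ge0 andbT negbK => /eqP h.
  by rewrite psiE -h le0_lneNy// gt0_muleNy// lte_fin.
apply: measurable_fun_ifT => //.
  by apply: measurable_fun_ltr => //; exact: measurable_sgB.
apply/measurable_EFinP; apply: measurable_funM => //.
by apply: measurableT_comp; [exact: measurable_ln|exact: measurable_sgB].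
Qed.

Lemma exp2_arch r : exists n, r < 2 ^+ n.
Proof.
have [r0|r0] := leP r 0; first by exists 0%N; rewrite expr0; lra.
exists (Num.truncn r).+1; have /andP[_ h] := truncn_itv (ltW r0).
by apply: (lt_trans h); rewrite -natrX ltr_nat ltn_expl.
Qed.

(** There are countably many cells and their diameters tend to [0]; hence the
    cells generate the Borel sets. *)
Lemma open_bigcup_cell (U : set (torus R)) : open U ->
  U = \bigcup_(p in [set p : nat * nat | cell p.1 p.2 `<=` U]) cell p.1 p.2.
Proof.
move=> oU; apply/seteqP; split => x /=; last by move=> [p /= pU xp]; exact: pU.
move=> Ux; have [d d0 dU] := nbhd_sg oU Ux.
have [n hn] := exp2_arch (pi / d).
exists (n, dig n x) => //= y yx; apply: dU.
have -> : y - x = proj (frac y - frac x) by rewrite projB !proj_frac.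
apply: le_lt_trans (sg_le _) _; apply: lt_trans (_ : pi * 2 ^- n < d).
  rewrite ltr_pM2l ?pi_gt0//; exact: dig_eq.
by rewrite ltr_pdivrMr ?exprn_gt0// mulrC -ltr_pdivrMr.
Qed.

(** The empty set is included to make the family stable under
    intersection, as the uniqueness theorem for measures requires. *)
Definition cells : set (set (btorus R)) := [set A | A = set0 \/ exists n k, A = cell n k].

Lemma measurable_cells : @measurable _ (btorus R) = <<s cells >>.
Proof.
apply/seteqP; split.
  apply: smallest_sub; first exact: smallest_sigma_algebra.
  move=> U oU; rewrite [U]open_bigcup_cell//.
  pose CT := g_sigma_algebraType cells.
  rewrite bigcup_mkcond; apply: (@countable_bigcupT_measurable _ CT) => // p.
    by case: ifPn => _; apply: sub_sigma_algebra; [right; exists p.1, p.2|left].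
apply: smallest_sub; first exact: sigma_algebra_measurable.
move=> A [->|[n [k ->]]]; [exact: measurable0|exact: measurable_cell].
Qed.

(** Two cells are nested or disjoint, the digits of the coarser generation
    being a prefix of those of the finer one. *)
Lemma setI_closed_cells : setI_closed cells.
Proof.
have E n k m l : (n <= m)%N -> cells (cell n k `&` cell m l).
  move=> nm; have dE (x : btorus R) : (dig m x %/ 2 ^ (m - n))%N = dig n x.
    have -> : dig m x = (dig n x * 2 ^ (m - n) + dig (m - n) ((x : torus R) *+ 2 ^ n))%N.
      by rewrite -digD subnKC.
    by rewrite divnMDl ?expn_gt0// divn_small ?addn0// dig_lt.
  have [kl|kl] := eqVneq (l %/ 2 ^ (m - n))%N k.
    right; exists m, l; apply/seteqP; split => [x [//]|x xl]; split => //.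
    by move: kl; have <- : dig m x = l := xl; rewrite dE.
  left; apply/seteqP; split => // x [xk xl]; move/eqP: kl; apply.
  by have <- : dig m x = l := xl; rewrite dE.
move=> A B [->|[n [k ->]]]; first by rewrite set0I; left.
move=> [->|[m [l ->]]]; first by rewrite setI0; left.
by have [/E//|/ltnW/E] := leqP n m; rewrite setIC; apply.
Qed.

End TorusTopology.

(** * Laws of finite-valued maps and the Gibbs inequality *)

Section Gibbs.
Variable R : realType.

Lemma ln_div_le (p q : R) : 0 < p -> 0 < q -> p * (ln q - ln p) <= q - p.
Proof.
move=> p0 q0; rewrite -ln_div//.
have qp0 : 0 < q / p by rewrite divr_gt0.
have h : ln (q / p) <= q / p - 1.
  have := @le_ln1Dx R (q / p - 1); have -> : 1 + (q / p - 1) = q / p by ring.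
  by apply; lra.
apply: (@le_trans _ _ (p * (q / p - 1))); first by rewrite ler_pM2l.
by rewrite mulrBr mulrCA divff ?gt_eqF// !mulr1.
Qed.

(** Gibbs inequality, with the information of the image law on the left: a
    point of the finer space has mass at most that of its image. *)
Lemma gibbs_marginal (K I : finType) (phi : K -> I) (P Q : K -> R) (p : I -> R) :
  (forall k, 0 <= P k) -> (forall k, 0 <= Q k) -> (forall k, Q k = 0 -> P k = 0) ->
  (forall k, P k <= p (phi k)) -> \sum_k P k = 1 -> \sum_k Q k <= 1 ->
  - \sum_k P k * ln (p (phi k)) <= - \sum_k P k * ln (Q k).
Proof.
move=> P0 Q0 QP Pp P1 Q1; rewrite lerN2 -subr_le0 -sumrB.
apply: (@le_trans _ _ (\sum_k (Q k - P k))); last by rewrite sumrB P1 subr_le0.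
apply: ler_sum => k _; rewrite -mulrBr.
have := P0 k; rewrite le_eqVlt => /orP[/eqP <-|Pk]; first by rewrite mul0r subr0.
have Qk : 0 < Q k.
  by rewrite lt_neqAle Q0 andbT; apply/eqP => /esym/QP Pk0; rewrite Pk0 ltxx in Pk.
have pk : 0 < p (phi k) := lt_le_trans Pk (Pp k).
have Pl : P k * ln (P k) <= P k * ln (p (phi k)) by rewrite ler_pM2l// ler_ln ?posrE.
by have := ln_div_le Pk Qk; rewrite !mulrBr; lra.
Qed.

End Gibbs.

Section Law.
Context d (X : measurableType d) (R : realType) (mu : probability X R).

(** Partitions are handled through their index maps, which makes refinement,
    joins and factors into pairing and composition of maps. *)
Definition fmeasurable (J : finType) (F : X -> J) := forall j, measurable (F @^-1` [set j]).

Definition law (J : finType) (F : X -> J) (j : J) : R := fine (mu (F @^-1` [set j])).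

Lemma law_ge0 (J : finType) (F : X -> J) j : 0 <= law F j.
Proof. exact: fine_ge0. Qed.

Lemma lawE (J : finType) (F : X -> J) j : fmeasurable F -> mu (F @^-1` [set j]) = (law F j)%:E.
Proof. by move=> mF; rewrite fineK// fin_num_measure//. Qed.

Lemma fmeasurable_comp (J J' : finType) (F : X -> J) (phi : J -> J') :
  fmeasurable F -> fmeasurable (phi \o F).
Proof.
move=> mF j'; have -> : (phi \o F) @^-1` [set j'] =
    \bigcup_(j in [set j | phi j = j']) (F @^-1` [set j]).
  by apply/seteqP; split => [x /= h|x [j /= pj Fx]]; [exists (F x)|rewrite Fx].
apply: fin_bigcup_measurable => // j _; exact: mF.
Qed.

Lemma measurable_fin_comp (J : finType) (F : X -> J) (g : J -> R) : fmeasurable F ->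
  measurable_fun [set: X] (fun x => g (F x)).
Proof.
move=> mF _ B mB; rewrite setTI.
have -> : (fun x => g (F x)) @^-1` B =
  \bigcup_(j in [set j | B (g j)]) (F @^-1` [set j]).
  by apply/seteqP; split => [x /= h|x [j /= pj Fx]]; [exists (F x)|rewrite /= Fx].
by apply: fin_bigcup_measurable => // j _; exact: mF.
Qed.

Lemma integral_law (J : finType) (F : X -> J) (g : J -> R) : fmeasurable F ->
  (\int[mu]_x (g (F x))%:E = (\sum_j law F j * g j)%:E)%E.
Proof.
move=> mF.
have cov : \big[setU/set0]_(j <- enum J) (F @^-1` [set j]) = setT.
  apply/seteqP; split => // x _; rewrite -bigcup_seq; exists (F x) => //=.
  by rewrite mem_enum.
have mg := measurable_fin_comp g mF.
rewrite -[in LHS]cov integral_bigsetU_EFin//=.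
- rewrite -sumEFin big_enum; apply: eq_bigr => j _.
  rewrite (eq_integral (fun=> (g j)%:E)); last by move=> x; rewrite inE => ->.
  have e := lawE j mF; rewrite (integral_cst mu (mF j)).
  by rewrite -[X in (_ * X)%E]/(mu (F @^-1` [set j])) e -EFinM mulrC.
- exact: enum_uniq.
- by move=> i j _ _ [x /= [<- <-]].
- by apply/measurable_EFinP; rewrite cov.
Qed.

Lemma law_sum1 (J : finType) (F : X -> J) : fmeasurable F -> \sum_j law F j = 1.
Proof.
move=> mF; have := integral_law (fun=> 1) mF.
rewrite (integral_cst mu measurableT) -[X in (_ * X)%E]/(mu setT) probability_setT mule1 => -[->].
by apply: eq_bigr => j _; rewrite mulr1.
Qed.

Lemma measure_law (J : finType) (F : X -> J) (A : pred J) : fmeasurable F ->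
  mu [set x | A (F x)] = (\sum_(j | A j) law F j)%:E.
Proof.
move=> mF; have mA : measurable [set x | A (F x)].
  have -> : [set x | A (F x)] = (A \o F) @^-1` [set true].
    by apply/seteqP; split => x /=.
  exact: fmeasurable_comp.
rewrite -[in LHS](setIT [set _ | _]).
have := @integral_indic _ _ _ mu setT measurableT _ mA => {1}<-.
have -> : (\int[mu]_x (\1_[set x | A (F x)] x)%:E)%E = (\int[mu]_x ((A (F x))%:R)%:E)%E.
  apply: eq_integral => x _; rewrite indicE.
  by have -> : (x \in [set x0 | A (F x0)]) = A (F x) by apply/idP/idP; rewrite inE.
rewrite (integral_law (fun j => (A j)%:R))//; congr EFin.
rewrite [RHS]big_mkcond; apply: eq_bigr => j _; case: (A j); rewrite ?mulr1 ?mulr0//.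
Qed.

Lemma law_comp (J J' : finType) (F : X -> J) (phi : J -> J') j' : fmeasurable F ->
  law (phi \o F) j' = \sum_(j | phi j == j') law F j.
Proof.
move=> mF; have := @measure_law _ F (fun j => phi j == j') mF.
have -> : [set x | phi (F x) == j'] = (phi \o F) @^-1` [set j'].
  by apply/seteqP; split => x /= /eqP.
by rewrite lawE; [move=> [->]|exact: fmeasurable_comp].
Qed.

Lemma expect_comp (J J' : finType) (F : X -> J) (phi : J -> J') (g : J' -> R) :
  fmeasurable F ->
  \sum_j' law (phi \o F) j' * g j' = \sum_j law F j * g (phi j).
Proof.
move=> mF; rewrite (partition_big phi predT)//=; apply: eq_bigr => j' _.
rewrite law_comp// mulr_suml; apply: eq_bigr => j /eqP ->//.
Qed.

Definition entropy (J : finType) (F : X -> J) : R := - \sum_j law F j * ln (law F j).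

(** Any subprobability [Q] on a finer space bounds the entropy of a factor
    from above.  Upper bounds of entropies are all obtained by choosing [Q]. *)
Lemma entropy_le (K I : finType) (F : X -> K) (phi : K -> I) (Q : K -> R) :
  fmeasurable F -> (forall k, 0 <= Q k) -> (forall k, Q k = 0 -> law F k = 0) ->
  \sum_k Q k <= 1 ->
  entropy (phi \o F) <= - \sum_k law F k * ln (Q k).
Proof.
move=> mF Q0 QP Q1; rewrite /entropy (expect_comp phi (fun i => ln (law (phi \o F) i)))//.
apply: gibbs_marginal => //; first by move=> k; exact: law_ge0.
  move=> k; rewrite law_comp// (bigD1 k)//= lerDl sumr_ge0// => *; exact: law_ge0.
exact: law_sum1.
Qed.

End Law.

(** * Subadditivity of the entropy of itineraries *)

Section Fekete.
Variable R : realType.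

Lemma fekete (a : nat -> R) : (forall n, 0 <= a n) ->
  (forall n m, a (n + m)%N <= a n + a m) -> cvgn (fun n => a n / n%:R).
Proof.
move=> a0 sub.
pose S := [set a n.+1 / n.+1%:R | n in [set: nat]].
have lbS : has_inf S.
  split; first by exists (a 1%N / 1%:R); exists 0%N.
  by exists 0 => _ [n _ <-]; rewrite divr_ge0.
have amul k q : a (q * k)%N <= q%:R * a k + a 0%N.
  elim: q => [|q IH]; first by rewrite mul0n mul0r add0r.
  by rewrite mulSn; apply: (le_trans (sub _ _)); rewrite -natr1 mulrDl mul1r; lra.
apply/cvg_ex; exists (inf S); apply/cvgrPdist_le => e e0.
have [_ [k _ <-] hk] := inf_adherent (divr_gt0 e0 (ltr0n _ 2)) lbS.
(* [M] bounds the contribution of any remainder modulo [k + 1]. *)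
pose M := \sum_(r < k.+1) a r + a 0%N.
have M0 : 0 <= M by rewrite addr_ge0// sumr_ge0.
have e2 : 0 < e / 2 by rewrite divr_gt0.
have Me0 : 0 <= M / (e / 2) by rewrite divr_ge0// ltW.
have := truncn_itv Me0; set N := Num.truncn _ => /andP[_ MN].
exists N.+1 => // n /= Nn.
have n0 : 0 < n%:R :> R by rewrite ltr0n; exact: leq_trans Nn.
have lo : inf S <= a n / n%:R.
  apply: ge_inf; first exact: lbS.2.
  by exists n.-1 => //; rewrite prednK//; exact: leq_trans Nn.
rewrite ler0_norm ?subr_le0// opprB lerBlDr.
have hi : a n <= n%:R * (a k.+1 / k.+1%:R) + M.
  rewrite {1}(divn_eq n k.+1); apply: (le_trans (sub _ _)).
  have := amul k.+1 (n %/ k.+1)%N.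
  have : (n %/ k.+1)%:R * a k.+1 <= n%:R * (a k.+1 / k.+1%:R).
    rewrite mulrA ler_pdivlMr// mulrAC ler_wpM2r// -natrM ler_nat.
    exact: leq_trunc_div.
  have : a (n %% k.+1)%N <= \sum_(r < k.+1) a r.
    have := ltn_pmod n (ltn0Sn k) => lt.
    by rewrite (bigD1 (Ordinal lt))//= lerDl sumr_ge0.
  rewrite /M; move: (n%:R * (_ / _)) (_ * a k.+1) (a (_ * _)%N) (a (_ %% _)%N) => *.
  by lra.
rewrite ler_pdivrMr//; apply: (le_trans hi).
have Me : M <= n%:R * (e / 2).
  rewrite -ler_pdivrMr//; apply: le_trans (ltW MN) _.
  by rewrite ler_nat.
have : n%:R * (a k.+1 / k.+1%:R) <= n%:R * (inf S + e / 2) by rewrite ler_pM2l// ltW.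
by move: hi Me; set w := n%:R * (a k.+1 / _); lra.
Qed.

(** Once the limit is known to exist, a bound along the multiples of one
    integer is enough, with an additive error that is independent of the
    multiple. *)
Lemma lim_le_along (a : nat -> R) (n : nat) (B C : R) : (0 < n)%N ->
  cvgn (fun n => a n / n%:R) ->
  (forall k, a (k * n)%N <= (k * n)%:R * B + C) -> limn (fun n => a n / n%:R) <= B.
Proof.
move=> n0 /cvgrPdist_le cv h; apply/ler_addgt0Pr => e e0.
have [N _ hN] := cv _ (divr_gt0 e0 (ltr0n _ 2)).
have C0 : 0 <= `|C| / (e / 2) by rewrite !divr_ge0// ltW.
have := truncn_itv C0; set m := Num.truncn _ => /andP[_ mC].
pose k := (N + m.+1)%N; pose q := (k * n)%N.
have kq : (k <= q)%N by rewrite leq_pmulr.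
have q0 : 0 < q%:R :> R by rewrite ltr0n (leq_trans _ kq)// /k addnS.
have := hN q; rewrite /= (leq_trans _ kq) ?leq_addr// => /(_ isT).
set L := limn _ => hL.
have aq : a q / q%:R <= B + e / 2.
  rewrite ler_pdivrMr//; apply: (le_trans (h k)); rewrite -/q [_ * B]mulrC mulrDl lerD2l.
  apply: (le_trans (ler_norm _)); rewrite mulrC -ler_pdivrMr ?divr_gt0//.
  apply: le_trans (ltW mC) _; rewrite ler_nat; apply: leq_trans kq; exact: leq_addl.
have := ler_norm (L - a q / q%:R); lra.
Qed.

Lemma le_lim_along (a : nat -> R) (n : nat) (B C : R) : (0 < n)%N ->
  cvgn (fun n => a n / n%:R) ->
  (forall k, (k * n)%:R * B - C <= a (k * n)%N) -> B <= limn (fun n => a n / n%:R).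
Proof.
move=> n0 cv h; have e : (fun n => - a n / n%:R) = (fun n => - (a n / n%:R)).
  by apply/funext => i; rewrite mulNr.
rewrite -lerN2 -limN// -[- _](_ : (fun n => - (a n / n%:R)) = _)// -e.
apply: (@lim_le_along _ n _ C) => //; first by rewrite e; exact: is_cvgN.
by move=> k; have := h k; lra.
Qed.

End Fekete.

Section Dynamics.
Context d (X : measurableType d) (R : realType) (f : X -> X) (mu : probability X R).
Hypothesis mf : measurable_fun [set: X] f.
Hypothesis inv : invariant_measure f mu.

Lemma fmeasurable_iter (J : finType) (F : X -> J) i : fmeasurable F ->
  fmeasurable (F \o iter i f).
Proof.
move=> mF j; elim: i => [|i IH]; first exact: mF.
have -> : (F \o iter i.+1 f) @^-1` [set j] = f @^-1` ((F \o iter i f) @^-1` [set j]).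
  by apply/seteqP; split => x /=; rewrite -iterSr.
by rewrite -[X in measurable X]setTI; apply: mf.
Qed.

Lemma law_iter (J : finType) (F : X -> J) i j : fmeasurable F ->
  law mu (F \o iter i f) j = law mu F j.
Proof.
move=> mF; elim: i => [//|i <-]; rewrite /law; congr fine.
rewrite -(inv (fmeasurable_iter i mF j)); congr (mu _).
by apply/seteqP; split => x /=; rewrite -iterSr.
Qed.

Lemma fmeasurable_prod (J J' : finType) (F : X -> J) (F' : X -> J') :
  fmeasurable F -> fmeasurable F' -> fmeasurable (fun x => (F x, F' x)).
Proof.
move=> mF mF' [j j'].
have -> : (fun x => (F x, F' x)) @^-1` [set (j, j')] = (F @^-1` [set j]) `&` (F' @^-1` [set j']).
  by apply/seteqP; split => x /=; [case=> -> ->|case=> -> ->].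
exact: measurableI.
Qed.

Lemma fmeasurable_ffun (I : finType) (J : finType) (F : I -> X -> J) :
  (forall i, fmeasurable (F i)) -> fmeasurable (fun x => [ffun i => F i x]).
Proof.
move=> mF w.
have -> : (fun x => [ffun i => F i x]) @^-1` [set w] = \bigcap_(i in [set: I]) (F i @^-1` [set w i]).
  apply/seteqP; split => x /=; first by move=> <- i _ /=; rewrite ffunE.
  by move=> h; apply/ffunP => i; rewrite ffunE; exact: h.
by apply: fin_bigcap_measurable => // i _; exact: mF.
Qed.

Definition itin (J : finType) (F : X -> J) n (x : X) : {ffun 'I_n -> J} :=
  [ffun i : 'I_n => F (iter i f x)].

Lemma fmeasurable_itin (J : finType) (F : X -> J) n : fmeasurable F -> fmeasurable (itin F n).
Proof. by move=> mF; apply: fmeasurable_ffun => i; exact: (fmeasurable_iter i mF). Qed.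

(** The law of the longer itinerary is compared with the product of the laws
    of its two parts, the second one being shifted by invariance. *)
Lemma entropy_subadd (J : finType) (F : X -> J) n m : fmeasurable F ->
  entropy mu (itin F (n + m)) <= entropy mu (itin F n) + entropy mu (itin F m).
Proof.
move=> mF.
pose l (w : {ffun 'I_(n + m) -> J}) : {ffun 'I_n -> J} := [ffun i => w (lshift m i)].
pose r (w : {ffun 'I_(n + m) -> J}) : {ffun 'I_m -> J} := [ffun i => w (rshift n i)].
have lE : itin F n = l \o itin F (n + m) by apply/funext => x; apply/ffunP => i; rewrite !ffunE.
have rE : itin F m \o iter n f = r \o itin F (n + m).
  by apply/funext => x; apply/ffunP => i; rewrite !ffunE /= addnC iterD.
have mI k : fmeasurable (itin F k) by exact: fmeasurable_itin.
pose Q w := law mu (itin F n) (l w) * law mu (itin F m) (r w).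
have LE : law mu (itin F m) = law mu (r \o itin F (n + m)).
  by apply/funext => j; rewrite -rE law_iter.
have ln0 w : law mu (itin F n) (l w) = 0 -> law mu (itin F (n + m)) w = 0.
  rewrite lE law_comp// => /psumr_eq0P; apply => // i _; exact: law_ge0.
have rn0 w : law mu (itin F m) (r w) = 0 -> law mu (itin F (n + m)) w = 0.
  rewrite LE law_comp// => /psumr_eq0P; apply => // i _; exact: law_ge0.
have := @entropy_le _ _ _ mu _ _ (itin F (n + m)) id Q (mI _).
move=> /(_ _ _ _)/le_trans; apply.
- by move=> w; rewrite mulr_ge0// law_ge0.
- by move=> w /eqP; rewrite mulf_eq0 => /orP[/eqP/ln0|/eqP/rn0].
- pose join (p : {ffun 'I_n -> J} * {ffun 'I_m -> J}) : {ffun 'I_(n + m) -> J} :=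
    [ffun i => match fintype.split i with inl a => p.1 a | inr b => p.2 b end].
  have lj p : l (join p) = p.1.
    by apply/ffunP => i; rewrite !ffunE (unsplitK (inl i)).
  have rj p : r (join p) = p.2.
    by apply/ffunP => i; rewrite !ffunE (unsplitK (inr i)).
  rewrite (reindex join) /=; last first.
    exists (fun w => (l w, r w)) => [[u v] _|w _]; first by rewrite lj rj.
    by apply/ffunP => i; rewrite ffunE /=; case: (split_ordP i) => j ->; rewrite ffunE.
  under eq_bigr do rewrite /Q lj rj.
  rewrite -(pair_bigA _ (fun u v => law mu (itin F n) u * law mu (itin F m) v))/=.
  under eq_bigr do rewrite -mulr_sumr law_sum1// mulr1.
  by rewrite law_sum1.
- rewrite /entropy [in X in _ <= - X + _]lE [X in _ <= _ - X](eq_bigr (fun v =>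
    law mu (r \o itin F (n + m)) v * ln (law mu (itin F m) v))); last by rewrite LE.
  rewrite (expect_comp mu l (fun v => ln (law mu (l \o itin F (n + m)) v)))//.
  rewrite (expect_comp mu r (fun v => ln (law mu (itin F m) v)))//.
  rewrite -opprD lerN2 -big_split/= ler_sum// => w _.
  rewrite -mulrDr; have := law_ge0 mu (itin F (n + m)) w.
  rewrite le_eqVlt => /orP[/eqP <-|w0]; first by rewrite !mul0r.
  have l0 : 0 < law mu (itin F n) (l w).
    by rewrite lt_neqAle law_ge0 andbT; apply/eqP => /esym/ln0 h; rewrite h ltxx in w0.
  have r0 : 0 < law mu (itin F m) (r w).
    by rewrite lt_neqAle law_ge0 andbT; apply/eqP => /esym/rn0 h; rewrite h ltxx in w0.
  by rewrite /Q lnM ?posrE// -lE.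
Qed.

Lemma entropy_ge0 (J : finType) (F : X -> J) : fmeasurable F -> 0 <= entropy mu F.
Proof.
move=> mF; rewrite /entropy -sumrN sumr_ge0// => j _; rewrite -mulrN mulr_ge0 ?law_ge0//.
rewrite oppr_ge0 ln_le0//; rewrite -(law_sum1 mu mF) (bigD1 j)//= lerDl sumr_ge0// => *.
exact: law_ge0.
Qed.

End Dynamics.

(** * An upper bound for the Kolmogorov-Sinai entropy of the doubling map *)

Section PartitionIndex.
Context d (X : measurableType d) (R : realType) (f : X -> X) (mu : probability X R).

Lemma partition_index (k : nat) (A : 'I_k -> set X) : measurable_partition A ->
  exists2 al : X -> 'I_k, fmeasurable al & A = fun i => al @^-1` [set i].
Proof.
move=> [mA [cov triv _]].
have ex x : exists i, A i x.
  have : (setT : set X) x by [].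
  by rewrite -cov => -[i _ Aix]; exists i.
have [al hal] := choice ex.
have E : A = fun i => al @^-1` [set i].
  apply/funext => i; apply/seteqP; split => x /=; last by move=> <-.
  by move=> Aix; apply: triv => //; exists x; split.
by exists al => // i; have := mA i; rewrite E.
Qed.

Lemma join_entropyE (k : nat) (al : X -> 'I_k) n :
  join_entropy f mu (fun i => al @^-1` [set i]) n = entropy mu (itin f al n).
Proof.
rewrite /join_entropy /entropy; congr (- _); apply: eq_bigr => w _; rewrite /law.
suff -> : join_cell f (fun i => al @^-1` [set i]) w = itin f al n @^-1` [set w] by [].
apply/seteqP; split => x /=; first by move=> h; apply/ffunP => i; rewrite ffunE; exact: h.
by move=> <- i /=; rewrite ffunE.
Qed.

Hypothesis mf : measurable_fun [set: X] f.
Hypothesis inv : invariant_measure f mu.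

Lemma cvg_entropy (J : finType) (al : X -> J) : fmeasurable al ->
  cvgn (fun n => entropy mu (itin f al n) / n%:R).
Proof.
move=> mal; apply: fekete => [n|n m]; last exact: entropy_subadd.
by apply: entropy_ge0; exact: fmeasurable_itin.
Qed.

End PartitionIndex.

Section DyadicApproximation.
Variable R : realType.
Variable mu : probability (btorus R) R.
Local Notation X := (btorus R).
Local Open Scope ereal_scope.

Definition dyadic m (P : pred nat) : set X := [set x | P (dig m x)].

Definition dign n (x : X) : 'I_(2 ^ n) := Ordinal (dig_lt n x).

Lemma fmeasurable_dign n : fmeasurable (dign n).
Proof.
move=> j; have -> : dign n @^-1` [set j] = cell n j.
  by apply/seteqP; split => x /=; [move=> <-|move=> h; apply/val_inj].
exact: measurable_cell.
Qed.

Lemma measurable_dyadic m P : measurable (dyadic m P).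
Proof.
have -> : dyadic m P = \bigcup_(k in [set k | P k]) cell m k.
  apply/seteqP; split => x /=; first by move=> h; exists (dig m x).
  by move=> [k /= Pk ck]; have e : dig m x = k := ck; rewrite /dyadic /= e.
apply: bigcup_measurable => k _; exact: measurable_cell.
Qed.

Lemma dyadic_lift m j P : dyadic m P = dyadic (m + j) (fun d => P (d %/ 2 ^ j)%N).
Proof.
apply/seteqP; split => x; rewrite /dyadic /= digD divnMDl ?expn_gt0//.
  by rewrite divn_small ?dig_lt// addn0.
by rewrite divn_small ?dig_lt// addn0.
Qed.

Definition symdiff (A B : set X) := (A `\` B) `|` (B `\` A).

Lemma measurable_symdiff A B : measurable A -> measurable B -> measurable (symdiff A B).
Proof. by move=> mA mB; apply: measurableU; exact: measurableD. Qed.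

(** These sets form a sigma-algebra that contains the cells, so that they are
    all the Borel sets; that is how arbitrary partitions reduce to dyadic
    ones. *)
Definition approximable (A : set X) := measurable A /\
  forall e : R, (0 < e)%R -> exists m P, mu (symdiff A (dyadic m P)) < e%:E.

Lemma approximableC A : approximable A -> approximable (~` A).
Proof.
move=> [mA hA]; split; first exact: measurableC.
move=> e e0; have [m [P h]] := hA e e0; exists m, (predC P).
suff -> : symdiff (~` A) (dyadic m (predC P)) = symdiff A (dyadic m P) by [].
have -> : dyadic m (predC P) = ~` dyadic m P.
  by apply/seteqP; split => x /=; [move=> /negP|move=> /negP].
by rewrite /symdiff !setDE !setCK setUC [X in X `|` _]setIC [X in _ `|` X]setIC.
Qed.

Lemma approximableU A B : approximable A -> approximable B -> approximable (A `|` B).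
Proof.
move=> [mA hA] [mB hB]; split; first exact: measurableU.
move=> e e0; have e2 : (0 < e / 2)%R by rewrite divr_gt0.
have [m [P hP]] := hA _ e2; have [n [Q hQ]] := hB _ e2.
rewrite (dyadic_lift m n) in hP; rewrite (dyadic_lift n m) addnC in hQ.
set P' := (fun d => P _) in hP; set Q' := (fun d => Q _) in hQ.
exists (m + n)%N, (predU P' Q').
rewrite (splitr e) EFinD; apply: le_lt_trans (lteD hP hQ).
have mP := measurable_symdiff mA (measurable_dyadic (m + n) P').
have mQ := measurable_symdiff mB (measurable_dyadic (m + n) Q').
apply: le_trans (measureU2 mu mP mQ).
apply: le_measure; rewrite ?inE; [|exact: measurableU|].
  by apply: measurable_symdiff; [exact: measurableU|exact: measurable_dyadic].
move=> x [[[Ax|Bx] /= /negP]|[/= /orP[h|h] /not_orP[nA nB]]].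
- by rewrite negb_or => /andP[/negP h _]; left; left.
- by rewrite negb_or => /andP[_ /negP h]; right; left.
- by left; right.
- by right; right.
Qed.

Lemma approximable_bigcup (A : nat -> set X) :
  (forall n, approximable (A n)) -> approximable (\bigcup_n A n).
Proof.
move=> hA; have mA n : measurable (A n) by have [] := hA n.
have mF : measurable (\bigcup_n A n) by exact: bigcup_measurable.
split => // e e0; have e2 : (0 < e / 2)%R by rewrite divr_gt0.
pose U n := \big[setU/set0]_(i < n) A i.
have aU n : approximable (U n).
  rewrite /U; elim: n => [|n IH]; last by rewrite big_ord_recr; exact: approximableU.
  rewrite big_ord0; split => // r r0; exists 0%N, pred0.
  suff -> : symdiff set0 (dyadic 0 pred0) = set0 by rewrite measure0 lte_fin.
  by apply/seteqP; split => x //= [[]|[]].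
have mU n : measurable (U n) by have [] := aU n.
pose D n := (\bigcup_n A n) `\` U n.
have mD n : measurable (D n) by exact: measurableD.
have D0 : \bigcap_n D n = set0.
  apply/seteqP; split => // x h; have [[n _ Anx] _] := h 0%N I.
  have [_] := h n.+1 I; apply; rewrite /U big_ord_recr; by right.
have cv : mu (D n) @[n --> \oo] --> 0.
  rewrite -(measure0 mu) -D0; apply: nonincreasing_cvg_mu => //.
  - exact: le_lt_trans (probability_le1 mu (mD 0%N)) (ltry _).
  - by rewrite D0.
  - move=> m n mn; apply/subsetPset; apply: setDS; rewrite /U.
    exact: subset_bigsetU.
have [n hn] : exists n, mu (D n) < (e / 2)%:E.
  have := cv; move=> /fine_cvgP[_ /cvgrPdist_lt/(_ _ e2)[n _ hn]]; exists n.
  have := hn n (leqnn n); rewrite /= sub0r normrN ger0_norm ?fine_ge0// => h.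
  by rewrite -[mu (D n)]fineK ?lte_fin// fin_num_measure.
have [m [P hP]] := (aU n).2 _ e2; exists m, P.
rewrite (splitr e) EFinD; apply: le_lt_trans (lteD hn hP).
have mS := measurable_symdiff (mU n) (measurable_dyadic m P).
apply: le_trans (measureU2 mu (mD n) mS).
apply: le_measure; rewrite ?inE; [|exact: measurableU|].
  by apply: measurable_symdiff => //; exact: measurable_dyadic.
move=> x [[Fx nE]|[Ex nF]].
  by have [Ux|nU] := pselect (U n x); [right; left|left].
right; right; split => // Ux; apply: nF.
by move: Ux; rewrite /U -bigcup_mkord => -[i _ Ai]; exists i.
Qed.

Lemma measurable_approximable A : measurable A -> approximable A.
Proof.
have -> : @measurable _ X = <<s @cells R >> by exact: measurable_cells.
apply: smallest_sub.
  split => [|B aB|B aB]; last exact: approximable_bigcup.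
    split => // r r0; exists 0%N, pred0.
    suff -> : symdiff set0 (dyadic 0 pred0) = set0 by rewrite measure0 lte_fin.
    by apply/seteqP; split => x //= [[]|[]].
  by rewrite setTD; exact: approximableC.
have E0 (B : set X) : symdiff B B = set0 by rewrite /symdiff setDv setU0.
move=> B [->|[n [k ->]]].
  split => // r r0; exists 0%N, pred0.
  suff -> : symdiff set0 (dyadic 0 pred0) = set0 by rewrite measure0 lte_fin.
  by apply/seteqP; split => x //= [[]|[]].
split; first exact: measurable_cell.
move=> r r0; exists n, (pred1 k).
have -> : dyadic n (pred1 k) = cell n k by apply/seteqP; split => x /= /eqP.
by rewrite E0 measure0 lte_fin.
Qed.

(** Each of the [k] atoms is approximated within [e / k] at a common
    generation.  A point where the coded index is wrong lies in one of the [k]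
    symmetric differences. *)
Lemma approximable_index k (al : X -> 'I_k) (e : R) : fmeasurable al -> (0 < e)%R ->
  exists m (code : nat -> 'I_k), mu [set x | al x != code (dig m x)] <= e%:E.
Proof.
move=> mal e0; have k0 : (0 < k)%N by case: k al mal => [|//] al; case: (al point).
have ek : (0 < e / k%:R)%R by rewrite divr_gt0// ltr0n.
have /choice[mp hmp] : forall i, exists p : nat * pred nat,
    mu (symdiff (al @^-1` [set i]) (dyadic p.1 p.2)) < (e / k%:R)%:E.
  move=> i; have [m [P h]] := (measurable_approximable (mal i)).2 _ ek.
  by exists (m, P).
pose M := (\sum_i (mp i).1)%N.
have Mi i : ((mp i).1 <= M)%N by rewrite /M (bigD1 i)//= leq_addr.
pose P i := fun d => (mp i).2 (d %/ 2 ^ (M - (mp i).1))%N.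
have PE i : dyadic (mp i).1 (mp i).2 = dyadic M (P i).
  by rewrite (dyadic_lift _ (M - (mp i).1)) subnKC.
pose code d : 'I_k := odflt (al point) [pick i | P i d].
exists M, code.
pose F (x : X) := (al x, dign M x).
have mF : fmeasurable F by apply: fmeasurable_prod => //; exact: fmeasurable_dign.
have -> : [set x | al x != code (dig M x)] = [set x | (F x).1 != code (F x).2] by [].
rewrite (measure_law mu (fun p : 'I_k * 'I_(2 ^ M) => p.1 != code p.2) mF) lee_fin.
have hi i : (\sum_(p : 'I_k * 'I_(2 ^ M) | (p.1 == i) != P i p.2) law mu F p <= e / k%:R)%R.
  have h := hmp i; rewrite -lee_fin -(measure_law mu (fun p : 'I_k * 'I_(2 ^ M) => (p.1 == i) != P i p.2) mF).
  apply: le_trans (ltW h); rewrite PE.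
  suff -> : [set x | ((F x).1 == i) != P i (F x).2] = symdiff (al @^-1` [set i]) (dyadic M (P i)) by [].
  apply/seteqP; split => x; rewrite /symdiff /dyadic /=.
    have [ai|ai] := eqVneq (al x) i; case: (boolP (P i (dig M x))) => //= h1 _; [left|right].
      by split => //; exact/negP.
    by split => //; exact/eqP.
  by case=> -[h1 h2]; [rewrite h1 eqxx; move/negP/negbTE : h2 => ->|rewrite h1; move/eqP/negbTE: h2 => ->].
have -> : e = (\sum_(i < k) e / k%:R)%R.
  by rewrite sumr_const card_ord -[RHS]mulr_natr divfK// pnatr_eq0 -lt0n.
apply: le_trans (ler_sum _ (fun i _ => hi i)).
under [X in (_ <= X)%R]eq_bigr do rewrite big_mkcond.
rewrite exchange_big/= big_mkcond/=; apply: ler_sum => -[a d] _ /=.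
have l0 := law_ge0 mu F (a, d).
case: ifPn => [ne|_]; last by apply: sumr_ge0 => i _; case: ifP.
have [j hj] : exists j, (a == j) != P j d.
  rewrite /code in ne; case: pickP ne => [j Pj /= ne|np _]; last first.
    by exists a; rewrite eqxx np.
  by exists j; rewrite Pj (negbTE ne).
by rewrite (bigD1 j)//= hj lerDl sumr_ge0// => i _; case: ifP.
Qed.

End DyadicApproximation.

Section VariationalUpper.
Variable R : realType.
Variable mu : probability (btorus R) R.
Local Notation X := (btorus R).
Local Notation T := (@doubling R : btorus R -> btorus R).
Hypothesis inv : invariant_measure T mu.
Variables (n : nat) (g : 'I_(2 ^ n) -> R).
Hypothesis n0 : (0 < n)%N.
Hypothesis g0 : forall k, 0 < g k.

Local Notation Z := (\sum_k g k).
Local Notation E := (\sum_k law mu (@dign R n) k * ln (g k)).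

Lemma dig_tail i m r (x y : torus R) : dig (i + (m + r)) x = dig (i + (m + r)) y ->
  dig m (x *+ 2 ^ i) = dig m (y *+ 2 ^ i).
Proof.
move=> e.
have e1 : dig (m + r) (x *+ 2 ^ i) = dig (m + r) (y *+ 2 ^ i).
  have := congr1 (fun d => d %% 2 ^ (m + r))%N e; rewrite /= !(digD i) !modnMDl.
  by rewrite !modn_small// dig_lt.
have := congr1 (fun d => d %/ 2 ^ r)%N e1; rewrite /= !(digD m).
by rewrite !divnMDl ?expn_gt0// !divn_small ?addn0// dig_lt.
Qed.

Lemma dig_blocks B (x y : torus R) :
  (forall b, (b < B)%N -> dig n (x *+ 2 ^ (b * n)) = dig n (y *+ 2 ^ (b * n))) ->
  dig (B * n) x = dig (B * n) y.
Proof.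
elim: B => [|B IH] h.
  by have := dig_lt 0 x; have := dig_lt 0 y; rewrite !mul0n; case: dig => //; case: dig.
by rewrite mulSn addnC !digD IH ?h// => b bB; apply: h; exact: ltnW.
Qed.

(** The joint map records the itinerary [w] and [kp + m] consecutive blocks of
    [n] digits.  It is compared with the law that draws the blocks
    independently with weights [g / Z] and then each letter [w_i] as the letter
    predicted from the digits with probability [1 - eta], any other letter with
    probability [eta / k].  The [m] additional blocks make the [m] digits after
    time [i] available for every [i < kp * n]. *)
Lemma entropy_blocks k (al : X -> 'I_k) (m : nat) (code : nat -> 'I_k) (eta e : R) (kp : nat) :
  fmeasurable al -> 0 < eta < 1 -> e = fine (mu [set x | al x != code (dig m x)]) ->
  entropy mu (itin T al (kp * n)) <=
    (kp + m)%:R * (ln Z - E) + (kp * n)%:R * (- ln (1 - eta) - ln (eta / k%:R) * e).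
Proof.
move=> mal /andP[eta0 eta1] eE.
have k0 : (0 < k)%N := leq_ltn_trans (leq0n _) (ltn_ord (al point)).
pose J1 := {ffun 'I_(kp * n) -> 'I_k}; pose J2 := {ffun 'I_(kp + m) -> 'I_(2 ^ n)}.
pose ub (x : X) : J2 := [ffun b : 'I_(kp + m) => dign n (iter (b * n) T x)].
pose F (x : X) : J1 * J2 := (itin T al (kp * n) x, ub x).
have mT := @measurable_doubling R.
have lawT (J : finType) (G : X -> J) i : fmeasurable G -> law mu (G \o iter i T) = law mu G.
  by move=> mG; apply/funext => j; apply: law_iter.
have mF : fmeasurable F.
  apply: fmeasurable_prod; first exact: fmeasurable_itin.
  apply: fmeasurable_ffun => b; apply: (fmeasurable_iter mT (b * n) (F := @dign R n)).
  exact: fmeasurable_dign.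
pose q (a b : 'I_k) : R := if a == b then 1 - eta else eta / k%:R.
have kR : 0 < k%:R :> R by rewrite ltr0n.
have q0 a b : 0 < q a b by rewrite /q; case: ifP => _; rewrite ?subr_gt0// divr_gt0.
have q1 b : \sum_a q a b <= 1.
  rewrite (bigD1 b)//= {1}/q eqxx.
  rewrite (eq_bigr (fun=> eta / k%:R)); last by move=> i ib; rewrite /q (negbTE ib).
  rewrite sumr_const cardC1 card_ord -[_ *+ _]mulr_natr.
  suff : eta / k%:R * k.-1%:R <= eta by lra.
  by rewrite mulrAC ler_pdivrMr// ler_pM2l// ler_nat leq_pred.
(* Any point with the given blocks serves to evaluate the predicted letters. *)
pose rep (u : J2) : X := get [set x | ub x = u].
pose c (i : nat) (u : J2) : 'I_k := code (dig m (iter i T (rep u))).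
have cE i x : (i < kp * n)%N -> c i (ub x) = code (dig m (iter i T x)).
  move=> ikn; rewrite /c; congr code.
  have repE : ub (rep (ub x)) = ub x by apply: (@getI _ [set y | ub y = ub x] x).
  have dE : dig ((kp + m) * n) (rep (ub x)) = dig ((kp + m) * n) x.
    apply: dig_blocks => b bB.
    have := congr1 (fun w : J2 => val (w (Ordinal bB))) repE.
    by rewrite !ffunE /= !iter_doubling.
  rewrite !iter_doubling; apply: (@dig_tail i m ((kp + m) * n - i - m)).
  suff -> : (i + (m + ((kp + m) * n - i - m)) = (kp + m) * n)%N by [].
  have : (m <= m * n)%N by rewrite leq_pmulr.
  rewrite mulnDl; lia.
pose Q (p : J1 * J2) := (\prod_b (g (p.2 b) / Z)) * \prod_(i < kp * n) q (p.1 i) (c i p.2).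
have Z0 : 0 < Z.
  have p2 : (0 < 2 ^ n)%N by rewrite expn_gt0.
  by rewrite (bigD1 (Ordinal p2))//= ltr_wpDr// sumr_ge0// => *; exact: ltW.
have gZ k' : 0 < g k' / Z by rewrite divr_gt0.
have pg (u : J2) : 0 < \prod_b (g (u b) / Z) by apply: prodr_gt0.
have pq (p : J1 * J2) : 0 < \prod_(i < kp * n) q (p.1 i) (c i p.2) by apply: prodr_gt0.
have Q0 p : 0 < Q p by rewrite mulr_gt0.
have ext x : itin T al (kp * n) x = (fst \o F) x by [].
have -> : itin T al (kp * n) = fst \o F by apply/funext.
apply: le_trans (entropy_le (Q := Q) _ mF _ _ _) _.
- by move=> p; rewrite ltW.
- by move=> p h; have := Q0 p; rewrite h ltxx.
- rewrite -(pair_bigA _ (fun w u => Q (w, u)))/= exchange_big/=.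
  apply: (@le_trans _ _ (\sum_(u : J2) \prod_b (g (u b) / Z))).
    apply: ler_sum => u _; rewrite /Q /= -mulr_sumr ler_piMr//; first by rewrite ltW.
    rewrite -(bigA_distr_bigA (fun (i : 'I_(kp * n)) a => q a (c i u))).
    by apply: prodr_ile1 => i _; rewrite q1 sumr_ge0// => a _; rewrite ltW.
  rewrite -(bigA_distr_bigA (fun (b : 'I_(kp + m)) v => g v / Z)).
  by apply: prodr_ile1 => b _; rewrite -mulr_suml divff ?gt_eqF// lexx ler01.
have lnQ p : ln (Q p) = \sum_b (ln (g (p.2 b)) - ln Z) +
    \sum_(i < kp * n) ln (q (p.1 i) (c i p.2)).
  have lnprod (I : finType) (h : I -> R) : (forall i, 0 < h i) ->
      ln (\prod_i h i) = \sum_i ln (h i).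
    move=> h0; have [_ ->] : 0 < \prod_i h i /\ ln (\prod_i h i) = \sum_i ln (h i); last by [].
    elim/big_rec2: _ => [|i x y _ [x0 xE]]; first by rewrite ln1.
    by split; [rewrite mulr_gt0|rewrite lnM ?posrE// xE].
  rewrite lnM ?posrE// !lnprod//; congr (_ + _); apply: eq_bigr => b _.
  by rewrite ln_div ?posrE.
have e1 : \sum_p law mu F p * \sum_b (ln (g (p.2 b)) - ln Z) = (kp + m)%:R * (E - ln Z).
  under eq_bigr do rewrite mulr_sumr.
  rewrite exchange_big/= (eq_bigr (fun=> E - ln Z)); last first.
    move=> b _.
    have := expect_comp mu (fun p : J1 * J2 => p.2 b) (fun v => ln (g v) - ln Z) mF.
    move=> <-.
    have -> : (fun p : J1 * J2 => p.2 b) \o F = @dign R n \o iter (b * n) T.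
      by apply/funext => x; rewrite /= ffunE.
    rewrite lawT; last exact: fmeasurable_dign.
    under eq_bigr do rewrite mulrBr; rewrite sumrB; congr (_ - _).
    by rewrite -mulr_suml law_sum1 ?mul1r//; exact: fmeasurable_dign.
  by rewrite sumr_const card_ord -[LHS]mulr_natl.
pose be (x : X) := (al x, code (dig m x)).
have mbe : fmeasurable be.
  apply: fmeasurable_prod => //.
  apply: (fmeasurable_comp (F := @dign R m) (fun d => code (val d))); exact: fmeasurable_dign.
have e2 : \sum_p law mu F p * \sum_(i < kp * n) ln (q (p.1 i) (c i p.2)) =
    (kp * n)%:R * \sum_ab law mu be ab * ln (q ab.1 ab.2).
  under eq_bigr do rewrite mulr_sumr.
  rewrite exchange_big/= (eq_bigr (fun=> \sum_ab law mu be ab * ln (q ab.1 ab.2))); last first.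
    move=> i _.
    have := expect_comp mu (fun p : J1 * J2 => (p.1 i, c i p.2)) (fun ab => ln (q ab.1 ab.2)) mF.
    move=> <-.
    have -> : (fun p : J1 * J2 => (p.1 i, c i p.2)) \o F = be \o iter i T.
      by apply/funext => x; rewrite /= ffunE cE.
    by rewrite lawT.
  by rewrite sumr_const card_ord -[LHS]mulr_natl.
have -> : \sum_p law mu F p * ln (Q p) = (kp + m)%:R * (E - ln Z) +
   (kp * n)%:R * \sum_ab law mu be ab * ln (q ab.1 ab.2).
  by rewrite -e1 -e2 -big_split/=; apply: eq_bigr => p _; rewrite lnQ mulrDr.
rewrite opprD -mulrN opprB lerD2l -mulrN ler_wpM2l// lerNl opprD opprK opprK.
have {eE}-> : e = \sum_(ab | ab.1 != ab.2) law mu be ab.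
  rewrite eE (_ : [set x | _] = [set x | (be x).1 != (be x).2])//.
  by rewrite (measure_law mu (fun ab : 'I_k * 'I_k => ab.1 != ab.2) mbe).
have leq : ln (1 - eta) <= 0 by rewrite ln_le0//; lra.
rewrite [X in _ <= X](bigID (fun ab => ab.1 != ab.2))/= addrC lerD//; last first.
  by rewrite mulr_sumr; apply: ler_sum => ab ne; rewrite mulrC /q (negbTE ne)//.
rewrite (eq_bigr (fun ab => law mu be ab * ln (1 - eta))); last first.
  by move=> ab; rewrite negbK /q => ->.
rewrite -mulr_suml -[X in X <= _]mul1r ler_wnM2r//.
rewrite -(law_sum1 mu mbe) [X in _ <= X](bigID (fun ab => ab.1 != ab.2))/= lerDr.
by apply: sumr_ge0 => *; exact: law_ge0.
Qed.

(** The prediction error of [entropy_blocks] costs [- ln (1 - eta)] per step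
    and [- ln (eta / k)] per wrong prediction.  Choosing [eta] first, then the
    approximation of the partition, makes both at most [d / 2]; the [m]
    additional blocks disappear in the limit. *)
Lemma ks_entropy_le : (ks_entropy T mu <= ((ln Z - E) / n%:R)%:E)%E.
Proof.
apply: ub_ereal_sup => _ [k [A [pA ->]]]; rewrite lee_fin /partition_entropy.
have [al mal ->] := partition_index pA.
have -> : (fun N => join_entropy T mu (fun i => al @^-1` [set i]) N / N%:R) =
  (fun N => entropy mu (itin T al N) / N%:R).
  by apply/funext => N; rewrite join_entropyE.
have k0 : (0 < k)%N := leq_ltn_trans (leq0n _) (ltn_ord (al point)).
apply/ler_addgt0Pr => d d0.
pose eta : R := 1 - expR (- (d / 2)).
have eta1 : eta < 1 by rewrite /eta gtrBl expR_gt0.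
have eta0 : 0 < eta by rewrite subr_gt0 expR_lt1; lra.
have lneta : - ln (1 - eta) = d / 2 by rewrite /eta subKr expRK opprK.
pose w := `|ln (eta / k%:R)|.
have w0 : 0 <= w by exact: normr_ge0.
have dw : 0 < d / 2 / (1 + w) by rewrite !divr_gt0//; lra.
have [m [code hcode]] := approximable_index mu mal dw.
apply: (@lim_le_along _ _ n _ (m%:R * (ln Z - E)) n0 (cvg_entropy (@measurable_doubling R) inv mal)).
move=> kp.
pose e := fine (mu [set x | al x != code (dig m x)]).
have := @entropy_blocks k al m code eta e kp mal; rewrite eta0 eta1 => /(_ isT erefl) h.
apply: (le_trans h).
have e0 : 0 <= e by exact: fine_ge0.
have ee : e <= d / 2 / (1 + w).
  rewrite -lee_fin fineK// fin_num_measure//.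
  have mbe : fmeasurable (fun x : X => (al x, dign m x)).
    by apply: fmeasurable_prod => //; exact: fmeasurable_dign.
  have := fmeasurable_comp (fun p : 'I_k * 'I_(2 ^ m) => p.1 != code p.2) mbe true.
  by congr measurable; apply/seteqP; split => x /=.
have hw : - ln (eta / k%:R) * e <= d / 2.
  apply: (@le_trans _ _ (w * e)); first by rewrite ler_wpM2r// /w -normrN ler_norm.
  apply: (@le_trans _ _ (w * (d / 2 / (1 + w)))); first by rewrite ler_wpM2l.
  rewrite mulrCA ler_piMr//; first lra.
  by rewrite ler_pdivrMr ?mul1r; lra.
have hs : (kp * n)%:R * (- ln (1 - eta) - ln (eta / k%:R) * e) <= (kp * n)%:R * d.
  rewrite ler_wpM2l// lneta; move: hw; rewrite mulNr; lra.
have hn : n%:R != 0 :> R by rewrite pnatr_eq0 -lt0n.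
have -> : (kp * n)%:R * ((ln Z - E) / n%:R + d) = kp%:R * (ln Z - E) + (kp * n)%:R * d.
  by rewrite natrM; field.
rewrite natrD mulrDl; move: hs; lra.
Qed.

End VariationalUpper.

(** * Partition sums bound the pressure from above *)

Section Weights.
Variable R : realType.
Implicit Types (x c : torus R) (n k j : nat) (t : R).

Definition base n k : torus R := proj (k%:R / 2 ^+ n).

(** [T^j] stretches the cell, of length [2^-n], by the factor [2^j]; so this
    bounds the distance from [T^j x] to [c] for every [x] in the cell.  Being
    positive even when the orbit of the cell meets [c], it regularises the
    singularity. *)
Definition cell_dist n k c j : R := Num.min 1 (sg (base n k *+ 2 ^ j - c) + pi * 2 ^+ j / 2 ^+ n).

Definition birkhoff n k c : R := \sum_(j < n) ln (cell_dist n k c j).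

Definition weight n c t k : R := expR (2 * t * birkhoff n k c).

Definition partition_sum n c t : R := \sum_(k < 2 ^ n) weight n c t k.

Lemma sg_base n x : sg (x - base n (dig n x)) <= pi / 2 ^+ n.
Proof.
rewrite -{1}(proj_frac x) -projB; apply: (le_trans (sg_le _)).
rewrite ler_pM2l ?pi_gt0//; have p0 : 0 < 2 ^+ n :> R by rewrite exprn_gt0.
have /andP[h1 h2] := dig_itv n x; rewrite -(ler_pM2l p0) divff ?gt_eqF//.
rewrite -{1}(gtr0_norm p0) -normrM mulrBr mulrCA divff ?gt_eqF// mulr1 ler_norml.
by move: h1 h2; rewrite -[(dig n x).+1%:R]natr1 => h1 h2; apply/andP; split; lra.
Qed.

Lemma sg_base_mul n j x : sg (x *+ 2 ^ j - base n (dig n x) *+ 2 ^ j) <= pi * 2 ^+ j / 2 ^+ n.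
Proof.
rewrite -mulrnBl; apply: (le_trans (sg_mulX _ _)).
by rewrite [pi * _]mulrC -mulrA ler_pM2l ?exprn_gt0// sg_base.
Qed.

Lemma sg_le_cell_dist n j x c : sg (x *+ 2 ^ j - c) <= cell_dist n (dig n x) c j.
Proof.
rewrite /cell_dist le_min sg_le1 /= [X in _ <= X]addrC.
by apply: (le_trans (sg_triangle (base n (dig n x) *+ 2 ^ j) _ _)); rewrite lerD2r sg_base_mul.
Qed.

Lemma cell_dist_gt0 n k c j : 0 < cell_dist n k c j.
Proof.
rewrite /cell_dist lt_min ltr01 ltr_wpDl ?sg_ge0//.
by rewrite !mulr_gt0 ?invr_gt0 ?exprn_gt0 ?pi_gt0.
Qed.

Lemma cell_dist_le1 n k c j : cell_dist n k c j <= 1.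
Proof. by rewrite /cell_dist ge_min lexx. Qed.

Lemma birkhoff_le0 n k c : birkhoff n k c <= 0.
Proof. by apply: sumr_le0 => j _; rewrite ln_le0 ?cell_dist_le1. Qed.

Lemma weight_gt0 n c t k : 0 < weight n c t k.
Proof. exact: expR_gt0. Qed.

Lemma partition_sum_gt0 n c t : 0 < partition_sum n c t.
Proof.
have p2 : (0 < 2 ^ n)%N by rewrite expn_gt0.
rewrite /partition_sum (bigD1 (Ordinal p2))//= ltr_wpDr ?weight_gt0// sumr_ge0// => k _.
exact: ltW (weight_gt0 _ _ _ _).
Qed.

Lemma weight_le1 n c t k : 0 <= t -> weight n c t k <= 1.
Proof.
by move=> t0; rewrite /weight -expR0 ler_expR mulr_ge0_le0 ?birkhoff_le0// mulr_ge0.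
Qed.

Lemma partition_sum_le n c t : 0 <= t -> partition_sum n c t <= 2 ^+ n.
Proof.
move=> t0; apply: (@le_trans _ _ (\sum_(k < 2 ^ n) 1)).
  by apply: ler_sum => k _; exact: weight_le1.
by rewrite sumr_const card_ord -natrX.
Qed.

Lemma psi_le_cell_dist n j x c t : 0 <= t ->
  (t%:E * psi c (x *+ 2 ^ j)%R <= (2 * t * ln (cell_dist n (dig n x) c j))%:E)%E.
Proof.
move=> t0; have := sg_ge0 (x *+ 2 ^ j - c); rewrite le_eqVlt => /orP[/eqP s0|s0].
  rewrite psiE -s0 le0_lneNy// gt0_muleNy ?lte_fin//.
  move: t0; rewrite le_eqVlt => /orP[/eqP <-|t0].
    by rewrite mulr0 mul0r mul0e.
  by rewrite gt0_muleNy ?lte_fin// leNye.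
rewrite psi_ln// -EFinM lee_fin mulrA [t * 2]mulrC ler_wpM2l ?mulr_ge0//.
by rewrite ler_ln ?posrE ?cell_dist_gt0 ?sg_le_cell_dist.
Qed.

End Weights.

Section PressureUpper.
Variable R : realType.
Variable mu : probability (btorus R) R.
Local Notation X := (btorus R).
Local Notation T := (@doubling R : btorus R -> btorus R).
Hypothesis inv : invariant_measure T mu.
Local Open Scope ereal_scope.

Lemma integral_iter (f : X -> \bar R) j : measurable_fun [set: X] f ->
  (forall x, 0 <= f x) -> \int[mu]_x f (iter j T x) = \int[mu]_x f x.
Proof.
move=> mf f0; have mT := @measurable_doubling R.
elim: j => [//|j IH].
have mfj : measurable_fun [set: X] (fun x => f (iter j T x)).
  apply: measurableT_comp => //; elim: (j) => [|i IHi]; first exact: measurable_id.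
  by apply: (measurableT_comp mT IHi).
under eq_integral do rewrite iterSr.
rewrite -(@ge0_integral_pushforward _ _ _ _ _ _ mT mu setT (fun x => f (iter j T x)))//.
rewrite -IH; apply: eq_measure_integral => A mA _; exact: inv.
Qed.

(** By invariance the integral is the mean of the integrals along [n]
    iterates, and on each cell the Birkhoff sum is at most [birkhoff]. *)
Lemma integral_psi_le n c (t : R) : (0 < n)%N -> (0 <= t)%R ->
  \int[mu]_x (t%:E * psi c x) <=
  ((\sum_k law mu (@dign R n) k * (2 * t * birkhoff n k c)) / n%:R)%:E.
Proof.
move=> n0 t0; set E := (\sum_k _)%R.
pose f (x : X) : \bar R := - (t%:E * psi c x).
have f0 x : 0 <= f x by rewrite oppe_ge0 mule_ge0_le0 ?lee_fin// psi_le0.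
have mf : measurable_fun [set: X] f.
  by apply: measurableT_comp => //; apply: measurable_funeM; exact: measurable_psi.
have fE : \int[mu]_x (t%:E * psi c x) = - \int[mu]_x f x.
  rewrite -integral_ge0N => [|x _ //]; by apply: eq_integral => x _; rewrite /f oppeK.
have mfj (j : nat) : measurable_fun [set: X] (fun x => f (iter j T x)).
  apply: measurableT_comp => //; elim: (j) => [|i IHi]; first exact: measurable_id.
  by apply: (measurableT_comp (@measurable_doubling R) IHi).
have : (- E)%:E <= n%:R%:E * \int[mu]_x f x.
  have -> : n%:R%:E * \int[mu]_x f x = \sum_(j < n) \int[mu]_x f (iter j T x).
    under eq_bigr do rewrite integral_iter//.
    by rewrite sumr_const card_ord mule_natl.
  have -> : \sum_(j < n) \int[mu]_x f (iter j T x) = \int[mu]_x \sum_(j < n) f (iter j T x).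
    by rewrite ge0_integral_sum.
  have -> : (- E)%:E = \int[mu]_x (- (2 * t * birkhoff n (dign n x) c))%:E.
    rewrite (integral_law mu (fun k : 'I_(2 ^ n) => - (2 * t * birkhoff n k c))%R); last exact: fmeasurable_dign.
    by rewrite -sumrN; congr EFin; apply: eq_bigr => k _; rewrite mulrN.
  apply: ge0_le_integral => //.
  - by move=> x _; rewrite lee_fin oppr_ge0 mulr_ge0_le0 ?birkhoff_le0// mulr_ge0.
  - apply/measurable_EFinP.
    exact: (measurable_fin_comp (fun k : 'I_(2 ^ n) => - (2 * t * birkhoff n k c))%R (@fmeasurable_dign R n)).
  - by apply: emeasurable_sum.
  move=> x _; rewrite /birkhoff mulr_sumr -sumrN -sumEFin; apply: lee_sum => j _.
  by rewrite EFinN leeN2 iter_doubling psi_le_cell_dist.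
rewrite fE; case: (\int[mu]_x f x) => [r| |] h.
- rewrite -EFinN lee_fin ler_pdivlMr ?ltr0n// mulNr lerNl mulrC.
  by move: h; rewrite -EFinM lee_fin.
- by rewrite leNye.
- by move: h; rewrite gt0_muleNy ?lte_fin ?ltr0n.
Qed.

End PressureUpper.

(** With the weights of the partition sum, the terms in [birkhoff] of
    the entropy bound and of the integral bound cancel. *)
Lemma pressure_le (R : realType) (c : torus R) (t : R) n : (0 < n)%N -> 0 <= t ->
  (pressure c t <= (ln (partition_sum n c t) / n%:R)%:E)%E.
Proof.
move=> n0 t0; apply: ub_ereal_sup => _ [mu [inv _] <-].
have g0 (k : 'I_(2 ^ n)) : 0 < weight n c t k by exact: weight_gt0.
have h1 := ks_entropy_le inv n0 g0.
have h2 := integral_psi_le inv c n0 t0.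
apply: (le_trans (leeD h1 h2)); rewrite -EFinD lee_fin -mulrDl.
suff -> : \sum_k law mu (@dign R n) k * ln (weight n c t k) =
  \sum_k law mu (@dign R n) k * (2 * t * birkhoff n k c) by rewrite subrK.
by apply: eq_bigr => k _; rewrite /weight expRK.
Qed.

(** * Averages of image measures, and Lebesgue measure on the circle *)

Section AverageMeasure.
Context d d' (X : measurableType d) (Y : measurableType d') (R : realType).
Variables (P : probability X R) (G : nat -> {mfun X >-> Y}) (N : nat).

Definition invSN : {nonneg R} := (N.+1%:R^-1)%:nng.

Definition average := mscale invSN (msum (fun i => distribution P (G i)) N.+1).

HB.instance Definition _ := Measure.on average.

Let average_setT : average [set: Y] = 1%E.
Proof.
rewrite /average /mscale [X in (_ * X)%E](_ : _ = \sum_(i < N.+1) 1%E); last first.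
  by apply: eq_bigr => i _; exact: (probability_setT (distribution P (G i))).
rewrite sumEFin sumr_const card_ord -EFinM /=.
by rewrite mulVf// pnatr_eq0.
Qed.

HB.instance Definition _ := Measure_isProbability.Build _ _ _ average average_setT.

Lemma averageE A : average A = (N.+1%:R^-1%:E * \sum_(i < N.+1) P (G i @^-1` A))%E.
Proof. by []. Qed.

Lemma ge0_integral_average (f : Y -> \bar R) : measurable_fun [set: Y] f ->
  (forall y, (0 <= f y)%E) ->
  (\int[average]_y f y = N.+1%:R^-1%:E * \sum_(i < N.+1) \int[P]_x f (G i x))%E.
Proof.
move=> mf f0; rewrite ge0_integral_mscale//= ge0_integral_measure_sum//.
by congr mule; apply: eq_bigr => i _; rewrite ge0_integral_distribution.
Qed.

End AverageMeasure.

Definition mfun_of d d' (X : measurableType d) (Y : measurableType d') (f : X -> Y)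
  (mf : measurable_fun [set: X] f) : {mfun X >-> Y} :=
  HB.pack f (isMeasurableFun.Build _ _ _ _ f mf).

Section LebesgueTorus.
Variable R : realType.
Local Notation X := (btorus R).

Definition lebunit :=
  mrestr (@lebesgue_measure R) (measurable_itv `[0, 1[).

HB.instance Definition _ := Measure.copy lebunit
  (mrestr (@lebesgue_measure R) (measurable_itv `[0, 1[)).

Let lebunit_setT : lebunit setT = 1%E.
Proof. by rewrite /lebunit /mrestr setTI lebesgue_measure_itv /= lte_fin ltr01 oppr0 adde0. Qed.

HB.instance Definition _ := Measure_isProbability.Build _ _ _ lebunit lebunit_setT.

Lemma measurable_proj_ocitv :
  measurable_fun [set: measurableTypeR R]
    (fun r : measurableTypeR R => proj (r : R) : X).
Proof. by move=> _ B mB; have := @measurable_proj R measurableT B mB. Qed.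

Definition lebtorus : probability X R :=
  distribution lebunit (mfun_of measurable_proj_ocitv).

(** Under Lebesgue measure the binary digits are independent fair coins. *)
Lemma lebtorus_cell n k : (k < 2 ^ n)%N -> lebtorus (cell n k) = (2 ^- n)%:E.
Proof.
move=> kn; rewrite /lebtorus /distribution /= /pushforward /= /lebunit /mrestr.
have p0 : 0 < 2 ^+ n :> R by rewrite exprn_gt0.
have -> : (fun x => proj x) @^-1` cell n k `&` `[0, 1[%classic =
   `[k%:R / 2 ^+ n, k.+1%:R / 2 ^+ n[%classic :> set R.
  apply/seteqP; split => r /=.
    rewrite in_itv/= => -[rk /andP[r0 r1]].
    have := dig_itv n (proj r); have -> : dig n (proj r) = k := rk.
    rewrite frac_proj ?r0// in_itv/= ler_pdivrMr// ltr_pdivlMr// mulrC.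
    exact.
  rewrite in_itv/= ler_pdivrMr// ltr_pdivlMr// mulrC => /andP[h1 h2].
  have r0 : 0 <= r by rewrite -(pmulr_rge0 _ p0) (le_trans _ h1).
  have r1 : r < 1.
    rewrite -(ltr_pM2l p0) mulr1; apply: (lt_le_trans h2).
    by rewrite -natrX ler_nat.
  rewrite in_itv/= r0 r1; split => //; apply: digP; rewrite frac_proj ?r0//.
  by rewrite h1.
rewrite lebesgue_measure_itv /= lte_fin ltr_pM2r ?invr_gt0// ltr_nat ltnSn.
by rewrite -EFinB -mulrBl -natr1 addrAC subrr add0r mul1r.
Qed.

(** Measures that agree on the cells are equal, and the preimage of a cell
    consists of two cells of half its measure. *)
Lemma lebtorus_doubling (A : set X) : measurable A ->
  lebtorus ((@doubling R : X -> X) @^-1` A) = lebtorus A.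
Proof.
move=> mA; apply/esym.
have mT := @measurable_doubling R.
pose m2 := distribution lebtorus (mfun_of mT).
apply: (@measure_unique _ _ _ (@cells R) (fun=> cell 0 0) (@measurable_cells R)
  (@setI_closed_cells R) _ _ lebtorus m2) => //.
- by move=> _; right; exists 0%N, 0%N.
- apply/seteqP; split => // x _; exists 0%N => //=; rewrite /cell /=.
  by have := dig_lt 0 x; rewrite expn0; case: dig.
- move=> B [->|[n [k ->]]]; first by rewrite !measure0.
  have [nk|kn] := leqP (2 ^ n) k.
    have e0 : cell n k = set0 :> set X.
      apply/seteqP; split => // x xk; have := dig_lt n x.
      by rewrite (xk : dig n x = k) ltnNge nk.
    by rewrite e0 !measure0.
  transitivity ((2 ^- n)%:E : \bar R); first exact: lebtorus_cell.
  apply/esym; transitivity (lebtorus ((@doubling R : X -> X) @^-1` cell n k)); first by [].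
  have -> : (@doubling R : X -> X) @^-1` cell n k = cell n.+1 k `|` cell n.+1 (2 ^ n + k).
    apply/seteqP; split => x.
      move=> xk; have {}xk : dig n (x *+ 2 ^ 1) = k := xk.
      have := digD 1 n x; rewrite xk add1n; have := dig_lt 1 x.
      by case: (dig 1 x) => [|[|//]] _ h; [left|right]; rewrite /cell /= h ?mul1n.
    move=> h; have xd : dig n (x *+ 2 ^ 1) = (dig n.+1 x %% 2 ^ n)%N.
      by rewrite -[n.+1]add1n digD modnMDl modn_small// dig_lt.
    rewrite /preimage /cell /=.
    have -> : dig n (doubling x) = (dig n.+1 x %% 2 ^ n)%N by [].
    by case: h => h; rewrite (h : dig n.+1 x = _) ?modnDl modn_small.
  have d0 : cell n.+1 k `&` cell n.+1 (2 ^ n + k) = set0 :> set X.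
    apply/seteqP; split => // x [h1 h2].
    have : (k = 2 ^ n + k)%N by rewrite -{1}(h1 : dig n.+1 x = k) -(h2 : dig n.+1 x = _).
    by move=> /eqP; rewrite -{1}[k]add0n eqn_add2r eq_sym expn_eq0.
  transitivity (lebtorus (cell n.+1 k) + lebtorus (cell n.+1 (2 ^ n + k)))%E.
    by apply: measureU => //; exact: measurable_cell.
  rewrite !lebtorus_cell.
  - rewrite -EFinD; congr EFin; rewrite exprS; field.
    by rewrite gt_eqF// exprn_gt0.
  - by rewrite expnS mul2n -addnn ltn_add2l.
  - by rewrite (ltn_trans kn)// expnS mul2n -addnn -{1}[(2 ^ n)%N]addn0 ltn_add2l expn_gt0.
- move=> _; apply: (@le_lt_trans _ _ (lebtorus setT)).
    by apply: le_measure; rewrite ?inE//; exact: measurable_cell.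
  by rewrite -[X in (X < _)%E]/(lebtorus setT) probability_setT ltry.
Qed.

End LebesgueTorus.

(** * Invariant measures carried by concatenations of blocks *)

Lemma digits_inj (B p q d e : nat) : (d < B)%N -> (e < B)%N ->
  (p * B + d = q * B + e)%N -> p = q /\ d = e.
Proof.
move=> dB eB h.
have h1 := congr1 (divn^~ B) h; have h2 := congr1 (modn^~ B) h; move: h1 h2.
have B0 : (0 < B)%N by exact: leq_ltn_trans dB.
by rewrite /= !modnMDl !modn_small// !divnMDl// !divn_small// !addn0.
Qed.

Section BlockCoding.
Variable R : realType.
Local Notation X := (btorus R).
Local Notation T := (@doubling R : btorus R -> btorus R).
Variables (a N : nat) (w : nat -> nat).
Hypothesis N0 : (0 < N)%N.
Hypothesis w_inj : forall d e, (d < 2 ^ a)%N -> (e < 2 ^ a)%N -> w d = w e -> d = e.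
Hypothesis w_lt : forall d, (d < 2 ^ a)%N -> (w d < (2 ^ N).-1)%N.

Implicit Types x y : torus R.

(** The point [code x] has as its binary expansion the concatenation of the
    words [w d] of length [N], where [d] runs over the successive blocks of [a]
    digits of [x]; it is defined as the sum of the corresponding series. *)
Definition code_sum (m : nat) x : R :=
  \sum_(k < m) (w (dig a (x *+ 2 ^ (a * k))))%:R / 2 ^+ (N * k.+1).

Definition code_lim x : R := limn (fun m => code_sum m x).

Definition code x : torus R := proj (code_lim x).

Let p0 : 0 < 2 ^+ N :> R. Proof. by rewrite exprn_gt0. Qed.
Let p1 : 1 < 2 ^+ N :> R.
Proof. by rewrite exprn_egt1 ?ltr1n// -lt0n. Qed.

Lemma code_sumS m x :
  code_sum m.+1 x = ((w (dig a x))%:R + code_sum m (x *+ 2 ^ a)) / 2 ^+ N.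
Proof.
rewrite /code_sum big_ord_recl muln0 expn0 mulr1n muln1 mulrDl; congr (_ + _).
rewrite mulr_suml; apply: eq_bigr => k _; rewrite lift0 -mulrnA -expnD mulnS.
by rewrite [in RHS]mulnS [(N * k.+2)%N]mulnS exprD invfM mulrA mulrAC mulnS.
Qed.

Lemma code_sum_ge0 m x : 0 <= code_sum m x.
Proof. by apply: sumr_ge0 => k _; rewrite divr_ge0// exprn_ge0. Qed.

(** Words are required to differ from the word [11...1], of index [2^N - 1].
    The value of the series is then at most that of the constant digit
    [2^N - 2] in base [2^N], so that it stays away from [1] and its digits are
    the expected ones. *)
Definition code_max : R := (2 ^+ N - 2) / (2 ^+ N - 1).

Lemma code_max_lt1 : code_max < 1.
Proof. by rewrite /code_max ltr_pdivrMr ?subr_gt0// mul1r; lra. Qed.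

Lemma w_le x : (w (dig a x))%:R <= 2 ^+ N - 2 :> R.
Proof.
have := w_lt (dig_lt a x); rewrite -ltnS prednK ?expn_gt0// => h.
have : ((w (dig a x)).+2 <= 2 ^ N)%N by [].
by rewrite -(ler_nat R) natrX -addn2 natrD; lra.
Qed.

Lemma code_sum_le m x : code_sum m x <= code_max.
Proof.
have q0 : 0 <= code_max.
  have q2 : 2 <= 2 ^+ N :> R by rewrite -natrX ler_nat -{1}(expn1 2) leq_exp2l.
  by apply: divr_ge0; lra.
elim: m x => [|m IH] x; first by rewrite /code_sum big_ord0.
rewrite code_sumS ler_pdivrMr//; have := IH (x *+ 2 ^ a); have := w_le x.
have -> : code_max * 2 ^+ N = (2 ^+ N - 2) + code_max.
  by rewrite /code_max; field; rewrite subr_eq0 gt_eqF.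
lra.
Qed.

Lemma cvg_code_sum x : code_sum m x @[m --> \oo] --> code_lim x.
Proof.
apply: nondecreasing_is_cvgn.
  apply/nondecreasing_seqP => m; rewrite /code_sum big_ord_recr/= lerDl.
  by rewrite divr_ge0// exprn_ge0.
by exists code_max => _ [m _ <-]; exact: code_sum_le.
Qed.

Lemma code_lim_itv x : 0 <= code_lim x < 1.
Proof.
apply/andP; split.
  apply: (limr_ge (cvgP _ (cvg_code_sum (x := x)))); apply: nearW => m; exact: code_sum_ge0.
apply: le_lt_trans code_max_lt1.
apply: (limr_le (cvgP _ (cvg_code_sum (x := x)))); apply: nearW => m; exact: code_sum_le.
Qed.

Lemma code_limE x : code_lim x = ((w (dig a x))%:R + code_lim (x *+ 2 ^ a)) / 2 ^+ N.
Proof.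
have h1 : code_sum m.+1 x @[m --> \oo] --> code_lim x.
  by have := cvg_code_sum (x := x); rewrite -(cvg_shiftS (fun m => code_sum m x)).
have h2 : code_sum m.+1 x @[m --> \oo] -->
    ((w (dig a x))%:R + code_lim (x *+ 2 ^ a)) / 2 ^+ N.
  under eq_fun do rewrite code_sumS.
  by apply: cvgM; [apply: cvgD; [exact: cvg_cst|exact: cvg_code_sum]|exact: cvg_cst].
by rewrite -(cvg_lim (@Rhausdorff R) h1) (cvg_lim (@Rhausdorff R) h2).
Qed.

Lemma dig_code x : dig N (code x) = w (dig a x).
Proof.
rewrite /code code_limE; apply: dig_proj; last exact: code_lim_itv.
by apply: leq_trans (w_lt (dig_lt a x)) _; exact: leq_pred.
Qed.

(** The coding conjugates the shift by one block of [a] digits to [T^N]. *)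
Lemma code_shift x : code x *+ 2 ^ N = code (x *+ 2 ^ a).
Proof.
rewrite /code proj_mulX code_limE mulrC divfK ?gt_eqF//.
by rewrite projD proj_nat add0r.
Qed.

Lemma dig_code_inj k x y : dig (k * N) (code x) = dig (k * N) (code y) ->
  dig (k * a) x = dig (k * a) y.
Proof.
elim: k x y => [|k IH] x y.
  by rewrite mul0n; have := dig_lt 0 x; have := dig_lt 0 y; case: dig => //; case: dig.
rewrite !mulSn !digD !code_shift => e.
have [e1 e2] := digits_inj (dig_lt _ _) (dig_lt _ _) e.
move: e1; rewrite !dig_code => e1.
by rewrite (IH _ _ e2) (w_inj (dig_lt a x) (dig_lt a y) e1).
Qed.

Lemma measurable_iterT i : measurable_fun [set: X] (iter i T).
Proof.
elim: i => [|i IHi]; first exact: measurable_id.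
exact: measurableT_comp (@measurable_doubling R) IHi.
Qed.

Lemma measurable_code : measurable_fun [set: X] (code : X -> X).
Proof.
have h : measurable_fun [set: X] (code_lim : X -> R).
  apply: (measurable_fun_cvg (h := fun m (x : X) => code_sum m x)) => [m|x _].
    apply: measurable_sum => k.
    under eq_fun do rewrite -iter_doubling.
    exact: (measurableT_comp (measurable_fin_comp (fun d : 'I_(2 ^ a) => (w d)%:R / 2 ^+ (N * k.+1))
      (@fmeasurable_dign R a)) (measurable_iterT (a * k))).
  exact: cvg_code_sum.
exact: measurableT_comp (@measurable_proj R) h.
Qed.

Lemma measurable_iter_code i : measurable_fun [set: X] (fun x : X => iter i T (code x)).
Proof. exact: measurableT_comp (measurable_iterT i) measurable_code. Qed.

Lemma lebtorus_iter i (A : set X) : measurable A ->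
  lebtorus R (iter i T @^-1` A) = lebtorus R A.
Proof.
move=> mA; elim: i => [//|i <-].
have mi : measurable (iter i T @^-1` A).
  by rewrite -[X in measurable X]setTI; apply: measurable_iterT.
by rewrite -(lebtorus_doubling mi); congr (lebtorus R _); apply/seteqP; split => x /=; rewrite -iterSr.
Qed.

(** The image of Lebesgue measure under the coding is invariant under [T^N]
    only; averaging over [N] consecutive iterates makes it invariant under
    [T]. *)
Definition block_measure : probability X R :=
  average (lebtorus R) (fun i => mfun_of (measurable_iter_code i)) N.-1.

Lemma block_measureE A : block_measure A =
  (N%:R^-1%:E * \sum_(i < N) lebtorus R [set x | A (iter i T (code x))])%E.
Proof.
transitivity (average (lebtorus R) (fun i => mfun_of (measurable_iter_code i)) N.-1 A).
  by [].
by rewrite averageE prednK. Qed.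

Lemma block_invariant : invariant_measure T block_measure.
Proof.
move=> A mA; rewrite !block_measureE; congr mule.
pose F i := lebtorus R [set x | A (iter i T (code x))].
have FN : F N = F 0%N.
  rewrite /F; have mC : measurable (code @^-1` A : set X).
    by rewrite -[X in measurable X]setTI; apply: measurable_code.
  transitivity (lebtorus R (iter a T @^-1` (code @^-1` A))).
    by congr (lebtorus R _); apply/seteqP; split => x; rewrite /preimage /= !iter_doubling code_shift.
  by rewrite lebtorus_iter.
transitivity (\sum_(i < N) F i.+1)%E; first by apply: eq_bigr => i _.
rewrite -(big_mkord predT F) -(big_mkord predT (F \o S)) /=.
rewrite -(prednK N0) big_nat_recr//= [in RHS]big_nat_recl//= prednK// FN addeC.
by [].
Qed.

(** Among [(k + 1) N] digits from time [i < N] on, at least [k] blocks are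
    complete.  They determine [k] blocks of [a] digits of the coded point,
    since distinct blocks have distinct words. *)
Lemma block_cell_le k i d : (i < N)%N ->
  (lebtorus R [set x | dig (k.+1 * N) (iter i T (code x)) = d] <= (2 ^- (k * a))%:E)%E.
Proof.
move=> iN.
have [[x0 hx0]|h] := pselect (exists x, dig (k.+1 * N) (iter i T (code x)) = d); last first.
  have -> : [set x | dig (k.+1 * N) (iter i T (code x)) = d] = set0.
    by apply/seteqP; split => // x /= hx; apply: h; exists x.
  by rewrite measure0 lee_fin invr_ge0 exprn_ge0.
pose e := dig (k * a) (x0 *+ 2 ^ a).
have mc : measurable (iter a T @^-1` cell (k * a) e).
  by rewrite -[X in measurable X]setTI; apply: measurable_iterT => //; exact: measurable_cell.
have ec : (e < 2 ^ (k * a))%N by exact: dig_lt.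
rewrite -(lebtorus_cell R ec) -(lebtorus_iter a (measurable_cell _ _)).
apply: le_measure; rewrite ?inE//.
  have -> : [set x | dig (k.+1 * N) (iter i T (code x)) = d] =
     (fun x : X => iter i T (code x)) @^-1` cell (k.+1 * N) d by [].
  by rewrite -[X in measurable X]setTI; apply: measurable_iter_code => //; exact: measurable_cell.
move=> x /=; rewrite -hx0 !iter_doubling => hx.
change (dig (k * a) (x *+ 2 ^ a) = e).
apply: dig_code_inj; rewrite -!code_shift.
have kN : (k.+1 * N = (N - i) + (k * N + i))%N.
  by rewrite addnCA subnK ?(ltnW iN)// addnC -mulSn.
move: hx; rewrite kN => /dig_tail; rewrite -!mulrnA -!expnD subnKC//; exact: ltnW.
Qed.

(** All cells of generation [(k + 1) N] have measure at most [2^-(k a)], so that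
    the entropy of the itineraries is at least [k a ln 2]. *)
Lemma block_entropy : ((a%:R * ln 2 / N%:R)%:E <= ks_entropy T block_measure)%E.
Proof.
have mD := @fmeasurable_dign R 1.
have pD : measurable_partition (fun i => @dign R 1 @^-1` [set i]).
  split; first exact: mD.
  split.
  - by apply/seteqP; split => // x _; exists (dign 1 x).
  - by move=> i j _ _ [x [/= <- <-]].
  - move=> i _; exists (proj ((i%:R + 0) / 2 ^+ 1)) => /=; apply: val_inj => /=.
    by rewrite dig_proj// lexx ltr01.
apply: (@le_trans _ _ (partition_entropy T block_measure (fun i => @dign R 1 @^-1` [set i]))%:E); last first.
  by apply: ereal_sup_ubound; exists (2 ^ 1)%N, (fun i => @dign R 1 @^-1` [set i]).
rewrite lee_fin /partition_entropy.
have -> : (fun n => join_entropy T block_measure (fun i => @dign R 1 @^-1` [set i]) n / n%:R) =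
  (fun n => entropy block_measure (itin T (@dign R 1) n) / n%:R).
  by apply/funext => n; rewrite join_entropyE.
have mT := @measurable_doubling R.
apply: (@le_lim_along _ _ N _ (a%:R * ln 2) N0 (cvg_entropy mT block_invariant mD)).
move=> k; have NR : N%:R != 0 :> R by rewrite pnatr_eq0 -lt0n.
have mI n : fmeasurable (itin T (@dign R 1) n) by exact: fmeasurable_itin.
case: k => [|k].
  rewrite mul0n mul0r sub0r; apply: (@le_trans _ _ 0); last exact: entropy_ge0.
  by rewrite oppr_le0 mulr_ge0// ln_ge0// ler1n.
have -> : (k.+1 * N)%:R * (a%:R * ln 2 / N%:R) - a%:R * ln 2 = (k * a)%:R * ln 2 :> R.
  by rewrite !natrM -natr1; field.
have itin_dig n x y : itin T (@dign R 1) n x = itin T (@dign R 1) n y -> dig n x = dig n y.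
  move=> e; rewrite -[n]muln1; apply: dig_blocks => b bn.
  have := congr1 (fun f : {ffun 'I_n -> 'I_(2 ^ 1)} => val (f (Ordinal bn))) e.
  by rewrite !ffunE /= muln1 !iter_doubling.
have law_le v : law block_measure (itin T (@dign R 1) (k.+1 * N)) v <= 2 ^- (k * a).
  rewrite -lee_fin -lawE// block_measureE.
  have [[x0 hx0]|h] := pselect (exists x, itin T (@dign R 1) (k.+1 * N) x = v); last first.
    rewrite big1 ?mule0 ?lee_fin ?invr_ge0 ?exprn_ge0// => i _.
    rewrite (_ : [set _ | _] = set0) ?measure0//.
    by apply/seteqP; split => // x /= hx; apply: h; exists (iter i T (code x)).
  apply: (@le_trans _ _ (N%:R^-1%:E * \sum_(i < N) (2 ^- (k * a))%:E)%E).
    apply: lee_wpmul2l; first by rewrite lee_fin invr_ge0.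
    apply: lee_sum => i _; apply: le_trans (block_cell_le k (dig (k.+1 * N) x0) (ltn_ord i)).
    apply: le_measure; rewrite ?inE.
    - rewrite -[X in measurable X]setTI.
      exact: (measurable_iter_code i measurableT (mI (k.+1 * N)%N v)).
    - rewrite -[X in measurable X]setTI.
      exact: (measurable_iter_code i measurableT (measurable_cell (k.+1 * N) (dig (k.+1 * N) x0))).
    - by move=> x /= hx; apply: itin_dig; rewrite hx.
  by rewrite sumEFin sumr_const card_ord -EFinM lee_fin -[X in _ * X]mulr_natl mulrA mulVf// mul1r.
rewrite /entropy -sumrN.
set L := law block_measure _ in law_le *.
have -> : (k * a)%:R * ln 2 = \sum_v L v * ((k * a)%:R * ln 2).
  by rewrite -mulr_suml (law_sum1 block_measure (mI _)) mul1r.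
apply: ler_sum => v _; have : 0 <= L v by exact: law_ge0.
rewrite le_eqVlt => /orP[/eqP <-|v0]; first by rewrite !mul0r oppr0.
rewrite -mulrN ler_pM2l// lerNr.
have -> : - ((k * a)%:R * ln 2) = ln (2 ^- (k * a)) :> R.
  by rewrite lnV ?posrE ?exprn_gt0// lnXn// mulr_natl.
by rewrite ler_ln ?posrE ?invr_gt0 ?exprn_gt0.
Qed.

(** Under [block_measure] the entropy is at least [a ln 2 / N], and the orbit
    of almost every point is a concatenation of words [w d]: the hypothesis on
    two successive words bounds the distance to [c] and the Birkhoff sum over
    the first of them. *)
Lemma block_pressure c (t rho S : R) : 0 <= t -> 0 < rho ->
  (forall x, (exists2 d, (d < 2 ^ a)%N & dig N x = w d) ->
     (exists2 d, (d < 2 ^ a)%N & dig N (x *+ 2 ^ N) = w d) ->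
     (forall i, (i < N)%N -> rho <= sg (x *+ 2 ^ i - c)) /\
     S <= \sum_(i < N) ln (sg (x *+ 2 ^ i - c))) ->
  (((a%:R * ln 2 + 2 * t * S) / N%:R)%:E <= pressure c t)%E.
Proof.
move=> t0 rho0 H.
have {}H x : (forall i, (i < N)%N -> rho <= sg (code x *+ 2 ^ i - c)) /\
     S <= \sum_(i < N) ln (sg (code x *+ 2 ^ i - c)).
  apply: H; first by exists (dig a x); [exact: dig_lt|exact: dig_code].
  exists (dig a (x *+ 2 ^ a)); first exact: dig_lt.
  by rewrite code_shift dig_code.
have avoid : invariant_avoiding c block_measure.
  split; first exact: block_invariant.
  move=> hs; have /hs : open [set x | sg (x - c) < rho] by exact: open_sgB.
  rewrite /= subrr sg0 rho0 => /(_ isT); rewrite block_measureE big1 ?mule0 ?ltxx// => i _.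
  rewrite (_ : [set _ | _] = set0) ?measure0//.
  apply/seteqP; split => // x /=; rewrite iter_doubling ltNge.
  by have [-> //] := H x.
apply: (@le_trans _ _ (ks_entropy T block_measure + \int[block_measure]_x (t%:E * psi c x))%E); last first.
  by apply: ereal_sup_ubound; exists block_measure.
have NR : 0 < N%:R :> R by rewrite ltr0n.
rewrite mulrDl EFinD; apply: leeD; first exact: block_entropy.
pose f (x : X) : \bar R := (- (t%:E * psi c x))%E.
have f0 x : (0 <= f x)%E by rewrite oppe_ge0 mule_ge0_le0 ?lee_fin// psi_le0.
have mf : measurable_fun [set: X] f.
  by apply: measurableT_comp => //; apply: measurable_funeM; exact: measurable_psi.
have -> : (\int[block_measure]_x (t%:E * psi c x) = - \int[block_measure]_x f x)%E.
  by rewrite -integral_ge0N => [|x _ //]; apply: eq_integral => x _; rewrite /f oppeK.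
rewrite leeNr -EFinN.
have -> : (\int[block_measure]_x f x =
   \int[average (lebtorus R) (fun i => mfun_of (measurable_iter_code i)) N.-1]_x f x)%E by [].
rewrite ge0_integral_average// prednK//.
have mfi i : measurable_fun [set: X] (fun x : X => f (iter i T (code x))).
  exact: measurableT_comp mf (measurable_iter_code i).
apply: (@le_trans _ _ (N%:R^-1%:E * \int[lebtorus R]_x (- (2 * t * S))%:E)%E).
  apply: lee_wpmul2l; first by rewrite lee_fin invr_ge0 ltW.
  rewrite (eq_bigr (fun i : 'I_N => \int[lebtorus R]_x f (iter i T (code x)))%E)//.
  rewrite -ge0_integral_sum//.
  apply: ge0_le_integral => //.
  - by move=> x _; apply: sume_ge0.
  - by apply: emeasurable_sum.
  move=> x _; have [hr hS] := H x.
  have -> : (\sum_(i < N) f (iter i T (code x)) =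
     (\sum_(i < N) - (2 * t * ln (sg (code x *+ 2 ^ i - c))))%:E)%E.
    rewrite -sumEFin; apply: eq_bigr => i _; rewrite /f iter_doubling psi_ln.
      by rewrite -EFinM -EFinN mulrCA mulrA.
    by apply: lt_le_trans rho0 _; exact: hr.
  by rewrite lee_fin sumrN -mulr_sumr lerN2 ler_wpM2l// mulr_ge0.
rewrite (integral_cst (lebtorus R) measurableT) -[X in (_ * (_ * X))%E]/(lebtorus R setT).
rewrite probability_setT mule1 -EFinM lee_fin mulrC mulNr.
exact: lexx.
Qed.

End BlockCoding.

(** * The pressure at exponent zero *)

Section BlockSets.
Variable R : realType.
Implicit Types (x y c : torus R) (n N k : nat).

Lemma block_pressure_seq c (t rho S : R) (a N : nat) (W : seq nat) :
  0 <= t -> 0 < rho -> (0 < N)%N -> uniq W -> (2 ^ a <= size W)%N ->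
  (forall k, k \in W -> (k < (2 ^ N).-1)%N) ->
  (forall x, dig N x \in W -> dig N (x *+ 2 ^ N) \in W ->
     (forall i, (i < N)%N -> rho <= sg (x *+ 2 ^ i - c)) /\
     S <= \sum_(i < N) ln (sg (x *+ 2 ^ i - c))) ->
  (((a%:R * ln 2 + 2 * t * S) / N%:R)%:E <= pressure c t)%E.
Proof.
move=> t0 rho0 N0 uW sW Wlt H.
have wW d : (d < 2 ^ a)%N -> nth 0%N W d \in W.
  by move=> da; apply: mem_nth; exact: leq_trans sW.
apply: (@block_pressure R a N (nth 0%N W) N0 _ _ c t rho S t0 rho0).
- move=> d e da ea /eqP; rewrite nth_uniq ?(leq_trans _ sW)//; first by move/eqP.
- by move=> d da; apply/Wlt/wW.
- by move=> x [d da xd] [e ea xe]; apply: H; rewrite ?xd ?xe wW.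
Qed.

Lemma sin_digits_far N (u v : R) k p : (0 < N)%N ->
  k%:R <= 2 ^+ N * u < k.+1%:R -> p%:R <= 2 ^+ N * v < p.+1%:R ->
  (p + 2 <= k)%N -> (k + 2 <= 2 ^ N + p)%N ->
  sin (pi / 2 ^+ N) <= `|sin (pi * (u - v))|.
Proof.
move=> N0 /andP[u1 u2] /andP[v1 v2] pk kp.
have p0 : 0 < 2 ^+ N :> R by rewrite exprn_gt0.
have q1 : p%:R + 2 <= k%:R :> R by rewrite -natrD ler_nat.
have q2 : k%:R + 2 <= 2 ^+ N + p%:R :> R by rewrite -natrX -!natrD ler_nat.
have {u2 kp} u2 : 2 ^+ N * u < k%:R + 1 by rewrite natr1.
have {v2 pk} v2 : 2 ^+ N * v < p%:R + 1 by rewrite natr1.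
have e1 : 2 ^- N = 1 / 2 ^+ N :> R by rewrite div1r.
apply: le_trans (ler_norm _); apply: sin_ge; apply/andP; split.
- by rewrite invr_gt0.
- by rewrite lef_pV2 ?posrE//= -natrX ler_nat -{1}(expn1 2) leq_exp2l.
- by rewrite e1 ler_pdivrMr// mulrC mulrBr; lra.
- have : 1 / 2 ^+ N <= 1 - (u - v); last by rewrite e1; lra.
  by rewrite ler_pdivrMr// mulrC !mulrBr mulr1; lra.
Qed.

(** Points whose cells are neither equal nor adjacent on the circle are at
    least one cell apart.  Excluding the first and the last cell for [y] avoids
    treating adjacency across [0]. *)
Lemma sg_dig_far N y z : dig N y != 0%N -> (dig N y < (2 ^ N).-1)%N ->
  dig N y != dig N z -> dig N y != (dig N z).+1 -> (dig N y).+1 != dig N z ->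
  (0 < N)%N -> sin (pi / 2 ^+ N) <= sg (y - z).
Proof.
have dz := dig_lt N z.
have hy := dig_itv N y; have hz := dig_itv N z.
rewrite -(proj_frac y) -(proj_frac z) -projB sg_proj => k0 kl kp kp1 kp2 N0.
move: k0 kl kp kp1 kp2 dz hy hz; rewrite !proj_frac.
move: (dig N y) (dig N z) (frac y) (frac z) => k p u v k0 kl kp kp1 kp2 dz hy hz.
have [pk|kp'] := leqP p k.
  apply: sin_digits_far hy hz _ _ => //; move: (2 ^ N)%N kl dz => M *; lia.
have -> : pi * (u - v) = - (pi * (v - u)) by ring.
rewrite sinN normrN; apply: sin_digits_far hz hy _ _ => //.
  by lia.
by move: (2 ^ N)%N kl dz => M *; lia.
Qed.

Lemma exp2_lin N : (6 <= N)%N -> (3 * N + 2 <= 2 ^ N.-1)%N.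
Proof.
elim: N => // N IH; rewrite ltnS leq_eqVlt => /orP[/eqP <- //|N6].
by have := IH N6; case: N N6 {IH} => // N _ /= h; rewrite expnS; lia.
Qed.

Lemma size_notin (s bad : seq nat) : uniq s ->
  (size s <= size [seq k <- s | k \notin bad] + size bad)%N.
Proof.
move=> us; rewrite -[X in (X <= _)%N](count_predC (mem bad)) addnC leq_add//.
  by rewrite size_filter.
rewrite -size_filter; apply: uniq_leq_size; first exact: filter_uniq.
by move=> k; rewrite mem_filter => /andP[].
Qed.

(** At [t = 0] only the entropy matters.  Words of length [N] that avoid the
    cells of the first [N] images of [c] and their neighbours keep the orbit away
    from [c], and at least half of all words remain: this leaves [N - 1] free
    bits in [N] digits. *)
Lemma pressure0_ge c : ((ln 2)%:E <= pressure c 0)%E.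
Proof.
have ln2 : 0 < ln 2 :> R by rewrite ln_gt0// ltr1n.
suff H N : (6 <= N)%N -> ((N.-1%:R * ln 2 / N%:R)%:E <= pressure c 0)%E.
  apply/lee_addgt0Pr => e e0.
  have le0 : 0 <= ln 2 / e by rewrite divr_ge0 ?ltW.
  have := truncn_itv le0; set m := Num.truncn _ => /andP[_ hm].
  pose N := (m + 6)%N; have N6 : (6 <= N)%N by rewrite leq_addl.
  have N0 : 0 < N%:R :> R by rewrite ltr0n (leq_trans _ N6).
  apply: (@le_trans _ _ ((N.-1%:R * ln 2 / N%:R)%:E + e%:E)%E); last by rewrite leeD2r// H.
  rewrite -EFinD lee_fin -(ler_pM2r N0) mulrDl divfK ?gt_eqF//.
  have : ln 2 < N%:R * e.
    rewrite -ltr_pdivrMr//; apply: (lt_le_trans hm); rewrite ler_nat /N; lia.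
  by have -> : N%:R = N.-1%:R + 1 :> R; [rewrite natr1 prednK// (leq_trans _ N6)|lra].
move=> N6; have N0 : (0 < N)%N by exact: leq_trans N6.
pose bad := 0%N :: flatten [seq [:: dig N (c *+ 2 ^ r.+1); (dig N (c *+ 2 ^ r.+1)).+1;
   (dig N (c *+ 2 ^ r.+1)).-1] | r <- iota 0 N].
pose W := [seq k <- iota 0 (2 ^ N).-1 | k \notin bad].
have szb : size bad = (3 * N).+1.
  rewrite /bad /= size_flatten /shape -map_comp (eq_map (g := fun=> 3%N))//.
  suff -> : forall s : seq nat, sumn [seq 3%N | _ <- s] = (3 * size s)%N by rewrite size_iota.
  by elim=> //= r s ->; rewrite mulnS.
have rho0 : 0 < sin (pi / 2 ^+ N) / 2 ^+ N :> R.
  rewrite divr_gt0 ?exprn_gt0//; apply: sin_gt0_pi.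
  rewrite divr_gt0 ?pi_gt0 ?exprn_gt0//= ltr_pdivrMr ?exprn_gt0//.
  by rewrite ltr_pMr ?pi_gt0// exprn_egt1 ?ltr1n// -lt0n.
have hW x : dig N x \in W -> dig N (x *+ 2 ^ N) \in W ->
   forall i, (i < N)%N -> sin (pi / 2 ^+ N) / 2 ^+ N <= sg (x *+ 2 ^ i - c).
  move=> _; rewrite mem_filter mem_iota add0n => /andP[nb /andP[_ kl]] i iN.
  have far : sin (pi / 2 ^+ N) <= sg (x *+ 2 ^ N - c *+ 2 ^ (N - i)).
    have nb2 : forall k, k \in [:: dig N (c *+ 2 ^ (N - i)); (dig N (c *+ 2 ^ (N - i))).+1;
         (dig N (c *+ 2 ^ (N - i))).-1] -> dig N (x *+ 2 ^ N) != k.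
      move=> k hk; apply: contra nb => /eqP ->; rewrite inE; apply/orP; right.
      apply/flattenP; exists [:: dig N (c *+ 2 ^ (N - i)); (dig N (c *+ 2 ^ (N - i))).+1;
         (dig N (c *+ 2 ^ (N - i))).-1] => //.
      apply/mapP; exists (N - i).-1; first by rewrite mem_iota /=; lia.
      by rewrite prednK ?subn_gt0.
    apply: sg_dig_far => //.
    - by apply: contra nb => /eqP ->; rewrite inE eqxx.
    - by apply: nb2; rewrite !inE eqxx.
    - by apply: nb2; rewrite !inE eqxx orbT.
    - apply: contraTN (nb2 (dig N (c *+ 2 ^ (N - i))).-1 _).
        by rewrite negbK => /eqP <-.
      by rewrite !inE eqxx !orbT.
  rewrite ler_pdivrMr ?exprn_gt0//; apply: (le_trans far).
  have -> : x *+ 2 ^ N - c *+ 2 ^ (N - i) = (x *+ 2 ^ i - c) *+ 2 ^ (N - i).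
    by rewrite mulrnBl -mulrnA -expnD subnKC// ltnW.
  apply: (le_trans (sg_mulX _ _)); rewrite mulrC ler_wpM2l ?sg_ge0//.
  by rewrite ler_eXn2l ?ltr1n// leq_subr.
pose S := N%:R * ln (sin (pi / 2 ^+ N) / 2 ^+ N : R).
have := @block_pressure_seq c 0 _ S N.-1 N W (lexx 0) rho0 N0.
rewrite mulr0 mul0r addr0; apply.
- exact/filter_uniq/iota_uniq.
- have := size_notin bad (iota_uniq 0 (2 ^ N).-1); rewrite size_iota szb -/W.
  have := exp2_lin N6; have -> : (2 ^ N = 2 * 2 ^ N.-1)%N by rewrite -expnS prednK.
  move: (size W) (2 ^ N.-1)%N => sW P *; lia.
- by move=> k; rewrite mem_filter mem_iota add0n => /andP[_ /andP[]].
- move=> x h1 h2; split; first exact: hW.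
  rewrite /S mulr_natl -[N in _ *+ N]card_ord -sumr_const; apply: ler_sum => i _.
  have hi := hW x h1 h2 i (ltn_ord i).
  by rewrite ler_ln ?posrE//; exact: lt_le_trans hi.
Qed.

End BlockSets.

(** * Spacers: backward orbits that stay away from the singularity *)

Section Spacers.
Variable R : realType.
Implicit Types (x y z c u p : torus R) (n k q L : nat).

(** From every landing point [z] of the good set [G] one can go back two steps
    in two ways, each ending in [G] and avoiding the [del]-neighbourhood of
    [c].  Two steps are needed because one preimage may lie near [c]. *)
Definition spacer c (del : R) (G : set (torus R)) := forall z, G z ->
  exists y y', [/\ y != y', G y /\ G y', y *+ 2 ^ 2 = z /\ y' *+ 2 ^ 2 = z &
    [/\ del <= sg (y - c), del <= sg (y *+ 2 - c), del <= sg (y' - c) & del <= sg (y' *+ 2 - c)]].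

Lemma spacer_tree c del G q z : spacer c del G -> G z ->
  exists Y : seq (torus R), [/\ uniq Y, size Y = (2 ^ q)%N & forall y, y \in Y ->
    [/\ G y, y *+ 2 ^ (2 * q) = z & forall i, (i < 2 * q)%N -> del <= sg (y *+ 2 ^ i - c)]].
Proof.
move=> sp Gz; elim: q => [|q [Y [uY sY hY]]].
  exists [:: z]; split => // y; rewrite inE => /eqP ->; split => //.
have /choice[f hf] : forall y, exists yy : torus R * torus R, G y ->
   [/\ yy.1 != yy.2, G yy.1 /\ G yy.2, yy.1 *+ 2 ^ 2 = y /\ yy.2 *+ 2 ^ 2 = y &
    [/\ del <= sg (yy.1 - c), del <= sg (yy.1 *+ 2 - c), del <= sg (yy.2 - c)
      & del <= sg (yy.2 *+ 2 - c)]].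
  move=> y; have [/sp[u [v h]]|nG] := pselect (G y); first by exists (u, v).
  by exists (y, y).
have hf1 y : y \in Y -> (f y).1 *+ 2 ^ 2 = y.
  by move=> /hY[/hf[_ _ [h _] _] _ _].
have hf2 y : y \in Y -> (f y).2 *+ 2 ^ 2 = y.
  by move=> /hY[/hf[_ _ [_ h] _] _ _].
exists ([seq (f y).1 | y <- Y] ++ [seq (f y).2 | y <- Y]); split.
- rewrite cat_uniq !map_inj_in_uniq ?uY ?andbT//=.
  + apply/hasPn => _ /mapP[y yY ->]; apply/mapP => -[y' y'Y e].
    have yy' : y = y' by rewrite -(hf2 _ yY) -(hf1 _ y'Y) e.
    by move: e; rewrite -yy' => e; have [Gy _ _] := hY _ yY; have [] := hf _ Gy; rewrite e eqxx.
  + by move=> y y' yY y'Y e; rewrite -(hf2 _ yY) -(hf2 _ y'Y) e.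
  + by move=> y y' yY y'Y e; rewrite -(hf1 _ yY) -(hf1 _ y'Y) e.
- by rewrite size_cat !size_map sY expnS mul2n addnn.
have key u y : y \in Y -> G u -> u *+ 2 ^ 2 = y -> del <= sg (u - c) -> del <= sg (u *+ 2 - c) ->
   [/\ G u, u *+ 2 ^ (2 * q.+1) = z & forall i, (i < 2 * q.+1)%N -> del <= sg (u *+ 2 ^ i - c)].
  move=> /hY[Gy yz yi] Gu uy u0 u1; split => //; first by rewrite mulnS expnD mulrnA uy.
  move=> [|[|i]]; [by rewrite expn0 mulr1n|by rewrite expn1|].
  by rewrite mulnS !ltnS => iq; rewrite -(addn2 i) addnC expnD mulrnA uy; exact: yi.
move=> u; rewrite mem_cat => /orP[] /mapP[y yY ->].
  by have [Gy _ _] := hY _ yY; have [_ [G1 _] [e1 _] [h1 h2 _ _]] := hf _ Gy; exact: (key _ y).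
by have [Gy _ _] := hY _ yY; have [_ [_ G1] [_ e1] [_ _ h1 h2]] := hf _ Gy; exact: (key _ y).
Qed.

(** The ends of the backward orbits are [2 * 2^-(2q)]-separated, so each of the
    fewer than [2^q] forbidden points excludes at most one of them. *)
Lemma spacer_avoid c del G q z (P : seq (torus R)) : spacer c del G -> G z ->
  (size P < 2 ^ q)%N -> exists y, [/\ y *+ 2 ^ (2 * q) = z,
    forall i, (i < 2 * q)%N -> del <= sg (y *+ 2 ^ i - c) &
    forall p, p \in P -> 1 / 2 ^+ (2 * q) <= sg (y - p)].
Proof.
move=> sp Gz sP; have [Y [uY sY hY]] := spacer_tree q sp Gz.
apply: contrapT => H.
have /choice[f hf] : forall y, exists p, y \in Y -> p \in P /\ sg (y - p) < 1 / 2 ^+ (2 * q).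
  move=> y; have [yY|nY] := boolP (y \in Y); last by exists y.
  apply: contrapT => H'; apply: H; exists y; have [_ h1 h2] := hY _ yY; split => // p pP.
  by rewrite leNgt; apply/negP => h; apply: H'; exists p.
have uf : uniq (map f Y).
  rewrite map_inj_in_uniq// => y y' yY y'Y e; apply/eqP; rewrite -subr_eq0; apply/negPn/negP => ne.
  have [_ yz _] := hY _ yY; have [_ yz' _] := hY _ y'Y.
  have d0 : (y - y') *+ 2 ^ (2 * q) = 0 by rewrite mulrnBl yz yz' subrr.
  have := sg_sep d0 ne; have := sg_triangle (f y) y y'.
  have [_ h1] := hf _ yY; have [_ h2] := hf _ y'Y.
  rewrite [sg (f y - _)]sgBC {2}e; move: h1 h2.
  move: (sg (y - f y)) (sg (y' - f y')) (sg (y - y')) => r1 r2 r3; lra.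
have := uniq_leq_size uf (_ : {subset map f Y <= P}); rewrite size_map sY leqNgt sP => /(_ _)/notF; apply.
by move=> _ /mapP[y yY ->]; have [] := hf _ yY.
Qed.

Lemma lift_frac L y : frac y = ((dig L y)%:R + frac (y *+ 2 ^ L)) / 2 ^+ L.
Proof.
by rewrite frac_mul addrC subrK mulrC mulKf// expf_neq0.
Qed.

(** The forbidden points are the first [n + 1] points of the orbit of [c], and
    the point that starts with the word [11...1], which the coding does not
    allow. *)
Lemma spacer_word c del G q n z : spacer c del G -> G z -> (n.+2 < 2 ^ q)%N ->
  exists y, [/\ y *+ 2 ^ (2 * q) = z, (dig (2 * q) y < (2 ^ (2 * q)).-1)%N,
    forall i, (i < 2 * q)%N -> del <= sg (y *+ 2 ^ i - c) &
    forall m, (m <= n)%N -> 1 / 2 ^+ (2 * q) <= sg (y - c *+ 2 ^ m)].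
Proof.
move=> sp Gz nq; set L := (2 * q)%N.
(* The preimage of [z] under [T^L] whose first [L] digits are all [1]. *)
pose p1 : torus R := proj (((2 ^ L).-1%:R + frac z) / 2 ^+ L).
pose P := p1 :: [seq c *+ 2 ^ m | m <- iota 0 n.+1].
have [|y [yz yd yP]] := @spacer_avoid c del G q z P sp Gz; first by rewrite /= size_map size_iota.
have L0 : 0 < 1 / 2 ^+ L :> R by rewrite divr_gt0 ?exprn_gt0.
exists y; split => //.
  rewrite ltn_neqAle -ltnS prednK ?expn_gt0// dig_lt andbT; apply/eqP => dy.
  have yp1 : y = p1 by rewrite -(proj_frac y) (lift_frac L) dy yz.
  by have := yP p1 (mem_head _ _); rewrite yp1 subrr sg0 leNgt L0.
move=> m mn; apply: yP; rewrite inE; apply/orP; right; apply/mapP; exists m => //.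
by rewrite mem_iota.
Qed.

Lemma two_halves x : 1 <= 2 * sg x \/ 1 <= 2 * sg (x + half R).
Proof.
have := sg_sqr x; have := sg_ge0 x; have := sg_ge0 (x + half R).
move: (sg x) (sg (x + half R)) => a b b0 a0 ab.
have [h|h] := leP 1 (2 * a); [by left|right]; nra.
Qed.

(** A preimage [u] of [z] is usable if it is far from [c], and it then has a
    preimage far from [c].  If both preimages of [z] are usable, each provides
    one backward path.  If one is near [c], the other one, [u'], is near
    [c + 1/2], and both preimages of [u'] are usable: a preimage near [c]
    would put [u'] near [2 c], whence [2 c] near [c + 1/2], that is, [c] near
    [1/2]. *)
Lemma spacer_generic c : c != half R -> spacer c (sg (c - half R) / 4) setT.
Proof.
move=> ch; set e := sg (c - half R); have e1 : e <= 1 by exact: sg_le1.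
have e0 : 0 <= e by exact: sg_ge0.
have good u : exists2 y, y *+ 2 = u & e / 4 <= sg (y - c).
  have [y yu] := halvable u.
  have [h|h] := two_halves (y - c); first by exists y => //; lra.
  by exists (y + half R); rewrite ?halfD2// addrAC; lra.
have four y u z : y *+ 2 = u -> u *+ 2 = z -> y *+ 2 ^ 2 = z.
  by move=> yu uz; rewrite expnS expn1 mulrnA yu.
(* If the preimage [u] of [z] is near [c], both paths go through [u + 1/2]. *)
have forced u z : u *+ 2 = z -> sg (u - c) < e / 4 -> exists y y' : torus R, [/\ y != y', setT y /\ setT y',
    y *+ 2 ^ 2 = z /\ y' *+ 2 ^ 2 = z & [/\ e / 4 <= sg (y - c), e / 4 <= sg (y *+ 2 - c),
    e / 4 <= sg (y' - c) & e / 4 <= sg (y' *+ 2 - c)]].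
  move=> uz uc; pose u' := u + half R; have u'z : u' *+ 2 = z by rewrite halfD2.
  have u'c : e / 4 <= sg (u' - c).
    have [h|h] := two_halves (u - c); first lra.
    by rewrite /u' addrAC; lra.
  have gy y : y *+ 2 = u' -> e / 4 <= sg (y - c).
    move=> yu; rewrite leNgt; apply/negP => yc.
    have h1 : sg (u' - c *+ 2) <= 2 * sg (y - c).
      by have := sg_mulX 1 (y - c); rewrite expn1 expr1 mulrnBl yu.
    have h2 : sg (c - half R) <= sg (u' - c *+ 2) + sg (u - c).
      have -> : c - half R = (u - c) - (u' - c *+ 2).
        by rewrite opprB mulr2n !addrA subrK /u' opprD addrACA subrr add0r.
      by rewrite addrC (le_trans (sgD _ _))// sgN addrC.
    by move: h2; rewrite -/e; lra.
  have [y yu] := halvable u'.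
  have y'u : (y + half R) *+ 2 = u' by rewrite halfD2.
  exists y, (y + half R); split => //; first by rewrite eq_sym addhalf_neq.
    by split; apply: four u'z.
  by split; rewrite ?yu ?y'u//; apply: gy.
move=> z _; have [u uz] := halvable z.
have [|uc] := ltP (sg (u - c)) (e / 4); first exact: forced.
have u'z : (u + half R) *+ 2 = z by rewrite halfD2.
have [|u'c] := ltP (sg (u + half R - c)) (e / 4); first exact: forced.
have [y yu yc] := good u; have [y' yu' yc'] := good (u + half R).
exists y, y'; split => //.
- apply/eqP => yy; have := addhalf_neq u; rewrite -yu' -yy yu eqxx//.
- by split; [exact: four uz|exact: four u'z].
- by rewrite yu yu'.
Qed.

(** If [T y] is far from [0] then [y] is far from both [0] and [1/2].  So for
    [c = 1/2] being far from [0] is inherited by all preimages, except that the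
    second preimages have to be chosen far from [0]. *)
Lemma spacer_half : spacer (half R) (1 / 8) [set z | 1 <= 2 * sg z].
Proof.
have lift y : sg (y *+ 2) <= 2 * sg (y - half R).
  have := sg_mulX 1 (y - half R); rewrite expn1 expr1 mulrnBl.
  by rewrite [half R *+ 2]mulr2n half2 subr0.
have good u : exists2 y, y *+ 2 = u & 1 <= 2 * sg y.
  have [y yu] := halvable u.
  have [h|h] := two_halves y; first by exists y.
  by exists (y + half R); rewrite ?halfD2.
move=> z /= Gz; have [u uz] := halvable z.
have u'z : (u + half R) *+ 2 = z by rewrite halfD2.
have [y yu yG] := good u; have [y' yu' yG'] := good (u + half R).
exists y, y'; split => //.
- apply/eqP => yy; have := addhalf_neq u; rewrite -yu' -yy yu eqxx//.
- by rewrite expnS expn1 !mulrnA yu yu' uz u'z.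
have := lift y; have := lift y'; have := lift u; have := lift (u + half R).
have := lift (u); rewrite yu yu' uz u'z => *.
have := sg_mulX 1 u; have := sg_mulX 1 (u + half R); rewrite !expn1 !expr1 uz u'z => *.
by split; lra.
Qed.

End Spacers.

(** * Concatenating words through a spacer *)

Lemma concat_lt_pred (M P v k : nat) : (v < M.-1)%N -> (k < P)%N ->
  (k * M + v < (P * M).-1)%N.
Proof.
move=> vM kP; have : (k.+1 * M <= P * M)%N by rewrite leq_mul2r kP orbT.
rewrite mulSn; lia.
Qed.

Section Concatenation.
Variable R : realType.
Variables (c : torus R) (A eps : R).
Hypothesis Api : pi < A.
Hypothesis eps0 : 0 <= eps.
Hypothesis hA : expR (- eps) * (A + pi) <= A - pi.
Implicit Types (x y z : torus R) (n k j L r : nat).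

(** The times at which the cell is so close to [c], compared with its own
    size, that the distance to [c] may vary a lot inside the cell. *)
Definition bad n k j : bool := sg (base R n k *+ 2 ^ j - c) < A * (2 ^+ j / 2 ^+ n).

(** What is lost at most at a bad time, when the word is followed by a spacer
    of length [L]. *)
Definition bad_cost L : R := ln (A + pi) + L.+1%:R * ln 2.

Let A1 : 1 <= A + pi.
Proof. by have := @pi_ge2 R; have := Api; lra. Qed.

Let ln2 : 0 <= ln 2 :> R. Proof. by rewrite ln_ge0// ler1n. Qed.

Lemma bad_cost_ge0 L : 0 <= bad_cost L.
Proof. by rewrite addr_ge0 ?mulr_ge0// ln_ge0. Qed.

(** If the orbit passes close to [c] at time [j], then at time [n] it is close
    to the image of [c], up to the expansion [2^(n - j)].  A spacer that avoids
    the images of [c] excludes this. *)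
Lemma word_time_lower n L x j : (j < n)%N ->
  (forall m, (m <= n)%N -> 1 / 2 ^+ L / 2 <= sg (x *+ 2 ^ n - c *+ 2 ^ m)) ->
  2 ^+ j / 2 ^+ n * (1 / 2 ^+ L / 2) <= sg (x *+ 2 ^ j - c).
Proof.
move=> jn /(_ (n - j)%N (leq_subr _ _)) h.
have e : x *+ 2 ^ n - c *+ 2 ^ (n - j) = (x *+ 2 ^ j - c) *+ 2 ^ (n - j).
  by rewrite mulrnBl -mulrnA -expnD subnKC// ltnW.
have := sg_mulX (n - j) (x *+ 2 ^ j - c); rewrite -e => h2.
have p0 m : 0 < 2 ^+ m :> R by rewrite exprn_gt0.
have -> : 2 ^+ j / 2 ^+ n = 1 / 2 ^+ (n - j) :> R.
  rewrite -{1}(subnK (ltnW jn)) exprD; field.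
  by rewrite !gt_eqF.
rewrite [1 / 2 ^+ (n - j)]mul1r mulrC ler_pdivrMr// [X in _ <= X]mulrC.
exact: le_trans h h2.
Qed.

(** At a good time the whole cell has comparable distances to [c], up to the
    factor [exp (- eps)] fixed by the choice of [A]; at a bad time the lower
    bound of [word_time_lower] is used. *)
Lemma word_time n L x j : (j < n)%N ->
  (forall m, (m <= n)%N -> 1 / 2 ^+ L / 2 <= sg (x *+ 2 ^ n - c *+ 2 ^ m)) ->
  ln (cell_dist n (dig n x) c j) - eps - (bad n (dig n x) j)%:R * bad_cost L <=
  ln (sg (x *+ 2 ^ j - c)).
Proof.
move=> jn hm; have lo := word_time_lower jn hm.
have p0 m : 0 < 2 ^+ m :> R by rewrite exprn_gt0.
set u : R := 2 ^+ j / 2 ^+ n in lo *.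
have u0 : 0 < u by rewrite divr_gt0.
have s0 : 0 < sg (x *+ 2 ^ j - c).
  by apply: lt_le_trans lo; rewrite !mulr_gt0// ?invr_gt0.
have a0 := cell_dist_gt0 n (dig n x) c j.
have awle : cell_dist n (dig n x) c j <= sg (base R n (dig n x) *+ 2 ^ j - c) + pi * u.
  by rewrite /cell_dist /u mulrA ge_min lexx orbT.
rewrite /bad -/u; set d := sg (base R n _ *+ _ - c) in awle *.
have sd : d - pi * u <= sg (x *+ 2 ^ j - c).
  have := sg_triangle (x *+ 2 ^ j) (base R n (dig n x) *+ 2 ^ j) c.
  have : sg (base R n (dig n x) *+ 2 ^ j - x *+ 2 ^ j) <= pi * u.
    by rewrite sgBC /u mulrA; exact: sg_base_mul.
  rewrite -/d; lra.
case: ltP => [bd|gd]; rewrite ?mul0r ?mul1r ?subr0.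
  suff : ln (cell_dist n (dig n x) c j) - bad_cost L <= ln (sg (x *+ 2 ^ j - c)).
    by have := eps0; lra.
  have Api0 : 0 < A + pi by apply: lt_le_trans A1.
  rewrite /bad_cost opprD addrA.
  have -> : ln (cell_dist n (dig n x) c j) - ln (A + pi) - L.+1%:R * ln 2 =
    ln (cell_dist n (dig n x) c j / (A + pi) / 2 ^+ L.+1).
    by rewrite !ln_div ?posrE ?divr_gt0// lnXn// [_ * ln 2]mulr_natl.
  rewrite ler_ln ?posrE ?divr_gt0//; apply: le_trans lo.
  have -> : u * (1 / 2 ^+ L / 2) = u / 2 ^+ L.+1 by rewrite exprS; field; rewrite gt_eqF.
  rewrite ler_pM2r ?invr_gt0// ler_pdivrMr//; apply: (le_trans awle).
  by rewrite mulrDr [u * A]mulrC [u * pi]mulrC lerD2r ltW.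
have e0 := expR_gt0 (- eps).
have -> : ln (cell_dist n (dig n x) c j) - eps = ln (expR (- eps) * cell_dist n (dig n x) c j).
  by rewrite lnM ?posrE// expRK addrC.
rewrite ler_ln ?posrE ?mulr_gt0//; apply: le_trans sd.
apply: (@le_trans _ _ (expR (- eps) * (d + pi * u))); first by rewrite ler_pM2l.
have e1 : expR (- eps) <= 1 by rewrite -expR0 ler_expR oppr_le0.
have h1 : 0 <= (d - A * u) * (1 - expR (- eps)) by rewrite mulr_ge0 ?subr_ge0.
have h2 : 0 <= u * ((A - pi) - expR (- eps) * (A + pi)) by rewrite mulr_ge0 ?subr_ge0// ltW.
by move: h1 h2; lra.
Qed.

Lemma sum_ltn_le n r : (\sum_(j < n) (j < r) <= r)%N.
Proof.
elim: n r => [|n IH] r; first by rewrite big_ord0.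
case: r => [|r]; first by rewrite big1.
by rewrite big_ord_recl /= add1n ltnS; exact: IH.
Qed.

(** A bad time other than the last [r] ones contributes at most [- r / 2] to
    the Birkhoff sum; since the sum is at least [- K n] there are at most
    [2 K n / r] of them. *)
Lemma bad_count n k r (K : R) : (0 < r)%N -> ln (A + pi) - r%:R * ln 2 <= - (r%:R / 2) ->
  - (K * n%:R) <= birkhoff n k c ->
  \sum_(j < n) (bad n k j)%:R <= r%:R + 2 * K * n%:R / r%:R.
Proof.
move=> r0 hr hS; have rR : 0 < r%:R :> R by rewrite ltr0n.
(* The last [r] times are all counted as bad. *)
have near : \sum_(j < n) ((n - j <= r)%N)%:R <= r%:R :> R.
  rewrite -natr_sum ler_nat (reindex_inj rev_ord_inj)/=.
  apply: leq_trans (sum_ltn_le n r); apply: leq_sum => j _.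
  by rewrite subKn.
have far : \sum_(j < n) (bad n k j && (r < n - j)%N)%:R <= 2 * K * n%:R / r%:R.
  rewrite ler_pdivlMr//.
  suff : birkhoff n k c <= - (\sum_(j < n) (bad n k j && (r < n - j)%N)%:R * (r%:R / 2)).
    by rewrite -mulr_suml; lra.
  rewrite /birkhoff -sumrN; apply: ler_sum => j _.
  case: (boolP (_ && _)) => [/andP[bj rj]|_]; last first.
    by rewrite mul0r oppr0 ln_le0// cell_dist_le1.
  rewrite mul1r.
  have p0 m : 0 < 2 ^+ m :> R by rewrite exprn_gt0.
  apply: le_trans hr; have Api0 : 0 < A + pi by apply: lt_le_trans A1.
  have -> : ln (A + pi) - r%:R * ln 2 = ln ((A + pi) / 2 ^+ r).
    by rewrite ln_div ?posrE// lnXn// mulr_natl.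
  rewrite ler_ln ?posrE ?cell_dist_gt0 ?divr_gt0//.
  have ur : 2 ^+ j / 2 ^+ n <= 1 / 2 ^+ r :> R.
    rewrite ler_pdivrMr// mulrAC mul1r ler_pdivlMr// -exprD ler_eXn2l ?ltr1n//.
    by move: rj; rewrite ltn_subRL; exact: ltnW.
  apply: (@le_trans _ _ ((A + pi) * (2 ^+ j / 2 ^+ n))).
    rewrite /cell_dist ge_min -[pi * _ / _]mulrA mulrDl lerD2r (ltW bj) orbT//.
  by rewrite ler_pM2l// (le_trans ur)// mul1r.
apply: le_trans (lerD near far); rewrite -big_split/=; apply: ler_sum => j _.
by rewrite -natrD ler_nat; case: (bad n k j); case: leqP.
Qed.

Lemma word_sum_lower n L x r (K : R) :
  (forall m, (m <= n)%N -> 1 / 2 ^+ L / 2 <= sg (x *+ 2 ^ n - c *+ 2 ^ m)) ->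
  (0 < r)%N -> ln (A + pi) - r%:R * ln 2 <= - (r%:R / 2) ->
  - (K * n%:R) <= birkhoff n (dig n x) c ->
  birkhoff n (dig n x) c - n%:R * eps - (r%:R + 2 * K * n%:R / r%:R) * bad_cost L <=
  \sum_(j < n) ln (sg (x *+ 2 ^ j - c)).
Proof.
move=> hm r0 hr hS.
apply: (@le_trans _ _ (\sum_(j < n) (ln (cell_dist n (dig n x) c j) - eps -
    (bad n (dig n x) j)%:R * bad_cost L))).
  rewrite !sumrB -mulr_suml sumr_const card_ord -[eps *+ n]mulr_natl lerB//.
  by rewrite ler_wpM2r ?bad_cost_ge0// bad_count.
by apply: ler_sum => j _; exact: word_time.
Qed.

Section Blocks.
Variables (del : R) (G : set (torus R)) (l : nat).
Hypothesis sp : spacer c del G.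
Hypothesis del0 : 0 < del.
Hypothesis del1 : del <= 1.
Hypothesis hl : pi / 2 ^+ l <= del / 2.

Lemma dig_base n k : (k < 2 ^ n)%N -> dig n (base R n k) = k.
Proof. by move=> kn; rewrite /base -[k%:R]addr0 dig_proj// lexx ltr01. Qed.

Lemma dig_prefix n y z : (l <= n)%N -> dig n y = dig n z -> dig l y = dig l z.
Proof.
move=> ln; rewrite -(subnKC ln) !digD => e.
by have [] := digits_inj (dig_lt _ _) (dig_lt _ _) e.
Qed.

Lemma spacer_perturb L (y y0 : torus R) i : dig L y = dig L y0 ->
  dig l (y *+ 2 ^ L) = dig l (y0 *+ 2 ^ L) ->
  sg (y *+ 2 ^ i - y0 *+ 2 ^ i) <= 2 ^+ i / 2 ^+ L * (del / 2).
Proof.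
move=> dy dz; have p0 m : 0 < 2 ^+ m :> R by rewrite exprn_gt0.
have h : sg (y - y0) <= del / 2 / 2 ^+ L.
  have -> : y - y0 = proj (frac y - frac y0) by rewrite projB !proj_frac.
  apply: (le_trans (sg_le _)).
  rewrite (lift_frac L y) (lift_frac L y0) dy -mulrBl opprD addrACA subrr add0r.
  rewrite normrM [`|_^-1|]gtr0_norm ?invr_gt0// mulrA ler_pM2r ?invr_gt0//.
  apply: le_trans hl; rewrite ler_pM2l ?pi_gt0//; apply: ltW; exact: dig_eq.
rewrite -mulrnBl; apply: (le_trans (sg_mulX _ _)).
by rewrite mulrAC -mulrA ler_pM2l// (le_trans h).
Qed.

(** The words are [k v], with [k] in [W] and [v] one spacer that lands on the
    cell of [k0].  As all words of [W] share their first [l] digits with [k0],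
    the same [v] serves before every one of them, up to a perturbation that
    leaves at least half of each distance.  Along [k] the loss is bounded by
    [word_sum_lower], along [v] the distance to [c] is at least [del / 2]. *)
Lemma block_lower_bound n q a r (K s t : R) (W : {set 'I_(2 ^ n)}) (k0 : 'I_(2 ^ n)) :
  let L := (2 * q)%N in
  0 <= t -> (n.+2 < 2 ^ q)%N -> (0 < n)%N -> (l <= n)%N -> (0 < r)%N ->
  ln (A + pi) - r%:R * ln 2 <= - (r%:R / 2) ->
  (2 ^ a <= #|W|)%N -> k0 \in W ->
  (forall k : 'I_(2 ^ n), k \in W -> [/\ G (base R n k), dig l (base R n k) = dig l (base R n k0),
     s <= birkhoff n k c & - (K * n%:R) <= birkhoff n k c]) ->
  (((a%:R * ln 2 + 2 * t * (s - n%:R * eps - (r%:R + 2 * K * n%:R / r%:R) * bad_cost L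
     + L%:R * ln (del / 2))) / (n + L)%:R)%:E <= pressure c t)%E.
Proof.
move=> L t0 nq n0 lln r0 hr aW k0W hW.
have p0 m : 0 < 2 ^+ m :> R by rewrite exprn_gt0.
have [Gz0 _ _ _] := hW _ k0W.
have [y0 [y0z y0v y0d y0c]] := spacer_word sp Gz0 nq; rewrite -/L in y0z y0v y0d y0c.
pose v := dig L y0.
pose Wb := [seq (k * 2 ^ L + v)%N | k : 'I_(2 ^ n) <- enum W].
have v_lt : (v < 2 ^ L)%N by exact: dig_lt.
have del2 : 0 < del / 2 by rewrite divr_gt0.
have key x : dig (n + L) x \in Wb -> dig (n + L) (x *+ 2 ^ (n + L)) \in Wb ->
  [/\ exists2 k : 'I_(2 ^ n), k \in W & dig n x = k,
   forall m, (m <= n)%N -> 1 / 2 ^+ L / 2 <= sg (x *+ 2 ^ n - c *+ 2 ^ m) &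
   forall i, (i < L)%N -> del / 2 <= sg (x *+ 2 ^ (n + i) - c)].
  move=> /mapP[k]; rewrite mem_enum digD => kW /(digits_inj (dig_lt _ _) v_lt)[xk xv].
  move=> /mapP[k']; rewrite mem_enum digD => k'W /(digits_inj (dig_lt _ _) v_lt)[xk' _].
  have zl : dig l (x *+ 2 ^ n *+ 2 ^ L) = dig l (y0 *+ 2 ^ L).
    rewrite y0z -mulrnA -expnD; have [_ <- _ _] := hW _ k'W.
    by apply: (dig_prefix lln); rewrite dig_base// ltn_ord.
  have pert i := spacer_perturb i xv zl.
  split; first by exists k.
    move=> m /y0c h; have := pert 0%N; rewrite expn0 !mulr1n expr0.
    have := sg_triangle (x *+ 2 ^ n) y0 (c *+ 2 ^ m); rewrite [sg (y0 - x *+ _)]sgBC.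
    have : 1 / 2 ^+ L * (del / 2) <= 1 / 2 ^+ L / 2 by rewrite ler_pM2l ?divr_gt0//; have := del1; lra.
    by move: h; lra.
  move=> i iL; rewrite expnD mulrnA; have h := y0d i iL; have := pert i.
  have : 2 ^+ i / 2 ^+ L * (del / 2) <= del / 2.
    by rewrite ler_piMl ?(ltW del2)// ler_pdivrMr// mul1r ler_eXn2l ?ltr1n// ltnW.
  have := sg_triangle (x *+ 2 ^ n *+ 2 ^ i) (y0 *+ 2 ^ i) c.
  rewrite [sg (y0 *+ 2 ^ i - x *+ 2 ^ n *+ 2 ^ i)]sgBC.
  by move: h; lra.
(* A common lower bound for the distances to [c] along the word and the spacer. *)
pose rho := 1 / 2 ^+ n * (1 / 2 ^+ L / 2) * (del / 2) : R.
have rho0 : 0 < rho by rewrite !mulr_gt0 ?invr_gt0.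
have rhod : rho <= del / 2.
  rewrite ler_piMl ?(ltW del2)//.
  have h1 m : 1 / 2 ^+ m <= 1 :> R by rewrite ler_pdivrMr// mul1r exprn_ege1// ler1n.
  have h0 m : 0 <= 1 / 2 ^+ m :> R by rewrite divr_ge0// ltW.
  have := h1 n; have := h1 L; have := h0 n; have := h0 L; nra.
apply: (block_pressure_seq (rho := rho) (W := Wb)) => //.
- by rewrite addn_gt0 n0.
- rewrite map_inj_in_uniq ?enum_uniq// => k k' _ _ e.
  by have [/val_inj] := digits_inj v_lt v_lt e.
- by rewrite size_map -cardE.
- move=> _ /mapP[k _ ->]; have := ltn_ord k; move: y0v; rewrite -/v expnD.
  by move=> vM kP; exact: concat_lt_pred.
move=> x h1 h2; have [[k kW xk] hm hs] := key x h1 h2.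
split.
  move=> i; have [iL|ni] := ltnP i n.
    move=> _; apply: le_trans (word_time_lower iL hm).
    apply: (@le_trans _ _ (1 / 2 ^+ n * (1 / 2 ^+ L / 2))).
      apply: ler_piMr; last by have := del1; lra.
      by apply: ltW; rewrite !mulr_gt0 ?invr_gt0.
    by rewrite ler_pM2r ?divr_gt0// ler_pM2r ?invr_gt0// exprn_ege1// ler1n.
  by rewrite -{1}(subnKC ni) ltn_add2l => /hs; rewrite subnKC//; exact: le_trans.
have [_ _ hs1 hs2] := hW _ kW.
rewrite big_split_ord /=; apply: lerD.
  have := @word_sum_lower n L x r K hm r0 hr; rewrite xk => /(_ hs2).
  by apply: le_trans; rewrite !lerD2r.
rewrite mulr_natl -[L in _ *+ L]card_ord -sumr_const; apply: ler_sum => i _.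
rewrite ler_ln ?posrE//; first exact: hs.
by apply: lt_le_trans (hs _ (ltn_ord i)).
Qed.

End Blocks.
End Concatenation.

(** * Choosing many words with nearly equal Birkhoff sums *)

Section Growth.
Variable R : realType.

(** The size [24] is where [2^(q - 1)] overtakes [16 q^4 + 2] for good. *)
Lemma exp2_quartic (q : nat) : (24 <= q)%N -> 16 * q%:R ^+ 4 + 2 <= 2 ^+ q.-1 :> R.
Proof.
move=> /subnK <-; move: (q - 24)%N => m; rewrite addnS /= -[(m + 23)%N.+1]addnS.
elim: m => [|m IH]; first lra.
rewrite !addSn [2 ^+ _.+1]exprS -[(m + 24).+1%:R]natr1; move: IH; set y : R := (m + 24)%:R; set z := 2 ^+ _ => IH.
have y24 : 24 <= y :> R by rewrite /y ler_nat leq_addl.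
have : (y + 1) ^+ 4 <= 2 * y ^+ 4.
  have h2 : 4 * y ^+ 3 + 6 * y ^+ 2 + 4 * y + 1 <= y ^+ 4.
    have y1 : 24 * y <= y ^+ 2 by nra.
    have y2 : 24 * y ^+ 2 <= y ^+ 3 by nra.
    have y3 : 24 * y ^+ 3 <= y ^+ 4 by nra.
    lra.
  by rewrite (_ : (y + 1) ^+ 4 = y ^+ 4 + (4 * y ^+ 3 + 6 * y ^+ 2 + 4 * y + 1)); [lra|ring].
lra.
Qed.

(** A spacer length [L = 2 q] that allows for [n + 2] forbidden points and is
    nevertheless at most [n^(1/4)]. *)
Lemma log_scale (X : R) : exists n0, forall n, (n0 <= n)%N ->
  exists q, [/\ (n.+2 < 2 ^ q)%N, X <= q%:R & 16 * q%:R ^+ 4 <= n%:R :> R].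
Proof.
pose x := maxn 24 (Num.truncn X).+1; exists (2 ^ x)%N => n xn.
exists (up_log 2 n.+3); set q := up_log 2 n.+3.
have /andP[q1 q2] : (2 ^ q.-1 < n.+3 <= 2 ^ q)%N by exact: up_log_bounds.
have xq : (x < q)%N.
  by rewrite -(ltn_exp2l _ _ (isT : 1 < 2)%N) (leq_ltn_trans xn)// (leq_trans _ q2)// ltnS -addn2 leq_addr.
split => //.
  apply: (@le_trans _ _ (Num.truncn X).+1%:R); first exact/ltW/truncnS_gt.
  by rewrite ler_nat (leq_trans _ (ltnW xq))// leq_maxr.
have := exp2_quartic (leq_trans (leq_maxl _ _) (ltnW xq)).
have : 2 ^+ q.-1 <= n%:R + 2 :> R by rewrite -natrX -natrD ler_nat addn2 -ltnS.
lra.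
Qed.

Lemma pigeonhole_sum (I C : finType) (P : pred I) (f : I -> R) (col : I -> C) (c0 : C) :
  exists e, \sum_(i | P i) f i <= #|C|%:R * \sum_(i | P i && (col i == e)) f i.
Proof.
pose g e := \sum_(i | P i && (col i == e)) f i.
pose e := [arg max_(e > c0) g e]%O; exists e; rewrite -/(g e).
rewrite (partition_big col xpredT)//= mulr_natl -sumr_const.
by apply: ler_sum => d _; rewrite /e; case: arg_maxP => // i _ /(_ d isT).
Qed.

(** [2 = (4/3) (3/2)] and [ln (1 / x) >= 1 - x].  The point is that the value
    exceeds [1/2]. *)
Lemma ln2_ge : 7 / 12 <= ln 2 :> R.
Proof.
have l (x : R) : 0 < x -> 1 - x <= ln x^-1.
  move=> x0; rewrite lnV ?posrE//.
  by have := @le_ln1Dx R (x - 1); rewrite (_ : 1 + (x - 1) = x); [lra|ring].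
have -> : 2 = (3/4)^-1 * (2/3)^-1 :> R by field.
rewrite lnM ?posrE ?invr_gt0//; have := l (3/4); have := l (2/3); lra.
Qed.

Lemma ln2_le1 : ln 2 <= 1 :> R.
Proof. by have := @le_ln1Dx R 1; rewrite -[1 + 1]/(2 : R); apply; lra. Qed.

Lemma ln_sub_ge (u : R) : 0 <= u -> u <= 1 / 2 -> - (2 * u) <= ln (1 - u).
Proof.
move=> u0 uh; have u1 : 0 < 1 - u by lra.
have h : ln ((1 - u)^-1) <= 2 * u.
  have := @le_ln1Dx R ((1 - u)^-1 - 1); rewrite [1 + (_ - 1)]addrC subrK => h.
  apply: le_trans (h _) _.
    by rewrite -subr_gt0 opprK subrK invr_gt0.
  rewrite lerBlDr -[_^-1]mul1r ler_pdivrMr//; nra.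
by move: h; rewrite lnV ?posrE//; lra.
Qed.

End Growth.

Section GoodWords.
Variable R : realType.
Variables (c : torus R) (t : R) (G : set (torus R)) (b : R).
Hypothesis t0 : 0 < t.

Definition partition_sum_on n : R := \sum_(k < 2 ^ n | `[< G (base R n k) >]) weight n c t k.

(** Words with [birkhoff < - K n] are negligible: there are at most [2^n] of
    them and their weights are tiny.  The others are split according to
    the value of [birkhoff] up to [eps n] and to their first [l] digits.  The
    number of classes does not depend on [n], and the heaviest class carries
    the growth. *)
Lemma good_words (K eps : R) (l n : nat) : 0 < K -> 0 < eps -> (0 < n)%N ->
  `|ln 2 - b| + 1 <= 2 * t * K ->
  expR (n%:R * b) <= partition_sum_on n ->
  exists (a : nat) (W : {set 'I_(2 ^ n)}) (k0 : 'I_(2 ^ n)) (s : R),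
  [/\ (2 ^ a <= #|W|)%N, k0 \in W,
   (forall k : 'I_(2 ^ n), k \in W -> [/\ G (base R n k), dig l (base R n k) = dig l (base R n k0),
     s <= birkhoff n k c & - (K * n%:R) <= birkhoff n k c]) &
   n%:R * b - ln (4 * ((Num.truncn (K / eps)).+1 * 2 ^ l)%:R) - 2 * t * eps * n%:R
     <= a%:R * ln 2 + 2 * t * s].
Proof.
move=> K0 e0 n0 hK hZ; have nR : 0 < n%:R :> R by rewrite ltr0n.
have n1 : 1 <= n%:R :> R by rewrite ler1n.
set J := Num.truncn (K / eps); set C := ((J.+1 * 2 ^ l)%:R : R).
pose good (k : 'I_(2 ^ n)) := `[< G (base R n k) >] && (- (K * n%:R) <= birkhoff n k c).
have half_mass : expR (n%:R * b) / 2 <= \sum_(k | good k) weight n c t k.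
  have rest : \sum_(k < 2 ^ n | `[< G (base R n k) >] && ~~ (- (K * n%:R) <= birkhoff n k c)) weight n c t k
      <= expR (n%:R * b) / 2.
    apply: (@le_trans _ _ (\sum_(k < 2 ^ n) expR (- (2 * t * K * n%:R)))).
      rewrite big_mkcond; apply: ler_sum => k _; case: ifP => [/andP[_]|_]; last exact: expR_ge0.
      by rewrite -ltNge => /ltW h; rewrite /weight ler_expR -!mulrA -mulrN -mulrN ler_pM2l// ler_pM2l.
    rewrite sumr_const card_ord -[_ *+ _]mulr_natr natrX.
    have -> : 2 ^+ n = expR (n%:R * ln 2) :> R by rewrite expRM_natl lnK ?posrE.
    rewrite -expRD.
    have h1 : 2 <= expR n%:R :> R by have := @expR_ge1Dx R n%:R; lra.
    apply: (@le_trans _ _ (expR (n%:R * b - n%:R))).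
      rewrite ler_expR; have := ler_norm (ln 2 - b); nra.
    by rewrite expRD expRN ler_pM2l ?expR_gt0// lef_pV2 ?posrE// expR_gt0.
  move: hZ; rewrite /partition_sum_on (bigID (fun k : 'I_(2 ^ n) => - (K * n%:R) <= birkhoff n k c))/=.
  by move: rest; rewrite /good; lra.
pose col (k : 'I_(2 ^ n)) : 'I_J.+1 * 'I_(2 ^ l) :=
  (inord (Num.truncn (- birkhoff n k c / (eps * n%:R))), Ordinal (dig_lt l (base R n k))).
have p2 : (0 < 2 ^ l)%N by rewrite expn_gt0.
have [[i d] he] := pigeonhole_sum good (fun k => weight n c t k) col (ord0, Ordinal p2).
rewrite card_prod !card_ord -/C in he.
have C0 : 0 < C by rewrite ltr0n muln_gt0 p2.
pose W : {set 'I_(2 ^ n)} := [set k | good k && (col k == (i, d))]%SET.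
have hW (k : 'I_(2 ^ n)) : k \in W -> [/\ G (base R n k), - (K * n%:R) <= birkhoff n k c,
   i%:R * (eps * n%:R) <= - birkhoff n k c < i.+1%:R * (eps * n%:R) & dig l (base R n k) = d].
  rewrite inE => /andP[/andP[/asboolP Gk Kk] /eqP[ei ed]]; split => //; last by rewrite -ed.
  have en : 0 < eps * n%:R by rewrite mulr_gt0.
  have q0 : 0 <= - birkhoff n k c / (eps * n%:R) by rewrite divr_ge0 ?(ltW en)// oppr_ge0 birkhoff_le0.
  have := truncn_itv q0; rewrite ler_pdivlMr// ltr_pdivrMr//.
  suff -> : Num.truncn (- birkhoff n k c / (eps * n%:R)) = i by [].
  rewrite -ei inordK// ltnS; apply: le_truncn.
  by rewrite ler_pdivrMr// mulrA divfK ?gt_eqF// lerNl.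
have mass : expR (n%:R * b) / 2 <= C * (#|W|%:R * expR (- (2 * t * (i%:R * (eps * n%:R))))).
  apply: (le_trans half_mass); apply: (le_trans he); rewrite ler_pM2l//.
  rewrite mulr_natl -sumr_const.
  rewrite (eq_bigl (mem W)); last by move=> k; rewrite /= inE.
  apply: ler_sum => k /hW[_ _ /andP[h _] _].
  by rewrite /weight ler_expR -mulrN ler_pM2l ?mulr_gt0// lerNr.
have W0 : (0 < #|W|)%N.
  rewrite lt0n; apply/eqP => w0; move: mass; rewrite w0 mul0r mulr0.
  by have := expR_gt0 (n%:R * b); lra.
have [k0 k0W] : exists k0, k0 \in W by apply/card_gt0P.
exists (trunc_log 2 #|W|), W, k0, (- (i.+1%:R * (eps * n%:R))).
have /andP[a1 a2] := trunc_log_bounds (isT : 1 < 2)%N W0.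
split => //.
  move=> k kW; have [h1 h2 /andP[_ h3] h4] := hW k kW; have [_ _ _ h5] := hW _ k0W.
  by rewrite h4 h5; split => //; rewrite lerNl ltW.
have W0R : 0 < #|W|%:R :> R by rewrite ltr0n.
move: mass; rewrite -ler_ln ?posrE ?divr_gt0 ?mulr_gt0 ?expR_gt0//.
rewrite ln_div ?posrE ?expR_gt0// expRK !lnM ?posrE ?mulr_gt0 ?expR_gt0// expRK.
have : ln #|W|%:R <= (trunc_log 2 #|W|).+1%:R * ln 2 :> R.
  rewrite mulr_natl -lnXn// ler_ln ?posrE ?exprn_gt0// -natrX ler_nat ltnW//.
have -> : ln 4 = 2 * ln 2 :> R by rewrite (_ : 4 = 2 ^+ 2)// ?lnXn// ?mulr_natl//; rewrite -natrX.
rewrite -[i.+1%:R]natr1 -[(trunc_log _ _).+1%:R]natr1 -/C.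
set x := ln C; set y := ln 2; set z := (trunc_log _ _)%:R; set u := i%:R; nra.
Qed.

End GoodWords.

(** * Growth of the partition sums bounds the pressure from below *)

Section PressureLower.
Variable R : realType.
Implicit Types (c : torus R) (t b : R).

(** The ratio of [A - pi] to [A + pi] tends to [1], and [1 + eps <= exp eps]
    makes [A] explicit. *)
Lemma contraction_width (eps : R) : 0 < eps ->
  exists2 A : R, pi < A & expR (- eps) * (A + pi) <= A - pi.
Proof.
move=> e0; have p0 := @pi_gt0 R; have ee := expR_gt0 (- eps).
have h : expR (- eps) * (1 + eps) <= 1.
  by rewrite expRN ler_pdivrMl ?expR_gt0// mulr1 expR_ge1Dx.
exists (pi + 2 * pi / eps); first by rewrite ltrDl !mulr_gt0// invr_gt0.
have -> : pi + 2 * pi / eps - pi = 2 * pi / eps by rewrite addrC addKr.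
have -> : pi + 2 * pi / eps + pi = (1 + eps) * (2 * pi / eps).
  by field; rewrite gt_eqF.
by rewrite mulrA ler_piMl// !mulr_ge0 ?invr_ge0// ?ltW.
Qed.

(** With spacers of length [L] and the last [L^2] times of each word given up,
    the total loss is [O(L^3 + n / L)], which is at most [eta n / 2] as soon as
    [L] is large and [L^4 <= n]. *)
Lemma error_budget (b t K lnC lnd lnA eta L n D s a eps : R) :
  let E1 := lnC + 2 * t * (lnA + 2) + 2 * t * lnd + `|b| in
  let E2 := 4 * t * K * (lnA + 2) in
  0 < t -> 0 < K -> 0 <= lnC -> 0 <= lnd -> 0 <= lnA -> 0 < eta ->
  2 <= L -> 4 * E1 <= L * eta -> 4 * E2 <= L * eta -> L ^+ 4 <= n ->
  D <= (lnA + 2) * L -> t * eps * 8 = eta ->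
  n * b - lnC - 2 * t * eps * n <= a + 2 * t * s ->
  (b - eta) * (n + L) <=
  a + 2 * t * (s - n * eps - (L ^+ 2 + 2 * K * n / L ^+ 2) * D - L * lnd).
Proof.
move=> E1 E2 t0 K0 lnC0 lnd0 lnA0 eta0 L2 LX1 LX2 L4 D1 epsE hs.
have L0 : 0 < L by lra.
have n0 : 0 < n by apply: lt_le_trans L4; rewrite exprn_gt0.
have cost : (L ^+ 2 + 2 * K * n / L ^+ 2) * D <= (lnA + 2) * (L ^+ 3 + 2 * K * (n / L)).
  have -> : (lnA + 2) * (L ^+ 3 + 2 * K * (n / L)) =
    (L ^+ 2 + 2 * K * n / L ^+ 2) * ((lnA + 2) * L) by field; rewrite gt_eqF.
  by rewrite ler_wpM2l// addr_ge0 ?exprn_ge0 ?(ltW L0)// divr_ge0 ?mulr_ge0 ?exprn_ge0// ltW.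
have c1 : E1 * L ^+ 3 <= eta / 4 * n.
  have h1 : 4 * E1 * L ^+ 3 <= L * eta * L ^+ 3 by rewrite ler_pM2r ?exprn_gt0.
  have h2 : L ^+ 4 * eta <= n * eta by rewrite ler_pM2r.
  have h3 : L * eta * L ^+ 3 = L ^+ 4 * eta by ring.
  by move: h1 h2 h3; clear; lra.
have c2 : E2 * (n / L) <= eta / 4 * n.
  have h1 : 0 <= (L * eta - 4 * E2) * (n / L).
    by rewrite mulr_ge0 ?subr_ge0// divr_ge0// ltW.
  have h3 : (L * eta - 4 * E2) * (n / L) = eta * n - 4 * (E2 * (n / L)).
    by field; rewrite gt_eqF.
  by move: h1 h3; clear; lra.
have sq : L <= L ^+ 2 by nra.
have L13 : L <= L ^+ 3 by nra.
have L03 : 1 <= L ^+ 3 by lra.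
have e1 : lnC + `|b| * L + 2 * t * lnd * L + 2 * t * ((lnA + 2) * L ^+ 3) <= E1 * L ^+ 3.
  have g1 : 0 <= lnC * (L ^+ 3 - 1) by rewrite mulr_ge0// subr_ge0.
  have g2 : 0 <= `|b| * (L ^+ 3 - L) by rewrite mulr_ge0// subr_ge0.
  have g3 : 0 <= t * lnd * (L ^+ 3 - L) by rewrite !mulr_ge0 ?subr_ge0// ltW.
  by rewrite /E1; clear -g1 g2 g3; lra.
have cost' : 2 * t * ((L ^+ 2 + 2 * K * n / L ^+ 2) * D) <=
  2 * t * ((lnA + 2) * L ^+ 3) + E2 * (n / L).
  have -> : 2 * t * ((lnA + 2) * L ^+ 3) + E2 * (n / L) =
    2 * t * ((lnA + 2) * (L ^+ 3 + 2 * K * (n / L))) by rewrite /E2; field; rewrite gt_eqF.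
  by rewrite ler_pM2l// mulr_gt0.
have bL : b * L <= `|b| * L by rewrite ler_pM2r// ler_norm.
have eL : 0 <= eta * L by rewrite mulr_ge0// ltW.
have epsn : 2 * t * eps * n = eta / 4 * n by rewrite -epsE; field.
move: hs cost' e1 c1 c2; rewrite epsn.
clear LX1 LX2 cost; clearbody E1 E2.
set Q := (_ + _ / _) * D; move: Q (L ^+ 3) (n / L) => Q L3 M.
have -> : 2 * t * (s - n * eps - Q - L * lnd) =
   2 * t * s - eta / 4 * n - 2 * t * Q - 2 * t * lnd * L by rewrite -epsn; ring.
by clear -bL eL; move=> *; lra.
Qed.

(** The constants are chosen in the order [eps], [A], [l], [K], then [n], which
    fixes [L] through [log_scale]. *)
Lemma pressure_ge_growth c t (del : R) (G : set (torus R)) b : 0 < t ->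
  spacer c del G -> 0 < del -> del <= 1 ->
  (forall n0, exists n, (n0 <= n)%N /\ expR (n%:R * b) <= partition_sum_on c t G n) ->
  forall eta : R, 0 < eta -> ((b - eta)%:E <= pressure c t)%E.
Proof.
move=> t0 sp del0 del1 hZ eta eta0.
pose eps := eta / (8 * t); have eps0 : 0 < eps by rewrite divr_gt0// mulr_gt0.
have [A Api hA] := contraction_width eps0.
have [l hl] : exists l, pi / 2 ^+ l <= del / 2.
  have [l hl] := @exp2_arch R (2 * pi / del); exists l.
  rewrite ler_pdivrMr ?exprn_gt0// -ler_pdivrMl ?divr_gt0//.
  by rewrite invf_div mulrAC; exact: ltW.
have t2 : 0 < 2 * t by rewrite mulr_gt0.
have [K [K0 hK]] : exists K, 0 < K /\ `|ln 2 - b| + 1 <= 2 * t * K.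
  exists ((`|ln 2 - b| + 1) / (2 * t)).
  by rewrite divr_gt0 ?ltr_wpDl// mulrCA divff ?mulr1 ?gt_eqF.
pose lnC := ln (4 * ((Num.truncn (K / eps)).+1 * 2 ^ l)%:R) : R.
pose lnd := - ln (del / 2).
have lnC0 : 0 <= lnC.
  apply: ln_ge0; have : 1 <= ((Num.truncn (K / eps)).+1 * 2 ^ l)%:R :> R.
    by rewrite ler1n muln_gt0 expn_gt0.
  lra.
have lnd0 : 0 <= lnd by rewrite oppr_ge0 ln_le0//; lra.
have A1 : 1 <= A + pi by have := @pi_ge2 R; lra.
pose lnA := ln (A + pi); have lnA0 : 0 <= lnA by exact: ln_ge0.
pose E1 := lnC + 2 * t * (lnA + 2) + 2 * t * lnd + `|b|.
pose E2 := 4 * t * K * (lnA + 2).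
have [n0 hn0] := log_scale (4 * (E1 / eta) + 4 * (E2 / eta) + 12 * lnA + 1).
have [n [nn0 hZn]] := hZ (maxn (maxn n0 l) 1).
have [|q [nq Xq q4]] := hn0 n; first by apply: leq_trans nn0; rewrite -maxnA leq_maxl.
have ln_ : (l <= n)%N by apply: leq_trans nn0; rewrite maxnAC leq_maxr.
have n1 : (0 < n)%N by apply: leq_trans nn0; rewrite leq_maxr.
have [a [W [k0 [s [aW k0W hW hs]]]]] := good_words t0 l K0 eps0 n1 hK hZn.
have E10 : 0 <= E1 by rewrite !addr_ge0// !mulr_ge0 ?addr_ge0// ?ltW.
have E20 : 0 <= E2 by rewrite !mulr_ge0 ?addr_ge0// ?ltW.
pose L := (2 * q)%N; pose Lr : R := L%:R.
have F1 : 0 <= E1 / eta by rewrite divr_ge0// ltW.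
have F2 : 0 <= E2 / eta by rewrite divr_ge0// ltW.
have [q1 q2 q3 q5] : [/\ 1 <= q%:R :> R, 4 * (E1 / eta) <= q%:R,
    4 * (E2 / eta) <= q%:R & 12 * lnA <= q%:R].
  have dom (x y z w : R) : 0 <= x -> 0 <= y -> 0 <= z ->
      4 * x + 4 * y + 12 * z + 1 <= w -> [/\ 1 <= w, 4 * x <= w, 4 * y <= w & 12 * z <= w].
    by clear; move=> *; split; lra.
  exact: dom.
have q0 : (0 < q)%N by rewrite -(ler_nat R).
have LE : Lr = 2 * q%:R by rewrite /Lr /L natrM.
have L2 : 2 <= Lr by rewrite LE; move: q1; clear; lra.
have LX1 : 4 * E1 <= Lr * eta.
  by rewrite -ler_pdivrMr// -mulrA LE (le_trans q2)//; move: q1; clear; lra.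
have LX2 : 4 * E2 <= Lr * eta.
  by rewrite -ler_pdivrMr// -mulrA LE (le_trans q3)//; move: q1; clear; lra.
have LX3 : 12 * lnA <= Lr by rewrite LE (le_trans q5)//; move: q1; clear; lra.
have L4 : Lr ^+ 4 <= n%:R by rewrite LE exprMn (_ : 2 ^+ 4 = 16)// -natrX.
have r0 : (0 < L ^ 2)%N by rewrite expn_gt0 muln_gt0 q0.
have rE : (L ^ 2)%:R = Lr ^+ 2 by rewrite natrX.
have hr : ln (A + pi) - (L ^ 2)%:R * ln 2 <= - ((L ^ 2)%:R / 2).
  have := @ln2_ge R; rewrite rE -/lnA; set y := ln 2 => hy.
  have : Lr <= Lr ^+ 2 by nra.
  have : 0 <= Lr ^+ 2 * (y - 7/12) by rewrite mulr_ge0 ?exprn_ge0 ?subr_ge0//; lra.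
  lra.
apply: le_trans (block_lower_bound Api (ltW eps0) hA sp del0 del1 hl (ltW t0) nq n1 ln_ r0 hr aW k0W hW).
rewrite lee_fin ler_pdivlMr ?ltr0n ?addn_gt0 ?n1// -/L -/lnd.
have D1 : bad_cost A L <= (lnA + 2) * Lr.
  have := @ln2_le1 R; have := @ln2_ge R; rewrite /bad_cost -/lnA -natr1 -/Lr.
  by set y := ln 2 => h1 h2; nra.
have -> : ln (del / 2) = - lnd by rewrite opprK.
rewrite natrD rE mulrN -/Lr.
apply: (@error_budget b t K lnC lnd lnA) => //.
by rewrite /eps; field; rewrite gt_eqF.
Qed.

End PressureLower.

(** * The pressure as an infimum of partition sums *)

Section Approximation.
Variable R : realType.
Implicit Types (c : torus R) (t b : R) (n : nat).

(** The Dirac mass at the fixed point [0] has entropy [0], and it gives [psi] the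
    integral [2 ln 1 = 0] when [c = 1/2].  The single word [00...0] captures it
    up to an error that tends to [0] with its length. *)
Lemma pressure_half_ge0 t : 0 <= t -> (0 <= pressure (half R) t)%E.
Proof.
move=> t0; apply/lee_subgt0Pr => e e0; rewrite sub0e -EFinN.
have p0 := @pi_gt0 R.
have [N0 hN0'] := @exp2_arch R (4 * t * pi / e + pi); set N := (N0 + 3)%N.
have N1 : (0 < N)%N by rewrite addn_gt0 orbT.
have P0 : 0 < 2 ^+ N0 :> R by rewrite exprn_gt0.
have PN : 2 ^+ N = 2 ^+ N0 * 8 :> R by rewrite exprD; congr (_ * _); rewrite -natrX.
have te0 : 0 <= 4 * t * pi / e by rewrite !mulr_ge0// ?invr_ge0// ltW.
have P1 : pi <= 2 ^+ N0 :> R by apply: le_trans (ltW hN0'); rewrite lerDr.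
have hN0 : 4 * t * pi / e < 2 ^+ N0 by apply: le_lt_trans hN0'; rewrite lerDl ltW.
pose u : R := pi / 2 ^+ N.
have u0 : 0 < u by rewrite divr_gt0// exprn_gt0.
have uh : u <= 1 / 2.
  by rewrite ler_pdivrMr ?exprn_gt0// PN; move: P1 P0; clear; lra.
have near x (i : nat) : dig N x \in [:: 0%N] -> dig N (x *+ 2 ^ N) \in [:: 0%N] -> (i < N)%N ->
    1 - u <= sg (x *+ 2 ^ i - half R).
  rewrite !inE => /eqP d1 /eqP d2 iN.
  have d0 : dig (N + N) x = 0%N by rewrite digD d1 d2.
  have := sg_base_mul (N + N) i x; rewrite d0 /base mul0r proj0 mul0rn subr0 => h.
  have : sg (x *+ 2 ^ i) <= u.
    apply: (le_trans h); rewrite /u -mulrA ler_pM2l// ler_pdivrMr ?exprn_gt0//.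
    by rewrite exprD mulrA mulVf ?expf_neq0// mul1r ler_eXn2l ?ltr1n// ltnW.
  have := sg_triangle (x *+ 2 ^ i) 0 (half R); rewrite !sub0r !sgN sg_half; lra.
have := @block_pressure_seq R (half R) t (1 - u) (N%:R * ln (1 - u)) 0 N [:: 0%N] t0.
move=> /(_ _ N1 isT isT) H.
have {}H : (((0%:R * ln 2 + 2 * t * (N%:R * ln (1 - u))) / N%:R)%:E <= pressure (half R) t)%E.
  apply: H; first lra.
    by move=> k; rewrite inE => /eqP ->; rewrite -ltnS prednK ?expn_gt0// -[1%N]/(2 ^ 0)%N ltn_exp2l.
  move=> x h1 h2; split; first by move=> i; exact: near.
  rewrite mulr_natl -[N in _ *+ N]card_ord -sumr_const; apply: ler_sum => i _.
  have hi := near x i h1 h2 (ltn_ord i).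
  by rewrite ler_ln ?posrE//; lra.
apply: le_trans H; rewrite lee_fin mul0r add0r.
have -> : 2 * t * (N%:R * ln (1 - u)) / N%:R = 2 * t * ln (1 - u).
  by field; rewrite pnatr_eq0 -lt0n.
have lu := ln_sub_ge (ltW u0) uh.
apply: (@le_trans _ _ (2 * t * - (2 * u))); last by rewrite ler_wpM2l// mulr_ge0.
rewrite mulrN lerN2 /u PN.
move: hN0; rewrite ltr_pdivrMr// => hN0.
have -> : 2 * t * (2 * (pi / (2 ^+ N0 * 8))) = (4 * t * pi / 2 ^+ N0) / 8.
  by field; rewrite gt_eqF.
rewrite ler_pdivrMr// ler_pdivrMr//; nra.
Qed.

(** Dropping the first digit drops the first term of the Birkhoff sum, which
    is not positive. *)
Lemma weight_half_succ t n (k : nat) : 0 <= t ->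
  weight n.+1 (half R) t k <= weight n (half R) t (k %% 2 ^ n)%N.
Proof.
move=> t0; rewrite /weight ler_expR ler_wpM2l ?mulr_ge0// /birkhoff big_ord_recl.
rewrite ler_wnDl ?ln_le0 ?cell_dist_le1//; apply: ler_sum => j _.
suff -> : cell_dist n.+1 k (half R) (lift ord0 j) = cell_dist n (k %% 2 ^ n)%N (half R) j by [].
have p0 m : 2 ^+ m != 0 :> R by rewrite expf_neq0.
rewrite /cell_dist lift0 !exprS; congr (Num.min 1 (sg (_ - _) + _)); last by field; rewrite !p0.
rewrite expnS mulrnA /base; congr (_ *+ _); rewrite -projMn.
rewrite {1}(divn_eq k (2 ^ n)) natrD natrM natrX exprS.
have -> : ((k %/ 2 ^ n)%:R * 2 ^+ n + (k %% 2 ^ n)%:R) / (2 * 2 ^+ n) *+ 2 =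
  (k %/ 2 ^ n)%:R + (k %% 2 ^ n)%:R / 2 ^+ n :> R.
  by rewrite -mulr_natr; field.
by rewrite projD proj_nat add0r.
Qed.

(** Among the two words that become equal when the first digit is dropped, at
    most one starts near [0]. *)
Lemma partition_sum_half_succ t n : 0 <= t ->
  partition_sum n.+1 (half R) t <= partition_sum_on (half R) t [set z | 1 <= 2 * sg z] n.+1 + partition_sum n (half R) t.
Proof.
move=> t0; rewrite /partition_sum /partition_sum_on; set G := (fun z : torus R => _).
rewrite (bigID (fun k : 'I_(2 ^ n.+1) => `[< G (base R n.+1 k) >]))/= lerD2l big_mkcond/=.
pose F (k : nat) := if ~~ `[< G (base R n.+1 k) >] then weight n.+1 (half R) t k else 0.
rewrite -(big_mkord xpredT F) expnS mul2n -addnn.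
rewrite (big_cat_nat (n := 2 ^ n))//= ?leq_addr// -{2}[(2 ^ n)%N]add0n big_addn addnK !big_mkord -big_split/=.
apply: ler_sum => e _.
have w0 : 0 <= weight n (half R) t e by exact/ltW/weight_gt0.
have h1 : F e <= weight n (half R) t e.
  by rewrite /F; case: ifP => // _; rewrite (le_trans (weight_half_succ _ _ _))// modn_small.
have h2 : F (e + 2 ^ n)%N <= weight n (half R) t e.
  by rewrite /F; case: ifP => // _; rewrite (le_trans (weight_half_succ _ _ _))// modnDr modn_small.
have F0 k : `[< G (base R n.+1 k) >] -> F k = 0 by rewrite /F => ->.
have half_shift : base R n.+1 (e + 2 ^ n) = base R n.+1 e + half R.
  by rewrite /base natrD natrX mulrDl projD; congr (_ + proj _); rewrite exprS; field; rewrite expf_neq0.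
have [Ge|Ge] := two_halves (base R n.+1 e).
  by rewrite F0 ?add0r//; apply/asboolP.
by rewrite addrC F0 ?add0r//; apply/asboolP; rewrite half_shift.
Qed.

(** Otherwise the recursion bounds the partition sums by [O(n exp (n b'))],
    which is smaller than [exp (n b)] for large [n]. *)
Lemma partition_sum_half_frequent t b b' n0 : 0 <= t -> 0 < b' -> b' < b ->
  (forall n, (0 < n)%N -> expR (n%:R * b) <= partition_sum n (half R) t) ->
  exists n, (n0 <= n)%N /\ expR (n%:R * b') <= partition_sum_on (half R) t [set z | 1 <= 2 * sg z] n.
Proof.
move=> t0 b0 bb hZ; apply: contrapT => H.
have step n : (n0 <= n)%N -> partition_sum n (half R) t <= partition_sum n0 (half R) t + n%:R * expR (n%:R * b').
  move=> /subnK <-; elim: (n - n0)%N => [|m IH].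
    by rewrite add0n lerDl mulr_ge0// expR_ge0.
  rewrite addSn; move: IH (leq_addl m n0); move: (m + n0)%N => k IH nk.
  apply: (le_trans (partition_sum_half_succ _ t0)).
  have small : partition_sum_on (half R) t [set z | 1 <= 2 * sg z] k.+1 <= expR (k.+1%:R * b').
    by rewrite leNgt; apply/negP => h; apply: H; exists k.+1; split; [exact: leqW|exact: ltW].
  have mono : k%:R * expR (k%:R * b') <= k%:R * expR (k.+1%:R * b').
    by rewrite ler_wpM2l// ler_expR ler_pM2r// ler_nat.
  have -> : k.+1%:R * expR (k.+1%:R * b') = k%:R * expR (k.+1%:R * b') + expR (k.+1%:R * b').
    by rewrite -[X in _ + X]mul1r -mulrDl natr1.
  by rewrite addrC addrA lerD// (le_trans IH)// lerD2l.
pose d := b - b'; have d0 : 0 < d by rewrite subr_gt0.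
pose z0 := partition_sum n0 (half R) t.
(* Large enough for [exp (n d) >= (1 + n d / 2)^2] to exceed [z0 + n]. *)
pose n := maxn (maxn n0 (Num.truncn z0).+1) (Num.truncn (8 / d ^+ 2)).+1.
have nn0 : (n0 <= n)%N by rewrite /n -maxnA leq_maxl.
have n1 : (0 < n)%N by rewrite /n leq_max orbT.
have nz : z0 <= n%:R.
  apply: (@le_trans _ _ (Num.truncn z0).+1%:R); first exact/ltW/truncnS_gt.
  by rewrite ler_nat /n maxnAC leq_maxr.
have nd : 8 / d ^+ 2 <= n%:R.
  apply: (@le_trans _ _ (Num.truncn (8 / d ^+ 2)).+1%:R); first exact/ltW/truncnS_gt.
  by rewrite ler_nat /n leq_maxr.
have := le_trans (hZ n n1) (step n nn0); rewrite -/z0.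
have -> : n%:R * b = n%:R * b' + n%:R * d by rewrite -mulrDr addrC subrK.
rewrite expRD; have e1 : 1 <= expR (n%:R * b') by rewrite -expR0 ler_expR mulr_ge0// ltW.
have e2 : (1 + n%:R * d / 2) ^+ 2 <= expR (n%:R * d).
  rewrite {2}(splitr (n%:R * d)) expRD -expr2 ler_sqr ?nnegrE ?expR_ge0 ?expR_ge1Dx//.
  by rewrite addr_ge0// divr_ge0// mulr_ge0// ltW.
have n2 : 8 * n%:R <= (n%:R * d) ^+ 2.
  move: nd; rewrite ler_pdivrMr ?exprn_gt0// => nd.
  by rewrite exprMn [n%:R ^+ 2]expr2 -mulrA [8 * _]mulrC ler_wpM2l.
have n3 : 0 <= n%:R * d by rewrite mulr_ge0// ltW.
have key (u v w x z : R) : 1 <= u -> (1 + w / 2) ^+ 2 <= v -> 8 * x <= w ^+ 2 -> 0 <= w ->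
    z <= x -> u * v <= z + x * u -> False.
  clear => u1 vw xw w0 zx uv.
  have v2 : 1 + 2 * x <= v by apply: le_trans vw; rewrite sqrrD; lra.
  have h1 : 0 <= (u - 1) * (v - (1 + 2 * x)) by rewrite mulr_ge0 ?subr_ge0.
  have x0 : 0 <= x * (u - 1) by rewrite mulr_ge0 ?subr_ge0//; have := sqr_ge0 w; nra.
  nra.
exact: (key _ _ _ _ _ e1 e2 n2 n3 nz).
Qed.

(** For [c = 1/2] and [b <= 0] the growth of the words starting far from [0]
    may be smaller than that of the partition sums, but then
    [pressure_half_ge0] suffices. *)
Lemma pressure_approx c t b : 0 <= t -> (pressure c t < b%:E)%E ->
  exists2 n, (0 < n)%N & ln (partition_sum n c t) / n%:R < b.
Proof.
move=> t0 pb; apply: contrapT => H.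
have hZ n : (0 < n)%N -> expR (n%:R * b) <= partition_sum n c t.
  move=> n0; rewrite -[X in _ <= X]lnK ?posrE ?partition_sum_gt0// ler_expR mulrC -ler_pdivlMr ?ltr0n//.
  by rewrite leNgt; apply/negP => h; apply: H; exists n.
suff : (b%:E <= pressure c t)%E by rewrite leNgt pb.
move: t0; rewrite le_eqVlt => /orP[/eqP t0|t0].
  apply: le_trans (_ : ((ln 2)%:E <= _)%E); last by rewrite -t0; exact: pressure0_ge.
  rewrite lee_fin -ler_expR lnK ?posrE// -[b]mul1r.
  apply: (le_trans (hZ 1%N isT)); rewrite -[X in _ <= X]expr1; apply: partition_sum_le; by rewrite t0.
have [ch|ch] := eqVneq c (half R); last first.
  have dist : 0 < sg (c - half R) by rewrite sg_gt0// subr_eq0.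
  apply/lee_subgt0Pr => e e0; rewrite -EFinB.
  apply: (pressure_ge_growth t0 (spacer_generic ch)) => //; rewrite ?divr_gt0//.
    by have := sg_le1 (c - half R); lra.
  move=> n0; exists n0.+1; split => //; apply: (le_trans (hZ n0.+1 isT)).
  rewrite /partition_sum_on /partition_sum le_eqVlt; apply/orP; left; apply/eqP; apply: eq_bigl => k.
  by apply/esym/asboolP.
subst c; have [b0|b0] := leP b 0.
  by apply: le_trans (pressure_half_ge0 (ltW t0)); rewrite lee_fin.
apply/lee_subgt0Pr => e e0; rewrite -EFinB.
(* The rate [b'] must be positive for the recursion, and close to [b]. *)
pose b' := Num.max (b - e / 2) (b / 2).
have b'0 : 0 < b' by rewrite lt_max divr_gt0 ?orbT.
have b'b : b' < b by rewrite gt_max; apply/andP; split; lra.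
have b'e : b - e <= b' - e / 2 by rewrite lerBrDr le_max; apply/orP; left; lra.
apply: (@le_trans _ _ (b' - e / 2)%:E); first by rewrite lee_fin.
have [s0 s1] : 0 < 1 / 8 :> R /\ 1 / 8 <= 1 :> R by split; lra.
apply: (pressure_ge_growth t0 (@spacer_half R) s0 s1); last by rewrite divr_gt0.
by move=> n0; exact: (partition_sum_half_frequent _ (ltW t0) b'0 b'b hZ).
Qed.

End Approximation.

(** * Semicontinuity *)

Section Semicontinuity.
Variable R : realType.
Implicit Types (c : torus R) (t : R) (n k : nat).

(** Bounds by real numbers suffice, also at infinite limits. *)
Lemma cvg_ereal_order {T : Type} (F : set_system T) {FF : Filter F} (f : T -> \bar R) l :
  (forall a : R, (a%:E < l)%E -> \forall x \near F, (a%:E < f x)%E) ->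
  (forall b : R, (l < b%:E)%E -> \forall x \near F, (f x < b%:E)%E) ->
  f x @[x --> F] --> l.
Proof.
move=> fa fb A; case: l fa fb => [r| |] fa fb.
- move=> -[/= e e0 eA].
  have h1 : \forall x \near F, ((r - e)%:E < f x)%E by apply: fa; rewrite lte_fin ltrBlDr ltrDl.
  have h2 : \forall x \near F, (f x < (r + e)%:E)%E by apply: fb; rewrite lte_fin ltrDl.
  apply: filterS2 h1 h2 => x; rewrite /preimage /=.
  case: (f x) => [y| |]//; rewrite !lte_fin => h3 h4; apply: eA => /=.
  by rewrite ltr_norml; apply/andP; split; lra.
- move=> -[M [_ MA]]; apply: filterS (fa M (ltry _)) => x; exact: MA.
- move=> -[M [_ MA]]; apply: filterS (fb M (ltNyr _)) => x; exact: MA.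
Qed.

Lemma continuous_sum_ord {T : topologicalType} m (f : 'I_m -> T -> R) (x : T) :
  (forall i, {for x, continuous (f i)}) -> {for x, continuous (fun y => \sum_i f i y)}.
Proof.
move=> h; elim: (index_enum _) => [|i r IH].
  have -> : (fun y : T => \sum_(i <- [::]) f i y) = cst 0.
    by apply/funext => y; rewrite big_nil.
  exact: cst_continuous.
have -> : (fun y : T => \sum_(j <- i :: r) f j y) = f i \+ (fun y => \sum_(j <- r) f j y).
  by apply/funext => y; rewrite big_cons.
by apply: (@continuousD R R^o _ _ _ x) => //; exact: h.
Qed.

Lemma continuous_cell_dist n k j : continuous (fun c => cell_dist n k c j).
Proof.
move=> c; rewrite /cell_dist.
apply: (@continuous_min R (torus R) (fun=> 1)
  (fun c => sg (base R n k *+ 2 ^ j - c) + pi * 2 ^+ j / 2 ^+ n)); first exact: cst_continuous.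
have h : sg (base R n k *+ 2 ^ j - x) @[x --> c] --> sg (base R n k *+ 2 ^ j - c).
  rewrite sgBC; under eq_fun do rewrite sgBC.
  exact: continuous_sgB.
exact: (@cvgD _ R^o _ _ _ _ (fun=> pi * 2 ^+ j / 2 ^+ n) _ _ h (cvg_cst _)).
Qed.

Lemma continuous_partition_sum n : continuous (fun ct : torus R * R => partition_sum n ct.1 ct.2).
Proof.
move=> ct.
have c1 : (fun x : torus R * R => x.1) @ ct --> ct.1 by exact: cvg_fst.
have c2 : (fun x : torus R * R => x.2) @ ct --> ct.2 by exact: cvg_snd.
apply: (@continuous_sum_ord (torus R * R)%type _
  (fun (k : 'I_(2 ^ n)) (x : torus R * R) => weight n x.1 x.2 k)) => k.
have c3 : {for ct, continuous (fun x : torus R * R => birkhoff n k x.1)}.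
  apply: (@continuous_sum_ord (torus R * R)%type _
    (fun (j : 'I_n) (x : torus R * R) => ln (cell_dist n k x.1 j))) => j.
  have c4 : (fun x : torus R * R => cell_dist n k x.1 j) @ ct --> cell_dist n k ct.1 j.
    exact: (cvg_comp _ _ c1 (@continuous_cell_dist n k j ct.1)).
  exact: (cvg_comp _ _ c4 (continuous_ln (cell_dist_gt0 _ _ _ _))).
have c5 : 2 * x.2 * birkhoff n k x.1 @[x --> ct] --> 2 * ct.2 * birkhoff n k ct.1.
  by apply: cvgM => //; apply: cvgM => //; exact: cvg_cst.
exact: (cvg_comp _ _ c5 (@continuous_expR R _)).
Qed.

(** Away from [c] the logarithm is Lipschitz, with constant [2 / d] on the
    relevant range. *)
Lemma psi_perturb (c c' x : torus R) (t t' d : R) : 0 <= t' -> 0 < d -> d <= 1 ->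
  d <= sg (x - c) -> 2 * sg (c' - c) <= d ->
  (t%:E * psi c x - (4 * t' * sg (c' - c) / d + 2 * `|t' - t| * - ln d)%:E <= t'%:E * psi c' x)%E.
Proof.
move=> t0 d0 d1 dx cd; set r := sg (c' - c) in cd *.
have r0 : 0 <= r by exact: sg_ge0.
have s0 : 0 < sg (x - c) by exact: lt_le_trans dx.
have near : sg (x - c) - r <= sg (x - c').
  by rewrite lerBlDr; exact: sg_triangle.
have s'0 : 0 < sg (x - c') by lra.
rewrite !psi_ln// -!EFinM -EFinB lee_fin.
have s1 : sg (x - c) <= 1 by exact: sg_le1.
move: s0 s'0 near dx s1; set s := sg (x - c); set s' := sg (x - c') => s0 s'0 near dx s1.
have u0 : 0 <= r / d by rewrite divr_ge0// ltW.
have l1 : ln s - 2 * (r / d) <= ln s'.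
  apply: (@le_trans _ _ (ln (s * (1 - r / d)))).
    have := ln_sub_ge u0; rewrite ler_pdivrMr// => /(_ _) h.
    have uh : r <= 1 / 2 * d by lra.
    rewrite lnM ?posrE//; first by have := h uh; lra.
    by rewrite subr_gt0 ltr_pdivrMr// mul1r; lra.
  rewrite ler_ln ?posrE//.
    apply: le_trans near; rewrite mulrBr mulr1 lerB// mulrA ler_pdivlMr//.
    by rewrite [s * r]mulrC ler_wpM2l.
  by rewrite mulr_gt0// subr_gt0 ltr_pdivrMr// mul1r; lra.
have l2 : ln d <= ln s by rewrite ler_ln ?posrE.
have l3 : ln s <= 0 by rewrite ln_le0.
have h1 : (t - t') * ln s <= `|t' - t| * - ln d.
  apply: (le_trans (ler_norm _)); rewrite normrM distrC ler_wpM2l//.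
  by rewrite ler0_norm// lerN2.
have h2 : 0 <= t' * (ln s' - (ln s - 2 * (r / d))) by rewrite mulr_ge0// subr_ge0.
have -> : 4 * t' * r / d = 4 * t' * (r / d) by rewrite mulrA.
move: h1 h2; move: (ln s) (ln s') (ln d) (r / d) `|t' - t|; clear => *; lra.
Qed.

(** The integrals may be infinite; they are compared through the opposite
    functions, which are nonnegative, after removing the null set. *)
Lemma integral_perturb (mu : probability (btorus R) R) (U : set (torus R)) (f g : btorus R -> \bar R) (e : R) :
  open U -> mu U = 0%E -> measurable_fun setT f -> measurable_fun setT g ->
  (forall x, f x <= 0)%E -> (forall x, g x <= 0)%E -> 0 <= e ->
  (forall x : torus R, ~ U x -> f x - e%:E <= g x)%E ->
  (\int[mu]_x f x - e%:E <= \int[mu]_x g x)%E.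
Proof.
move=> oU U0 mf mg f0 g0 e0 fg.
have mU : measurable (U : set (btorus R)) by exact: measurable_open_torus.
have neg (h : btorus R -> \bar R) : (forall x, h x <= 0)%E ->
    (\int[mu]_x h x = - \int[mu]_x (- h x))%E.
  move=> h0; rewrite -integral_ge0N => [|x _]; last by rewrite oppe_ge0.
  by apply: eq_integral => x _; rewrite oppeK.
have mN (h : btorus R -> \bar R) : measurable_fun setT h -> measurable_fun setT (fun x => - h x)%E.
  by move=> mh; exact: measurableT_comp.
rewrite (neg f f0) (neg g g0) -oppeD ?fin_num_adde_defl// leeN2.
have drop (h : btorus R -> \bar R) : measurable_fun setT h -> (forall x, 0 <= h x)%E ->
    (\int[mu]_x h x = \int[mu]_(x in setT `\` U) h x)%E.
  by move=> mh h0; apply: ge0_negligible_integral.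
rewrite (drop (fun x => - g x)%E) ?(drop (fun x => - f x)%E)//; try exact: mN;
  try by move=> x; rewrite oppe_ge0.
have mD : measurable (setT `\` (U : set (btorus R))) by exact: measurableD.
apply: (@le_trans _ _ (\int[mu]_(x in setT `\` U) (- f x + e%:E))%E).
  apply: ge0_le_integral => //.
  - by move=> x _; rewrite oppe_ge0.
  - by apply: measurable_funTS; exact: mN.
  - by apply: measurable_funTS; apply: emeasurable_funD => //; exact: mN.
  move=> x [_ nU]; have := fg x nU.
  by rewrite -leeN2 oppeB// fin_num_adde_defl.
rewrite ge0_integralD//.
- rewrite leeD2l// integral_cst// -[X in (_ <= X)%E]mule1 lee_wpmul2l ?lee_fin//.
  exact: probability_le1.
- by move=> x _; rewrite oppe_ge0.
- by apply: measurable_funTS; exact: mN.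
Qed.

Lemma pressure_usc c t (b : R) : 0 <= t -> (pressure c t < b%:E)%E ->
  \forall ct \near (c, t), 0 <= ct.2 -> (pressure ct.1 ct.2 < b%:E)%E.
Proof.
move=> t0 /(pressure_approx t0)[n n0 hn].
have cont : (fun ct : torus R * R => ln (partition_sum n ct.1 ct.2)) @ (c, t) --> ln (partition_sum n c t).
  exact: (cvg_comp _ _ (@continuous_partition_sum n (c, t)) (continuous_ln (partition_sum_gt0 _ _ _))).
have hn' : ln (partition_sum n c t) < b * n%:R by rewrite -ltr_pdivrMr// ltr0n.
have : \forall ct \near (c, t), ln (partition_sum n ct.1 ct.2) < b * n%:R.
  exact: (cvgr_lt _ cont).
apply: filterS => ct h ct0; apply: (le_lt_trans (pressure_le ct.1 n0 ct0)).
by rewrite lte_fin ltr_pdivrMr// ltr0n.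
Qed.

(** Room below the supremum, including the case of an infinite value. *)
Lemma lt_sub_exists (a : R) (x : \bar R) : (a%:E < x)%E ->
  exists2 e : R, 0 < e & (a%:E < x - e%:E)%E.
Proof.
case: x => [r| |//]; last by exists 1 => //; rewrite addye// ltry.
rewrite lte_fin => ar; exists ((r - a) / 2); first by rewrite divr_gt0// subr_gt0.
by rewrite -EFinB lte_fin; lra.
Qed.

Lemma pressure_lsc c t (a : R) : 0 <= t -> (a%:E < pressure c t)%E ->
  \forall ct \near (c, t), 0 <= ct.2 -> (a%:E < pressure ct.1 ct.2)%E.
Proof.
move=> t0 /ereal_sup_gt[_ [mu [inv nsupp] <-]] /lt_sub_exists[e e0 he].
have [U [oU Uc U0]] : exists U : set (torus R), [/\ open U, U c & mu U = 0%E].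
  apply: contrapT => H; apply: nsupp => U oU Uc.
  rewrite lt_neqAle measure_ge0 andbT eq_sym; apply/eqP => U0.
  by apply: H; exists U.
have [d' d'0 hd'] := nbhd_sg oU Uc.
pose d := Num.min d' 1.
have d0 : 0 < d by rewrite lt_min d'0/=.
have d1 : d <= 1 by rewrite ge_min lexx orbT.
have hd x : sg (x - c) < d -> U x.
  by move=> h; apply: hd'; rewrite (lt_le_trans h)// ge_min lexx.
pose r := Num.min (d / 2) (e * d / (8 * (t + 1))).
have t1 : 0 < t + 1 by rewrite ltr_wpDl.
have r0 : 0 < r by rewrite lt_min !divr_gt0 ?mulr_gt0.
have lnd : 0 <= - ln d by rewrite oppr_ge0 ln_le0.
pose w := Num.min 1 (e / (4 * (- ln d + 1))).
have lnd1 : 0 < - ln d + 1 by rewrite ltr_wpDl.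
have w0 : 0 < w by rewrite lt_min ltr01 divr_gt0 ?mulr_gt0.
have near1 : \forall ct \near (c, t), sg (ct.1 - c) < r.
  have : \forall c' \near c, sg (c' - c) < r.
    by apply: open_nbhs_nbhs; split; [exact: open_sgB|rewrite /= subrr sg0].
  exact: cvg_fst.
have near2 : \forall ct \near (c, t), `|ct.2 - t| < w.
  have : \forall t' \near t, `|t' - t| < w.
    by near=> t'; rewrite distrC; near: t'; exact: nbhsx_ballx.
  exact: cvg_snd.
apply: filterS2 near1 near2 => -[c' t'] /= cr tw t'0.
have supp' : ~ supp mu c'.
  move=> /(_ U oU) h; have := h (hd _ _); rewrite U0 ltxx => /(_ _)/notF; apply.
  rewrite (lt_le_trans cr)// /r ge_min; apply/orP; left; lra.
apply: (lt_le_trans he).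
apply: (@le_trans _ _ (ks_entropy (@doubling R : btorus R -> btorus R) mu +
          \int[mu]_(x in [set: btorus R]) (t'%:E * psi c' x))%E); last first.
  by apply: ereal_sup_ubound; exists mu.
rewrite -addeA; apply: leeD2l.
apply: (@integral_perturb mu U) => //.
- by apply: measurable_funeM; exact: measurable_psi.
- by apply: measurable_funeM; exact: measurable_psi.
- by move=> x; rewrite mule_ge0_le0 ?lee_fin// psi_le0.
- by move=> x; rewrite mule_ge0_le0 ?lee_fin// psi_le0.
- exact: ltW.
move=> x nU; have dx : d <= sg (x - c) by rewrite leNgt; apply/negP => /hd.
have rd : r <= d / 2 by rewrite ge_min lexx.
have cd : 2 * sg (c' - c) <= d by lra.
apply: le_trans (psi_perturb t t'0 d0 d1 dx cd); rewrite leeD2l// leeN2 lee_fin.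
have tt : t' <= t + 1.
  have : w <= 1 by rewrite ge_min lexx.
  by have := ler_norm (t' - t); lra.
have s0 : 0 <= sg (c' - c) by exact: sg_ge0.
have b1 : 4 * t' * sg (c' - c) / d <= e / 2.
  rewrite ler_pdivrMr//.
  have : r <= e * d / (8 * (t + 1)) by rewrite ge_min lexx orbT.
  rewrite ler_pdivlMr ?mulr_gt0// => hr; nra.
have b2 : 2 * `|t' - t| * - ln d <= e / 2.
  have : w <= e / (4 * (- ln d + 1)) by rewrite ge_min lexx orbT.
  rewrite ler_pdivlMr ?mulr_gt0//; have := normr_ge0 (t' - t); nra.
by lra.
Unshelve. all: by end_near. Qed.

End Semicontinuity.

Theorem corollary2p5 (R : realType) :
  {within [set ct : torus R * R | 0 <= ct.2],
    continuous (fun ct : torus R * R => pressure ct.1 ct.2)}.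
Proof.
apply/subspace_continuousP => -[c t] /= t0; apply: cvg_ereal_order => [a|b] h.
  exact: pressure_lsc.
exact: pressure_usc.
Qed.
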